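(* Let $0<q<1$ and $N\ge1$. The generating functionals $\psi$ on $U_q(N)$ are exactly the functionals of the form $\psi=\psi_G+\psi_L$, where $\psi_G$ is a gaussian generating functional and $\psi_L$ is a completely non-gaussian generating functional. For a given $\psi$ such a decomposition can be chosen maximal, i.e. as a Lévy-Khintchine decomposition (defined in the context), and among these decompositions $\psi_G$ and $\psi_L$ are unique under the condition $\psi_L\circ\mathcal P=\psi_L$. Moreover: (1) The possible gaussian parts $\psi_G$ are classified uniquely (one-to-one) by real positive (semidefinite, symmetric) $N\times N$-matrices $(r_{jk})_{j,k=2}^{N+1}$, encoding uniquely the part $\psi_G\circ\mathcal P$ of $\psi_G$, and $N$ real numbers $r_2,\dots,r_{N+1}$, encoding the remaining drift term; namely $\psi_G=\sum_{j=2}^{N+1} r_j\varepsilon'_j+\frac12\sum_{j,k=2}^{N+1} r_{jk}\varepsilon''_{jk}$. (2) The possible completely non-gaussian parts $\psi_L$ satisfying $\psi_L\circ\mathcal P=\psi_L$ are exactly the functionals $$\psi_L(a)=\langle f,\mathcal P(a)^{\pi^*}f\rangle_\pi\qquad(a\in U_q(N)),$$ where $\pi$ is a completely non-gaussian $*$-representation of $U_q(N)$ on a Hilbert space $H$ and $f\in H^\pi$ is such that the cocycle $\eta$ determined by $f$ (i.e. $\eta(\mathbf 1)=0$, $\eta(a)=a^\pi f$ for $a\in K_1$) is cyclic. The pair $(\pi,f)$ is determined by $\psi_L$ uniquely up to unitary equivalence: pairs $(\pi,f)$ and $(\pi',f')$ with cyclic cocycles $\eta,\eta'$ give the same $\psi_L$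 if and only if there is a unitary $V\colon H\to H'$ with $V\pi(a)=\pi'(a)V$ and $V\eta(a)=\eta'(a)$ for all $a\in U_q(N)$.
   Context: **The algebra.** Fix $0<q<1$. For $N\ge1$, $U_q(N)$ is the unital complex algebra generated by $u_{jk}$ $(1\le j,k\le N)$ and $D^{-1}$ subject to: $u_{ij}u_{kj}=qu_{kj}u_{ij}$ for $i<k$; $u_{ij}u_{il}=qu_{il}u_{ij}$ for $j<l$; $u_{ij}u_{kl}=u_{kl}u_{ij}$ for $i<k,\ j>l$; $u_{ij}u_{kl}=u_{kl}u_{ij}-(q^{-1}-q)u_{il}u_{kj}$ for $i<k,\ j<l$; and $D^{-1}D=\mathbf 1=DD^{-1}$, where $D=\sum_{\sigma\in S_N}(-q)^{i(\sigma)}u_{1,\sigma(1)}\cdots u_{N,\sigma(N)}$ (a central element) and $i(\sigma)$ is the number of inversions of $\sigma$. It is a $*$-algebra with $u_{jk}^*=(-q)^{k-j}D^{jk}D^{-1}$ and $(D^{-1})^*=D$, where $D^{jk}$ is the quantum determinant (same formula as $D$, inversions counted with respect to the natural order of the remaining indices) of the matrix $(u_{il})$ with row $j$ and column $k$ removed. One has $\sum_su_{js}u_{ks}^*=\delta_{jk}\mathbf 1=\sum_su_{sj}^*u_{sk}$, so $*$-representations are by bounded operators. The counit is the unital $*$-homomorphism $\varepsilon\colon U_q(N)\to\mathbb C$, $\varepsilon(u_{jk})=\delta_{jk}$, $\varepsilon(D^{-1})=1$. Put $K_n=\mathrm{span}\,(\ker\varepsilon)^n$; $K_1=\ker\varepsilon$.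 **Functionals, cocycles.** A generating functional is a linear functional $\psi$ that is hermitian ($\psi(b^* )=\overline{\psi(b)}$), satisfies $\psi(\mathbf 1)=0$, and $\psi(b^*b)\ge0$ for $b\in K_1$. A $*$-representation is a unital $*$-homomorphism into $B(H)$, $H$ a Hilbert space ($\{0\}$ allowed). A cocycle with respect to $\pi$ is a linear map $\eta\colon U_q(N)\to H$ with $\eta(ab)=\pi(a)\eta(b)+\eta(a)\varepsilon(b)$; it is cyclic if its range is dense. A Schürmann triple $(\pi,\eta,\psi)$ consists of a $*$-representation $\pi$, a cocycle $\eta$ with respect to $\pi$, and a linear functional $\psi$ with $\langle\eta(a),\eta(b)\rangle=\psi(a^*b)-\psi(a^* )\varepsilon(b)-\varepsilon(a^* )\psi(b)$ for all $a,b$. Every generating functional $\psi$ belongs to a Schürmann triple with cyclic $\eta$, unique up to unitary equivalence, called *the* Schürmann triple of $\psi$. **Gaussian / completely non-gaussian.** A generating functional is gaussian if it vanishes on $K_3$; a representation is gaussian if it vanishes on $K_1$. A representation is completely non-gaussian if $\{0\}$ is the only invariant subspace on which it restricts to a gaussian representation; a generating functional is completely non-gaussian if the representation in its Schürmann triple is. A drift is a generating functional vanishing on $K_2$. Given $\psi$ with Schürmann triple $(\pi,\eta,\psi)$, split $\pi=\pi_G\oplus\pi_{NG}$ with $\pi_G$ the restriction to $\bigcap_{a\in K_1}\ker\pi(a)$ and $\pi_{NG}$ the (completely non-gaussian) restriction to the orthogonal complement, and accordingly $\eta=\eta_G\oplus\eta_{NG}$. A Lévy-Khintchine decomposition of $\psi$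 is $\psi=\psi_G+\psi_L$ with generating functionals such that $(\pi_G,\eta_G,\psi_G)$ and $(\pi_{NG},\eta_{NG},\psi_L)$ are Schürmann triples. **$\mathcal P$ and derivatives.** Put $d_j=\frac{u_{jj}-u_{jj}^*}{2i}$ for $2\le j\le N$ and $d_{N+1}=\frac{D^{-1}-(D^{-1})^*}{2i}$. $\mathcal P$ is the linear projection of $U_q(N)$ onto $K_2$ with kernel $\mathrm{span}\{\mathbf 1,d_2,\dots,d_{N+1}\}$. For $\theta_2,\dots,\theta_{N+1}\in\mathbb R$ and $\theta_1=-\sum_{k=2}^{N+1}\theta_k$, let $\varepsilon_{\theta_2,\dots,\theta_{N+1}}$ be the $*$-homomorphism $U_q(N)\to\mathbb C$ with $u_{kl}\mapsto e^{i\theta_k}\delta_{kl}$ $(k,l\le N)$, $D^{-1}\mapsto e^{i\theta_{N+1}}$; $\varepsilon'_j$ and $\varepsilon''_{jk}$ are its pointwise derivatives $\partial/\partial\theta_j$, $\partial^2/\partial\theta_j\partial\theta_k$ at $0$. **The space $H^\pi$.** For a completely non-gaussian $*$-representation $\pi$ on $H$, $\|f\|_\pi=\bigl(\sum_{j=1}^N\|\pi(\mathbf 1-u_{jj})f\|^2+\|\pi(\mathbf 1-D^{-1})f\|^2\bigr)^{1/2}$ is a norm on $H$ coming from an inner product; $H^\pi$ is the completion, with inner product $\langle\cdot,\cdot\rangle_\pi$. For $a\in K_1$, $\pi(a)$ extends continuously to an operator $a^\pi\colon H^\pi\to H$. For $a\in K_2$ and $f\in H^\pi$, the functional $g\mapsto\langle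 a^\pi f,g\rangle$ on $H$ extends continuously to $H^\pi$, and $a^{\pi^*}f\in H^\pi$ is the unique element with $\langle a^{\pi^*}f,g\rangle_\pi=\langle a^\pi f,g\rangle$ for $g\in H$. *)

(* Defs.v *)
From HB Require Import structures.
From mathcomp Require Import all_boot all_order all_algebra all_fingroup.
From mathcomp Require Import generic_quotient ring_quotient.
From mathcomp Require Import all_classical all_reals all_analysis.
From mathcomp Require Import complex.
From mathcomp.multinomials Require monalg.
(* The notations of monalg are incompatible with those of the analysis library. *)
Import -(notations) monalg.

Set Implicit Arguments.
Unset Strict Implicit.
Unset Printing Implicit Defensive.

Import Order.TTheory GRing.Theory Num.Theory.
Import numFieldNormedType.Exports.

Local Open Scope classical_set_scope.
Local Open Scope ring_scope.
Local Open Scope quotient_scope.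

Section FreeAlgebra.
Variables (C : fieldType) (I : choiceType).

Definition freeAlg := malg (fmonom I) C.
HB.instance Definition _ := GRing.Lalgebra.on freeAlg.

Definition fgen (i : I) : freeAlg := mkmalgU (fmu i) 1.

Lemma free_scaleAr (c : C) (x y : freeAlg) : c *: (x * y) = x * (c *: y).
Proof.
apply/malgP => k; rewrite mcoeffZ mcoeffMl.
rewrite (mcoeffMlw _ (finmap.fsubset_refl _) (msuppZ_le c y)).
rewrite mulr_sumr; apply: eq_bigr => k1 _; rewrite mulr_sumr.
by apply: eq_bigr => k2 _; rewrite mcoeffZ mulrCA mulrnAr.
Qed.

Definition free_eval (g : I -> C) (x : freeAlg) : C :=
  mmap idfun (fun w : fmonom I => \prod_(i <- w) g i) x.

Section Eval.
Variable g : I -> C.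

Definition word_eval (w : fmonom I) : C := \prod_(i <- w) g i.

Fact word_eval_mmorphism : mmorphism word_eval.
Proof. by split=> [x y|]; rewrite /word_eval ?fmM ?big_cat ?fm1 ?big_nil. Qed.
HB.instance Definition _ :=
  isMultiplicative.Build (fmonom I) C word_eval word_eval_mmorphism.

Lemma free_evalD : {morph free_eval g : x y / x + y}.
Proof. exact: (mmapD (f := idfun) (h := word_eval)). Qed.

Lemma free_evalM : {morph free_eval g : x y / x * y}.
Proof. exact: (rmorphM (mmap idfun word_eval)). Qed.

Lemma free_eval1 : free_eval g 1 = 1.
Proof. exact: (rmorph1 (mmap idfun word_eval)). Qed.

Lemma free_evalZ c x : free_eval g (c *: x) = c * free_eval g x.
Proof. exact: (@mmapZ (fmonom I) C C idfun word_eval). Qed.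

Lemma free_eval0 : free_eval g 0 = 0.
Proof. exact: (raddf0 (mmap idfun word_eval)). Qed.

Lemma free_evalN x : free_eval g (- x) = - free_eval g x.
Proof. exact: (raddfN (mmap idfun word_eval)). Qed.

Lemma free_eval_gen i : free_eval g (fgen i) = g i.
Proof.
by rewrite /free_eval mmapU mul1r fmU big_seq1.
Qed.
End Eval.
End FreeAlgebra.

Section PresentedAlgebra.
Variables (C : fieldType) (I : choiceType) (rel : set (freeAlg C I)).

Inductive two_sided_ideal : freeAlg C I -> Prop :=
| ideal_rel a r b : rel r -> two_sided_ideal (a * r * b)
| ideal_0 : two_sided_ideal 0
| ideal_add x y :
    two_sided_ideal x -> two_sided_ideal y -> two_sided_ideal (x + y).

Lemma ideal_mull a x : two_sided_ideal x -> two_sided_ideal (a * x).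
Proof.
elim=> [b r c Hr||y z _ Hy _ Hz]; first by rewrite !mulrA; exact: ideal_rel.
  by rewrite mulr0; exact: ideal_0.
by rewrite mulrDr; exact: ideal_add.
Qed.

Lemma ideal_mulr a x : two_sided_ideal x -> two_sided_ideal (x * a).
Proof.
elim=> [b r c Hr||y z _ Hy _ Hz]; first by rewrite -!mulrA mulrA; exact: ideal_rel.
  by rewrite mul0r; exact: ideal_0.
by rewrite mulrDl; exact: ideal_add.
Qed.

Lemma ideal_scale c x : two_sided_ideal x -> two_sided_ideal (c *: x).
Proof. by rewrite -[x in c *: x]mul1r scalerAl; exact: ideal_mull. Qed.

Definition idealP : {pred freeAlg C I} := fun x => `[< two_sided_ideal x >].

Fact ideal_zmod_closed : zmod_closed idealP.
Proof.
split=> [|x y /asboolP Hx /asboolP Hy]; apply/asboolP; first exact: ideal_0.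
by apply: ideal_add => //; rewrite -scaleN1r; exact: ideal_scale.
Qed.
HB.instance Definition _ :=
  GRing.isZmodClosed.Build (freeAlg C I) idealP ideal_zmod_closed.

(* The quotient of the free algebra by the ideal generated by the relators. *)
Definition presAlg := Quotient.quot idealP.
HB.instance Definition _ := GRing.Zmodule.on presAlg.
HB.instance Definition _ := EqQuotient.on presAlg.

Definition pres_proj : freeAlg C I -> presAlg := \pi_presAlg.
Definition pres_gen (i : I) : presAlg := pres_proj (fgen C i).

Lemma pres_projP x y :
  reflect (two_sided_ideal (x - y)) (pres_proj x == pres_proj y).
Proof.
apply: (iffP idP); first by rewrite /pres_proj piE => /asboolP.
by move=> H; rewrite /pres_proj piE; apply/asboolP.
Qed.

Lemma pres_proj_eq x y : two_sided_ideal (x - y) -> pres_proj x = pres_proj y.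
Proof. by move=> /pres_projP/eqP. Qed.

Lemma pres_projK (x : presAlg) : pres_proj (repr x) = x.
Proof. exact: reprK. Qed.

Lemma pres_repr x : two_sided_ideal (repr (pres_proj x) - x).
Proof. by apply/pres_projP; rewrite pres_projK. Qed.

Lemma pres_projD : {morph pres_proj : x y / x + y}.
Proof. by move=> x y; rewrite /pres_proj !piE. Qed.

Definition pres_mul (x y : presAlg) : presAlg := pres_proj (repr x * repr y).
Definition pres_scale c (x : presAlg) : presAlg := pres_proj (c *: repr x).

Lemma pres_projM x y : pres_proj (x * y) = pres_mul (pres_proj x) (pres_proj y).
Proof.
apply/esym/pres_proj_eq.
have -> : repr (pres_proj x) * repr (pres_proj y) - x * y =
  (repr (pres_proj x) - x) * repr (pres_proj y) + x * (repr (pres_proj y) - y).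
  by rewrite mulrBl mulrBr addrA subrK.
by apply: ideal_add; [apply: ideal_mulr|apply: ideal_mull]; exact: pres_repr.
Qed.

Lemma pres_projZ c x : pres_proj (c *: x) = pres_scale c (pres_proj x).
Proof.
by apply/esym/pres_proj_eq; rewrite -scalerBr; apply: ideal_scale; exact: pres_repr.
Qed.

Fact pres_mulA : associative pres_mul.
Proof.
by move=> x y z; rewrite -[x]pres_projK -[y]pres_projK -[z]pres_projK
  -!pres_projM mulrA.
Qed.
Fact pres_mul1 : left_id (pres_proj 1) pres_mul.
Proof. by move=> x; rewrite -[x]pres_projK -!pres_projM mul1r. Qed.
Fact pres_mulr1 : right_id (pres_proj 1) pres_mul.
Proof. by move=> x; rewrite -[x]pres_projK -!pres_projM mulr1. Qed.
Fact pres_mulDl : left_distributive pres_mul +%R.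
Proof.
by move=> x y z; rewrite -[x]pres_projK -[y]pres_projK -[z]pres_projK
  -!(pres_projM, pres_projD) mulrDl.
Qed.
Fact pres_mulDr : right_distributive pres_mul +%R.
Proof.
by move=> x y z; rewrite -[x]pres_projK -[y]pres_projK -[z]pres_projK
  -!(pres_projM, pres_projD) mulrDr.
Qed.
HB.instance Definition _ := GRing.Zmodule_isPzRing.Build presAlg
  pres_mulA pres_mul1 pres_mulr1 pres_mulDl pres_mulDr.

Fact pres_scaleA a b x : pres_scale a (pres_scale b x) = pres_scale (a * b) x.
Proof. by rewrite -[x]pres_projK -!pres_projZ scalerA. Qed.
Fact pres_scale1 : left_id 1 pres_scale.
Proof. by move=> x; rewrite -[x]pres_projK -!pres_projZ scale1r. Qed.
Fact pres_scaleDr : right_distributive pres_scale +%R.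
Proof.
by move=> c x y; rewrite -[x]pres_projK -[y]pres_projK
  -!(pres_projZ, pres_projD) scalerDr.
Qed.
Fact pres_scaleDl x : {morph pres_scale^~ x : a b / a + b}.
Proof.
by move=> a b /=; rewrite -[x]pres_projK -!pres_projZ -pres_projD scalerDl.
Qed.
HB.instance Definition _ := GRing.Zmodule_isLmodule.Build C presAlg
  pres_scaleA pres_scale1 pres_scaleDr pres_scaleDl.

Fact pres_scaleAl c (x y : presAlg) : c *: (x * y) = (c *: x) * y.
Proof.
by rewrite -[x]pres_projK -[y]pres_projK -[LHS]/(pres_scale _ (pres_mul _ _))
  -[RHS]/(pres_mul (pres_scale _ _) _) -!(pres_projZ, pres_projM) scalerAl.
Qed.
Fact pres_scaleAr c (x y : presAlg) : c *: (x * y) = x * (c *: y).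
Proof.
by rewrite -[x]pres_projK -[y]pres_projK -[LHS]/(pres_scale _ (pres_mul _ _))
  -[RHS]/(pres_mul _ (pres_scale _ _)) -!(pres_projZ, pres_projM) free_scaleAr.
Qed.

(* The character with values g on the generators. It is meaningful only if g
   satisfies the relations, in which case pres_charE applies. *)
Definition pres_char (g : I -> C) (x : presAlg) : C := free_eval g (repr x).

Section Char.
Variable g : I -> C.
Hypothesis g_rel : forall r, rel r -> free_eval g r = 0.

Lemma free_eval_ideal x : two_sided_ideal x -> free_eval g x = 0.
Proof.
elim=> [a r b Hr||y z _ Hy _ Hz]; last by rewrite free_evalD Hy Hz addr0.
  by rewrite !free_evalM (g_rel Hr) mulr0 mul0r.
exact: free_eval0.
Qed.

Lemma pres_charE x : pres_char g (pres_proj x) = free_eval g x.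
Proof.
apply/eqP; rewrite -subr_eq0 -free_evalN -free_evalD; apply/eqP.
exact: free_eval_ideal (pres_repr x).
Qed.

Lemma pres_char1 : pres_char g 1 = 1.
Proof. by rewrite -[1 in LHS]/(pres_proj 1) pres_charE free_eval1. Qed.

Lemma pres_charM : {morph pres_char g : x y / x * y}.
Proof.
move=> x y; rewrite -[x]pres_projK -[y]pres_projK.
by rewrite -[_ * _ in LHS]/(pres_mul _ _) -pres_projM !pres_charE free_evalM.
Qed.

Lemma pres_char_scalar : scalar (pres_char g).
Proof.
move=> c x y; rewrite -[x]pres_projK -[y]pres_projK.
by rewrite -[_ *: _ in LHS]/(pres_scale _ _) -pres_projZ -pres_projD
  !pres_charE free_evalD free_evalZ.
Qed.

Lemma pres_char_gen i : pres_char g (pres_gen i) = g i.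
Proof. by rewrite pres_charE free_eval_gen. Qed.
End Char.
End PresentedAlgebra.

Section QuantumUnitaryGroup.
Variables (C : fieldType) (q : C).

Definition inversions n (s : 'S_n) : nat :=
  #|[pred p : 'I_n * 'I_n | (p.1 < p.2)%N && (s p.2 < s p.1)%N]|.

Definition qdet (A : lalgType C) n (M : 'M[A]_n) : A :=
  \sum_(s : 'S_n) (- q) ^+ inversions s *: \prod_(i < n) M i (s i).

Variable N : nat.

(* Some (j, k) stands for u_jk and None for D^-1. *)
Definition Uq_index : Type := option ('I_N * 'I_N).
HB.instance Definition _ := Choice.on Uq_index.

Let x (j k : 'I_N) : freeAlg C Uq_index := fgen C (Some (j, k)).
Let y : freeAlg C Uq_index := fgen C None.
Let Dx : freeAlg C Uq_index := qdet (\matrix_(j, k) x j k).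

Inductive Uq_relator : freeAlg C Uq_index -> Prop :=
| Uq_col (i j k : 'I_N) : (i < k)%N ->
    Uq_relator (x i j * x k j - q *: (x k j * x i j))
| Uq_row (i j l : 'I_N) : (j < l)%N ->
    Uq_relator (x i j * x i l - q *: (x i l * x i j))
| Uq_anti (i j k l : 'I_N) : (i < k)%N -> (l < j)%N ->
    Uq_relator (x i j * x k l - x k l * x i j)
| Uq_diag (i j k l : 'I_N) : (i < k)%N -> (j < l)%N ->
    Uq_relator (x i j * x k l
      - (x k l * x i j - (q^-1 - q) *: (x i l * x k j)))
| Uq_invl : Uq_relator (y * Dx - 1)
| Uq_invr : Uq_relator (Dx * y - 1).

Definition Uq : Type := presAlg Uq_relator.
HB.instance Definition _ := GRing.PzRing.on Uq.
HB.instance Definition _ := GRing.Lmodule.on Uq.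

(* The unital homomorphism u_jk |-> t_j delta_jk, D^-1 |-> s. *)
Definition Uq_diag_value (t : 'I_N -> C) (s : C) (i : Uq_index) : C :=
  if i is Some (j, k) then t j *+ (j == k) else s.

Definition Uq_char (t : 'I_N -> C) (s : C) : Uq -> C :=
  pres_char (Uq_diag_value t s).

Lemma inversions1 n : inversions (1 : 'S_n) = 0%N.
Proof.
apply: eq_card0 => p; rewrite !inE !perm1.
by apply/negbTE/negP => /andP[/ltn_trans H /H]; rewrite ltnn.
Qed.

Lemma Uq_diag_value_rel (t : 'I_N -> C) (s : C) :
  (\prod_i t i) * s = 1 ->
  forall r, Uq_relator r -> free_eval (Uq_diag_value t s) r = 0.
Proof.
set g := Uq_diag_value t s => ts.
have evx j k : free_eval g (x j k) = t j *+ (j == k).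
  by rewrite free_eval_gen.
have evB a b : free_eval g (a - b) = free_eval g a - free_eval g b.
  by rewrite free_evalD free_evalN.
have evD : free_eval g Dx = \prod_i t i.
  rewrite /Dx /qdet (big_morph _ (free_evalD g) (free_eval0 g)).
  rewrite (bigD1 1%g) //= [X in _ + X]big1 ?addr0 => [|s0 s1].
    rewrite inversions1 expr0 scale1r (big_morph _ (free_evalM g) (free_eval1 g)).
    by apply: eq_bigr => i _; rewrite mxE evx perm1 eqxx.
  rewrite free_evalZ (big_morph _ (free_evalM g) (free_eval1 g)).
  suff [i si] : exists i, s0 i != i.
    by rewrite (bigD1 i) //= mxE evx eq_sym (negbTE si) mul0r mulr0.
  apply/existsP; rewrite -negb_forall; apply: contra s1 => /forallP s1.
  by apply/eqP/permP => i; rewrite perm1; apply/eqP.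
have ne (a b : 'I_N) : (a < b)%N -> (a == b) = false.
  by move=> ab; apply/eqP => e; move: ab; rewrite e ltnn.
have en (a b : 'I_N) : (a < b)%N -> (b == a) = false.
  by rewrite eq_sym; exact: ne.
have z (a : C) : a *+ false = 0 by [].
have eqB a b : free_eval g a = free_eval g b -> free_eval g (a - b) = 0.
  by move=> e; rewrite evB e subrr.
have evxx a b c d : free_eval g (x a b * x c d)
    = t a *+ (a == b) * (t c *+ (c == d)) by rewrite free_evalM 2!evx.
have evZ p a b c d : free_eval g (p *: (x a b * x c d))
    = p * (t a *+ (a == b) * (t c *+ (c == d))) by rewrite free_evalZ evxx.
move=> r [i j k ik|i j l jl|i j k l ik lj|i j k l ik jl||].
- apply/eqB/(etrans (evxx i j k j))/esym/(etrans (evZ q k j i j)).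
  have [e|_] := eqVneq i j; last by rewrite z mul0r mulr0 mulr0.
  by rewrite -e (en _ _ ik) z mulr0 mul0r mulr0.
- apply/eqB/(etrans (evxx i j i l))/esym/(etrans (evZ q i l i j)).
  have [e|_] := eqVneq i j; last by rewrite z mul0r mulr0 mulr0.
  by rewrite e (ne _ _ jl) z mulr0 mul0r mulr0.
- by apply/eqB/(etrans (evxx i j k l))/esym/(etrans (evxx k l i j)); rewrite mulrC.
- apply/eqB/(etrans (evxx i j k l))/esym/(etrans (evB _ _)).
  have -> := evZ (q^-1 - q) i l k j; have -> := evxx k l i j.
  rewrite mulrC; apply/eqP; rewrite subr_eq addrC -subr_eq subrr eq_sym; apply/eqP.
  have [il|_] := eqVneq i l; last by rewrite z mul0r mulr0.
  have [kj|_] := eqVneq k j; last by rewrite z !mulr0.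
  by move: jl; rewrite -kj -il => /(ltn_trans ik); rewrite ltnn.
- by rewrite evB free_evalM evD free_eval_gen free_eval1 mulrC ts subrr.
- by rewrite evB free_evalM evD free_eval_gen free_eval1 ts subrr.
Qed.

Fact Uq_nonzero : (1 : Uq) != 0.
Proof.
have g_rel := @Uq_diag_value_rel (fun=> 1) 1.
rewrite big1 // mulr1 in g_rel; have {}g_rel := g_rel erefl.
apply/eqP => e10; have := pres_char_scalar g_rel (-1) 1 1.
rewrite scaleN1r addNr -[X in pres_char _ X]e10 (pres_char1 g_rel) mulr1 addNr.
by move/eqP; rewrite oner_eq0.
Qed.
HB.instance Definition _ := GRing.PzSemiRing_isNonZero.Build Uq Uq_nonzero.
HB.instance Definition _ :=
  GRing.Lmodule_isLalgebra.Build C Uq (@pres_scaleAl _ _ Uq_relator).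
HB.instance Definition _ :=
  GRing.Lalgebra_isAlgebra.Build C Uq (@pres_scaleAr _ _ Uq_relator).

Definition Uq_u : 'M[Uq]_N := \matrix_(j, k) pres_gen Uq_relator (Some (j, k)).
Definition Uq_Dinv : Uq := pres_gen Uq_relator None.
Definition Uq_D : Uq := qdet Uq_u.

Section Char.
Variables (t : 'I_N -> C) (s : C).
Hypothesis ts : (\prod_i t i) * s = 1.

Lemma Uq_char1 : Uq_char t s 1 = 1.
Proof. exact: pres_char1 (Uq_diag_value_rel ts). Qed.

Lemma Uq_charM : {morph Uq_char t s : a b / a * b}.
Proof. exact: pres_charM (Uq_diag_value_rel ts). Qed.

Lemma Uq_char_scalar : scalar (Uq_char t s).
Proof. exact: pres_char_scalar (Uq_diag_value_rel ts). Qed.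

Lemma Uq_char_u j k : Uq_char t s (Uq_u j k) = t j *+ (j == k).
Proof.
by rewrite mxE; exact: pres_char_gen (Uq_diag_value_rel ts) (Some (j, k)).
Qed.

Lemma Uq_char_Dinv : Uq_char t s Uq_Dinv = s.
Proof. exact: pres_char_gen (Uq_diag_value_rel ts) None. Qed.
End Char.

Definition counit : Uq -> C := Uq_char (fun=> 1) 1.

End QuantumUnitaryGroup.

(* Inner products are antilinear in the first and linear in the second
   argument. *)
HB.mixin Record NormedModule_hasInner (C : numClosedFieldType) H
    & NormedModule C H := {
  inner : H -> H -> C;
  inner_linear : forall x, scalar (inner x);
  inner_conj : forall x y, inner y x = (inner x y)^*;
  inner_norm : forall x, inner x x = `|x| ^+ 2
}.

#[short(type="hilbertType")]
HB.structure Definition Hilbert (C : numClosedFieldType) :=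
  {H of CompleteNormedModule C H & NormedModule_hasInner C H}.

Section HilbertSpaces.
Variable C : numClosedFieldType.

Definition ortho (H : hilbertType C) (S : set H) : set H :=
  [set x | forall y, S y -> inner y x = 0].

Definition isometry (H H' : hilbertType C) (V : H -> H') :=
  linear V /\ forall x y, inner (V x) (V y) = inner x y.

Definition unitary (H H' : hilbertType C) (V : H -> H') :=
  isometry V /\ range V = setT.

Definition lspan (V : lmodType C) (S : set V) : set V :=
  [set x | exists (n : nat) (c : 'I_n -> C) (v : 'I_n -> V),
     (forall i, S (v i)) /\ x = \sum_i c i *: v i].

Definition subspace_set (V : lmodType C) (S : set V) :=
  S 0 /\ forall c x y, S x -> S y -> S (c *: x + y).

End HilbertSpaces.

Section GeneratingFunctionals.
Variables (C : numClosedFieldType) (q : C) (N : nat).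
Local Notation A := (Uq q N).
Local Notation u := (Uq_u q N).
Local Notation Dinv := (Uq_Dinv q N).
Local Notation eps := (@counit C q N).

Definition is_Uq_star (s : A -> A) : Prop :=
  [/\ forall c a b, s (c *: a + b) = c^* *: s a + s b,
      forall a b, s (a * b) = s b * s a,
      forall a, s (s a) = a,
      forall j k, s (u j k) =
        (- q) ^ (k%:Z - j%:Z) *: (qdet q (row' j (col' k u)) * Dinv)
    & s Dinv = Uq_D q N].

(* A map satisfying is_Uq_star is determined by its values on the generators;
   for real q != 0 it exists. *)
Definition Uq_star : A -> A := xget (fun a : A => a) is_Uq_star.

(* K_n is the span of the n-fold products of elements of the kernel of the
   counit. *)
Definition Kpow (n : nat) : set A :=
  lspan [set a | exists x : 'I_n -> A,
           (forall i, eps (x i) = 0) /\ a = \prod_(i < n) x i].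

Definition generating_functional (psi : A -> C) :=
  [/\ scalar psi, forall b, psi (Uq_star b) = (psi b)^*, psi 1 = 0
    & forall b, Kpow 1 b -> 0 <= psi (Uq_star b * b)].

Definition drift (psi : A -> C) :=
  generating_functional psi /\ forall a, Kpow 2 a -> psi a = 0.

Definition gaussian (psi : A -> C) :=
  generating_functional psi /\ forall a, Kpow 3 a -> psi a = 0.

Section Representations.
Variables (H : hilbertType C) (pi : A -> H -> H).

Definition star_rep :=
  [/\ (forall a, linear (pi a)) /\ (forall a, continuous (pi a)),
      forall c a b x, pi (c *: a + b) x = c *: pi a x + pi b x,
      forall x, pi 1 x = x,
      forall a b x, pi (a * b) x = pi a (pi b x)
    & forall a x y, inner (pi (Uq_star a) x) y = inner x (pi a y)].

Definition cocycle (eta : A -> H) :=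
  linear eta /\ forall a b, eta (a * b) = pi a (eta b) + eps b *: eta a.

Definition cyclic_cocycle (eta : A -> H) := dense (range eta).

Definition schurmann_triple (eta : A -> H) (psi : A -> C) :=
  [/\ star_rep, cocycle eta, scalar psi
    & forall a b, inner (eta a) (eta b) =
        psi (Uq_star a * b) - psi (Uq_star a) * eps b - eps (Uq_star a) * psi b].

Definition gaussian_part : set H :=
  [set x | forall a, Kpow 1 a -> pi a x = 0].

Definition completely_nongaussian_rep :=
  forall S : set H, subspace_set S -> closed S ->
    (forall a x, S x -> S (pi a x)) ->
    (forall a x, Kpow 1 a -> S x -> pi a x = 0) ->
    S = [set 0].

End Representations.

Definition completely_nongaussian (psi : A -> C) :=
  generating_functional psi /\
  exists (H : hilbertType C) (pi : A -> H -> H) (eta : A -> H),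
    [/\ schurmann_triple pi eta psi, cyclic_cocycle eta
      & completely_nongaussian_rep pi].

(* (pi', H') is, through the isometry j, the restriction of pi to the closed
   invariant subspace S of H. *)
Definition restricts_to (H H' : hilbertType C) (pi : A -> H -> H) (S : set H)
    (j : H' -> H) (pi' : A -> H' -> H') :=
  [/\ isometry j, range j = S & forall a x, j (pi' a x) = pi a (j x)].

Definition levy_khintchine (psi psiG psiL : A -> C) :=
  [/\ generating_functional psiG, generating_functional psiL,
      forall a, psi a = psiG a + psiL a
    & exists (H : hilbertType C) (pi : A -> H -> H) (eta : A -> H),
      [/\ schurmann_triple pi eta psi, cyclic_cocycle eta
        & exists (HG HN : hilbertType C) (jG : HG -> H) (jN : HN -> H)
            (piG : A -> HG -> HG) (piN : A -> HN -> HN)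
            (etaG : A -> HG) (etaN : A -> HN),
          [/\ restricts_to pi (gaussian_part pi) jG piG,
              restricts_to pi (ortho (gaussian_part pi)) jN piN,
              forall a, eta a = jG (etaG a) + jN (etaN a),
              schurmann_triple piG etaG psiG
            & schurmann_triple piN etaN psiL]]].

(* The indices 1, ..., N + 1 are represented by 'I_N.+1; the indices
   2, ..., N + 1 by 'I_N through lift ord0. *)
Definition diag_gen (k : 'I_N.+1) : A :=
  if unlift ord_max k is Some j then u j j else Dinv.

Definition dgen (i : 'I_N) : A :=
  let g := diag_gen (lift ord0 i) in (2 * 'i)^-1 *: (g - Uq_star g).

Definition is_projP (P : A -> A) : Prop :=
  [/\ linear P, range P = Kpow 2, forall a, Kpow 2 a -> P a = a
    & [set a | P a = 0] = lspan ([set 1] `|` range dgen)].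

(* The map satisfying is_projP is unique: a linear projection is determined by
   its range and its kernel. *)
Definition projP : A -> A := xget (fun a : A => a) is_projP.

Section CompletionPi.
Variables (H : hilbertType C) (pi : A -> H -> H).

Definition inner_pi (f g : H) : C :=
  \sum_(j < N) inner (pi (1 - u j j) f) (pi (1 - u j j) g)
  + inner (pi (1 - Dinv) f) (pi (1 - Dinv) g).

Definition completion_pi (Hpi : hilbertType C) (iota : H -> Hpi) :=
  [/\ linear iota, forall f g, inner (iota f) (iota g) = inner_pi f g
    & dense (range iota)].

Variables (Hpi : hilbertType C) (iota : H -> Hpi).

(* The continuous extension a^pi : H^pi -> H of pi a, meaningful for a in K_ 1. *)
Definition pi_ext (a : A) : Hpi -> H :=
  xget (fun=> 0)
    [set T | [/\ linear T, continuous T & forall f, T (iota f) = pi a f]].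

(* The adjoint extension a^{pi*} : H^pi -> H^pi, meaningful for a in K_ 2. *)
Definition pi_ext_adj (a : A) (f : Hpi) : Hpi :=
  xget 0 [set h | forall g : H, inner h (iota g) = inner (pi_ext a f) g].

Definition pi_cocycle (f : Hpi) (a : A) : H := pi_ext (a - eps a *: 1) f.

Definition pi_functional (f : Hpi) (a : A) : C := inner f (pi_ext_adj (projP a) f).

Definition nongaussian_pair (f : Hpi) :=
  [/\ star_rep pi, completely_nongaussian_rep pi, completion_pi iota
    & cyclic_cocycle (pi_cocycle f)].

End CompletionPi.
End GeneratingFunctionals.

Arguments Uq_star {C} q N _.
Arguments projP {C} q N _.

Section GaussianFunctionals.
Variables (R : realType) (q : R) (N : nat).
Local Notation A := (Uq q%:C%C N).

Definition expi (t : R) : R[i] := (cos t +i* sin t)%C.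

(* theta_1, ..., theta_(N+1), with theta_1 = - \sum_k theta_k. *)
Definition angle (theta : 'rV[R]_N) (k : 'I_N.+1) : R :=
  if unlift ord0 k is Some i then theta 0 i else - \sum_i theta 0 i.

Definition eps_theta (theta : 'rV[R]_N) : A -> R[i] :=
  Uq_char (fun k => expi (angle theta (lift ord_max k)))
          (expi (angle theta ord_max)).

Lemma expiD (s t : R) : expi (s + t) = expi s * expi t.
Proof. by rewrite /expi cosD sinD; apply/eqP; rewrite eq_complex /= addrC eqxx andTb addrC. Qed.

(* By this identity the lemmas on Uq_char apply to eps_theta. *)
Lemma eps_theta_rel (theta : 'rV[R]_N) :
  (\prod_(k < N) expi (angle theta (lift ord_max k)))
  * expi (angle theta ord_max) = 1.
Proof.
have -> : \prod_(k < N) expi (angle theta (lift ord_max k)) =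
    \prod_(k < N) expi (angle theta (widen_ord (leqnSn N) k)).
  by apply: eq_bigr => k _; congr (expi (angle theta _)); apply: val_inj => /=;
    rewrite /bump leqNgt ltn_ord.
rewrite -(big_ord_recr N (fun k => expi (angle theta k))) /=.
have e0 : expi 0 = 1 by rewrite /expi cos0 sin0.
rewrite -(big_morph _ expiD e0) big_ord_recl /angle unlift_none.
rewrite [X in _ + X](eq_bigr (fun i => theta 0 i)) => [|i _]; last by rewrite liftK.
by rewrite addNr.
Qed.

Definition partial (j : 'I_N) (F : 'rV[R]_N -> R[i]) (theta : 'rV[R]_N) : R[i] :=
  ('D_(delta_mx 0 j) (fun t => complex.Re (F t)) theta
   +i* 'D_(delta_mx 0 j) (fun t => complex.Im (F t)) theta)%C.

Definition eps1 (j : 'I_N) (a : A) : R[i] := partial j (eps_theta^~ a) 0.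

Definition eps2 (j k : 'I_N) (a : A) : R[i] :=
  partial j (partial k (eps_theta^~ a)) 0.

Definition psd (M : 'M[R]_N) :=
  M^T = M /\ forall x : 'rV[R]_N, 0 <= (x *m M *m x^T) 0 0.

Definition drift_term (r : 'rV[R]_N) (a : A) : R[i] :=
  \sum_j (r 0 j)%:C%C * eps1 j a.

Definition quadratic_term (M : 'M[R]_N) (a : A) : R[i] :=
  2^-1 * \sum_j \sum_k (M j k)%:C%C * eps2 j k a.

End GaussianFunctionals.

(* Main.v *)
(* Gaussian functionals: ker eps is spanned modulo K_2 by the d_j, and the
   commutators [d_j, d_k] lie in K_3, so a functional vanishing on K_3 is
   determined by its values on 1, d_j and d_j d_k; these give the vector r and
   the symmetric matrix M.

   Levy-Khintchine decomposition: for every *-representation pi and cocycle eta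
   there are vectors f_n such that pi(a - eps(a)) f_n converges, for every a, to
   the non-gaussian part of eta(a). They are found by descending induction on k:
   if all u_jj with j > k fix the range of eta, put
   f = (1 - r pi(u_kk))^-1 (- eta(u_kk)) and let r tend to 1; by the mean
   ergodic theorem and the commutation relations pi(a - eps(a)) f tends to
   eta(a) - zeta(a) for a cocycle zeta whose range is fixed by u_kk, too.
   Then psi_L(a) = lim <f_n, pi(P a) f_n> exists, depends on K_2 only through
   the non-gaussian part of the cocycle, and psi - psi_L is gaussian. The f_n
   are Cauchy for the norm of H^pi when pi is completely non-gaussian, and
   their limit is the vector representing the cocycle. *)
From HB Require Import structures.
From mathcomp Require Import all_boot all_order all_algebra all_fingroup.
From mathcomp Require Import all_classical all_reals all_analysis.
From mathcomp Require Import complex zify ring lra.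
From mathcomp.multinomials Require monalg.
Import -(notations) monalg.
Require Import Defs.
Set Implicit Arguments.
Unset Strict Implicit.
Unset Printing Implicit Defensive.
Import Order.TTheory GRing.Theory Num.Theory.
Import numFieldNormedType.Exports.
Local Open Scope ring_scope.

(** * Quantum determinants *)

(** [Uq_star] and [projP] are chosen by description, so their existence is part of the proof. For
    the star one must show that the inverse of [u] is a quantum matrix over the opposite algebra,
    with determinant [Dinv]; the theory of quantum determinants serves this purpose.

    The obstacle in the decomposition is that over a general involutive algebra a cocycle need not
    belong to any functional. Here the non-gaussian part of every cocycle is a limit of
    coboundaries, and a coboundary of f has the Gram form <f, pi(star a b) f>, so a functional on
    K_2 arises as a limit. The vectors f_n need not converge in [H]; their limit lives in H^pi.

    Ergodic averaging alone controls only elements commuting with u_kk. The off-diagonal generators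
    with largest index k commute with u_kk up to a factor q, and since q < 1 the operator 1 - q
    pi(u_kk) is bounded below. This gap settles these generators and also absorbs the error which
    they cause in the commutation relations of the remaining ones. *)

Section Inversions.

(** Arbitrary maps are allowed, since the Laplace expansions below select rows by maps that may
    repeat an index. *)
Definition ninv n (f : 'I_n -> 'I_n) : nat :=
  #|[pred p : 'I_n * 'I_n | (p.1 < p.2)%N && (f p.2 < f p.1)%N]|.

Lemma ninv_sum n (f : 'I_n -> 'I_n) :
  ninv f = (\sum_(a < n) \sum_(b < n) ((a < b) && (f b < f a)))%N.
Proof.
rewrite /ninv -sum1_card pair_big /= big_mkcond /=.
by apply: eq_bigr => -[a b] _ /=; rewrite unfold_in /=; case: (_ && _).
Qed.

Lemma eq_ninv n (f g : 'I_n -> 'I_n) : f =1 g -> ninv f = ninv g.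
Proof. by move=> fg; apply: eq_card => p; rewrite !inE !fg. Qed.

(** The first position, with value [k], is inverted exactly with the positions of the [k] smaller
    values; [lift k] is increasing and preserves the inversions of [s]. *)
Lemma ninv_lift0 n (f : 'I_n.+1 -> 'I_n.+1) (k : 'I_n.+1) (s : 'S_n) :
  f ord0 = k -> (forall i, f (lift ord0 i) = lift k (s i)) ->
  ninv f = (k + ninv s)%N.
Proof.
move=> f0 fl; rewrite ninv_sum big_ord_recl /=; congr addn.
  rewrite big_ord_recl /= add0n.
  transitivity (\sum_(b < n) (b < k : nat))%N.
    rewrite [RHS](reindex_inj (@perm_inj _ s)) /=; apply: eq_bigr => b _.
    by rewrite f0 fl /= /bump; congr nat_of_bool; case: leqP => /=; lia.
  rewrite -big_mkcond /= sum1_card.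
  have -> : #|[pred b : 'I_n | (b < k)%N]| = #|[pred b : 'I_n | (b < k)%N]| by [].
  have kn : (k <= n)%N by rewrite -ltnS.
  rewrite -[RHS]card_ord -(fintype.card_image (f := widen_ord kn)) //; last first.
    by move=> x y /(congr1 val) /= /val_inj.
  apply: eq_card => b; rewrite !inE; apply/idP/fintype.imageP => [bk|[x _ ->]].
    by exists (Ordinal bk) => //; exact: val_inj.
  exact: (ltn_ord x).
rewrite ninv_sum; apply: eq_bigr => a _; rewrite big_ord_recl /= add0n.
by apply: eq_bigr => b _; rewrite !fl !ltnNge !leq_bump2 negbK.
Qed.

Lemma ninv_lift_max n (f : 'I_n.+1 -> 'I_n.+1) (k : 'I_n.+1) (s : 'S_n) :
  f ord_max = k -> (forall i, f (lift ord_max i) = lift k (s i)) ->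
  ninv f = (n - k + ninv s)%N.
Proof.
have wl i : widen_ord (leqnSn n) i = lift ord_max i.
  by apply: val_inj; rewrite /= /bump leqNgt ltn_ord.
move=> fm fl; rewrite ninv_sum big_ord_recr /= [X in (_ + X)%N]big1 ?addn0; last first.
  by move=> b _; rewrite ltnNge -ltnS ltn_ord.
under eq_bigr do rewrite big_ord_recr /= wl fl fm ltn_ord /=.
rewrite big_split /= addnC; congr addn.
  transitivity (\sum_(b < n) (k <= b : nat))%N.
    rewrite [RHS](reindex_inj (@perm_inj _ s)) /=; apply: eq_bigr => b _.
    by rewrite /= /bump; congr nat_of_bool; case: leqP => /=; lia.
  have kn : (k <= n)%N by rewrite -ltnS.
  rewrite -(big_mkord xpredT (fun b => (k <= b)%N : nat)).
  rewrite (@big_cat_nat _ _ _ k) //= big1_seq; last first.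
    by move=> b; rewrite mem_index_iota => /andP[_ /andP[_ bk]]; rewrite leqNgt bk.
  rewrite add0n (eq_big_nat _ _ (F2 := fun=> 1%N)); last by move=> b /andP[-> _].
  by rewrite sum_nat_const_nat muln1.
rewrite ninv_sum; apply: eq_bigr => a _; apply: eq_bigr => b _.
by rewrite !wl !fl !ltnNge leq_bump2.
Qed.

Lemma tperm_adj_lt n (i i' a b : 'I_n) : i' = i.+1 :> nat ->
  (a, b) != (i, i') -> (a < b)%N -> (tperm i i' a < tperm i i' b)%N.
Proof.
move=> ii' ab lt_ab.
case: tpermP => [ea|ea|/eqP + /eqP]; case: tpermP => [eb|eb|/eqP + /eqP];
  rewrite -?val_eqE /=; move: ab lt_ab; rewrite xpair_eqE -!val_eqE /=;
  rewrite ?ea ?eb; lia.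
Qed.

(** On every pair other than (i, i') the transposition is increasing, so it matches the old
    inversions bijectively with new ones; (i, i') itself becomes one more. *)
Lemma ninv_swap n (f : 'I_n -> 'I_n) (i i' : 'I_n) : i' = i.+1 :> nat ->
  (f i < f i')%N -> ninv (f \o tperm i i') = (ninv f).+1.
Proof.
move=> ii' lt_f; pose t := tperm i i'.
pose tt (p : 'I_n * 'I_n) := (t p.1, t p.2).
have ttK : involutive tt by move=> [a b]; rewrite /tt /= !tpermK.
pose I (g : 'I_n -> 'I_n) := [set p : 'I_n * 'I_n | (p.1 < p.2)%N && (g p.2 < g p.1)%N].
have invE g : ninv g = #|I g| by apply: eq_card => p; rewrite !inE.
rewrite !invE.
have -> : I (f \o t) = (i, i') |: (tt @: I f).
  apply/setP => -[a b]; rewrite in_setU1.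
  have [e|ne] /= := eqVneq (a, b) (i, i').
    by case: e => -> ->; rewrite inE /= /t tpermL tpermR lt_f ii' leqnn.
  rewrite -[(a, b) in RHS]ttK mem_imset; last exact: (can_inj ttK).
  rewrite !inE /=; apply/andP/andP => -[lt1 lt2]; split=> //.
    by rewrite /t; apply: tperm_adj_lt.
  rewrite -(tpermK i i' a) -(tpermK i i' b); apply: tperm_adj_lt => //.
  apply: contraTneq lt2 => -[ea eb].
  by rewrite ea eb -leqNgt ltnW.
rewrite cardsU1 card_imset; last exact: (can_inj ttK).
suff -> : (i, i') \notin tt @: I f by [].
apply/imsetP => -[p]; rewrite inE => /andP[lt1 lt2] [e1 e2].
have e1' : p.1 = i' by rewrite -(tpermK i i' p.1) -/t -e1 /t tpermL.
have e2' : p.2 = i by rewrite -(tpermK i i' p.2) -/t -e2 /t tpermR.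
by move: lt1; rewrite e1' e2' ii' ltnNge leqnSn.
Qed.

End Inversions.

(** As the factors do not commute, [F] is extended by 1 to the naturals and the cut is made between
    intervals, where the order is kept. *)
Lemma prod_ord_split (B : pzRingType) n (m : nat) (F : 'I_n -> B) :
  \prod_(k < n) F k =
  (\prod_(k < n | (k < m)%N) F k) * (\prod_(k < n | (m <= k)%N) F k).
Proof.
pose G k := odflt 1 (omap F (insub k)).
have GE (k : 'I_n) : G k = F k by rewrite /G valK.
rewrite -(eq_bigr _ (fun k _ => GE k)) -(eq_bigr _ (fun k _ => GE k)).
rewrite -[X in _ = _ * X](eq_bigr _ (fun k _ => GE k)).
rewrite -(big_mkord xpredT G) -(big_mkord (fun k => k < m)%N G).
rewrite -(big_mkord (fun k => m <= k)%N G).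
have [le_mn|lt_nm] := leqP m n; last first.
  rewrite [X in _ * X]big1_seq ?mulr1; last first.
    by move=> k; rewrite mem_index_iota => /andP[? ?]; exfalso; lia.
  rewrite [RHS]big_nat_cond [LHS]big_nat_cond; apply: eq_bigl => k /=.
  by rewrite andbT; case: ltnP => //= kn; symmetry; lia.
rewrite (@big_cat_nat _ _ _ m) //=; congr (_ * _).
  rewrite [RHS](@big_cat_nat _ _ _ m) //= [X in _ = _ * X]big1_seq ?mulr1.
    by rewrite [RHS]big_nat_cond [LHS]big_nat_cond; apply: eq_bigl => k; lia.
  by move=> k; rewrite mem_index_iota => /andP[? ?]; exfalso; lia.
rewrite [RHS](@big_cat_nat _ _ _ m) //= [X in _ = X * _]big1_seq ?mul1r.
  by rewrite [RHS]big_nat_cond [LHS]big_nat_cond; apply: eq_bigl => k; lia.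
by move=> k; rewrite mem_index_iota => /andP[? ?]; exfalso; lia.
Qed.

(** * Quantum determinants of row selections *)

Section QMatrix.
Variables (C : fieldType) (q : C) (B : algType C).

(** The relations are isolated for arbitrary entries because they occur for [u], its minors, its
    transpose and, over the opposite algebra, its inverse. *)
Definition is_qmat n (M : 'M[B]_n) := [/\
  forall i j k : 'I_n, (i < k)%N -> M i j * M k j = q *: (M k j * M i j),
  forall i j l : 'I_n, (j < l)%N -> M i j * M i l = q *: (M i l * M i j),
  forall i j k l : 'I_n, (i < k)%N -> (l < j)%N -> M i j * M k l = M k l * M i j
  & forall i j k l : 'I_n, (i < k)%N -> (j < l)%N ->
      M i j * M k l = M k l * M i j - (q^-1 - q) *: (M i l * M k j)].

Lemma is_qmat_tr n (M : 'M[B]_n) : is_qmat M -> is_qmat M^T.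
Proof.
move=> [h1 h2 h3 h4]; split=> [i j k ik|i j l jl|i j k l ik lj|i j k l ik jl];
  rewrite !mxE.
- exact: h2.
- exact: h1.
- by rewrite -h3.
- rewrite h4 //; congr (_ - _ *: _); by rewrite h3.
Qed.

Lemma is_qmat_minor n (M : 'M[B]_n) j k : is_qmat M -> is_qmat (row' j (col' k M)).
Proof.
have lt (m : nat) (h : 'I_m) (i k' : 'I_m.-1) : (i < k')%N -> (lift h i < lift h k')%N.
  by rewrite /= /bump; case: leqP; case: leqP => /=; lia.
move=> [h1 h2 h3 h4]; split=> [*|*|*|*]; rewrite !mxE.
- by apply: h1; apply: lt.
- by apply: h2; apply: lt.
- by apply: h3; apply: lt.
- by apply: h4; apply: lt.
Qed.

(** Permutations are paired by exchanging their values at the adjacent rows [i] and [i']. The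
    partner of [s] has one more inversion, so each pair contributes a 2 by 2 quantum minor between
    unchanged factors. Identities for adjacent rows thereby reduce to such minors. *)
Lemma qdet_pair n (X : 'M[B]_n) (i i' : 'I_n) : i' = i.+1 :> nat ->
  qdet q X = \sum_(s : 'S_n | (s i < s i')%N) (- q) ^+ inversions s *:
    ((\prod_(k < n | (k < i)%N) X k (s k)) *
     (X i (s i) * X i' (s i') - q *: (X i (s i') * X i' (s i))) *
     (\prod_(k < n | (i' < k)%N) X k (s k))).
Proof.
move=> ii'; pose t := tperm i i'.
have split_prod (F : 'I_n -> B) : \prod_(k < n) F k =
    (\prod_(k < n | (k < i)%N) F k) * (F i * F i') *
    (\prod_(k < n | (i' < k)%N) F k).
  rewrite (prod_ord_split i) -mulrA; congr (_ * _).
  rewrite big_mkcond (prod_ord_split i.+2) -mulrA /=.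
  have -> : \prod_(k < n | (k < i.+2)%N) (if (i <= k)%N then F k else 1) = F i * F i'.
    rewrite big_mkcond (prod_ord_split i.+1) /=; congr (_ * _).
      rewrite -big_mkcondr -big_mkcondr /= (big_pred1 i) // => k.
      by rewrite /= -val_eqE /=; lia.
    rewrite -big_mkcondr -big_mkcondr /= (big_pred1 i') // => k.
    by rewrite /= -val_eqE /=; lia.
  rewrite mulrA; congr (_ * _); rewrite -big_mkcondr; apply: eq_bigl => k; lia.
rewrite /qdet (bigID (fun s : 'S_n => (s i < s i')%N)) /=.
rewrite [X in _ + X](reindex_inj (mulgI t)) /=.
rewrite [X in _ + X](eq_bigl (fun s : 'S_n => (s i < s i')%N)); last first.
  move=> s; rewrite !permM tpermL tpermR.
  have : s i != s i' by rewrite (inj_eq perm_inj) -val_eqE /= ii'; lia.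
  by rewrite -val_eqE /=; lia.
rewrite -big_split /=; apply: eq_bigr => s lt_s.
rewrite (split_prod (fun k => X k (s k))) (split_prod (fun k => X k ((t * s)%g k))).
have -> : inversions (t * s) = (inversions s).+1.
  rewrite -[inversions s]/(ninv s) -(ninv_swap ii' lt_s).
  by apply: eq_ninv => k /=; rewrite permM.
have tne (k : 'I_n) : (k < i)%N || (i' < k)%N -> t k = k.
  by move=> h; rewrite tpermD // -val_eqE /=; lia.
rewrite (eq_bigr (fun k : 'I_n => X k (s k)) (P := fun k : 'I_n => (k < i)%N)
  (F1 := fun k : 'I_n => X k ((t * s)%g k))); last first.
  by move=> k ki; rewrite permM tne // ki.
rewrite (eq_bigr (fun k : 'I_n => X k (s k)) (P := fun k : 'I_n => (i' < k)%N)
  (F1 := fun k : 'I_n => X k ((t * s)%g k))); last first.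
  by move=> k ki; rewrite permM tne // ki orbT.
rewrite !permM tpermL tpermR mulrBr mulrBl scalerBr; congr (_ + _).
by rewrite -scalerAr -scalerAl exprSr mulrN scaleNr scalerA.
Qed.

Section Rows.
Variables (n : nat) (M : 'M[B]_n).
Hypothesis (qM : is_qmat M) (q0 : q != 0).

(** By [qdet_pair] this is a computation with two rows, where the relations between entries in
    different rows and columns produce the factor -q. *)
Lemma qdet_rowsub_swap (f : 'I_n -> 'I_n) (i i' : 'I_n) : i' = i.+1 :> nat ->
  (f i < f i')%N ->
  qdet q (rowsub (f \o tperm i i') M) = - q *: qdet q (rowsub f M).
Proof.
case: qM => _ _ h3 h4 ii' lt_f.
rewrite !(qdet_pair _ ii') scaler_sumr; apply: eq_bigr => s lt_s.
rewrite scalerA mulrC -scalerA; congr (_ *: _).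
have tne (k : 'I_n) : (k < i)%N || (i' < k)%N -> tperm i i' k = k.
  by move=> h; rewrite tpermD // -val_eqE /=; lia.
rewrite (eq_bigr (fun k : 'I_n => rowsub f M k (s k)) (P := fun k : 'I_n => (k < i)%N)
  (F1 := fun k : 'I_n => rowsub (f \o tperm i i') M k (s k))); last first.
  by move=> k ki; rewrite !mxE /= tne // ki.
rewrite (eq_bigr (fun k : 'I_n => rowsub f M k (s k)) (P := fun k : 'I_n => (i' < k)%N)
  (F1 := fun k : 'I_n => rowsub (f \o tperm i i') M k (s k))); last first.
  by move=> k ki; rewrite !mxE /= tne // ki orbT.
rewrite -[RHS]/(_ *: (_ * _ * _)) [RHS]scalerAl; congr (_ * _).
rewrite [RHS]scalerAr; congr (_ * _).
rewrite !mxE /= tpermL tpermR.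
rewrite (h4 (f i) (s i) (f i') (s i')) // -(h3 (f i) (s i') (f i') (s i)) //.
move: (M (f i) (s i') * _) (M (f i') (s i') * _) => y x.
rewrite scalerBl opprB -addrA [_ - _ - _]addrAC subrr add0r.
by rewrite scalerBr scalerA mulNr divff // !scaleNr scale1r opprK addrC.
Qed.

Lemma qdet_rowsub_dup (f : 'I_n -> 'I_n) (i i' : 'I_n) : i' = i.+1 :> nat ->
  f i = f i' -> qdet q (rowsub f M) = 0.
Proof.
case: qM => _ h2 _ _ ii' eq_f; rewrite (qdet_pair _ ii') big1 // => s lt_s.
by rewrite !mxE -eq_f h2 // subrr mulr0 mul0r scaler0.
Qed.

(** Bubble sort on [f]: a descent is undone at the price of -q, two equal neighbours give 0 by the
    row relation, and a strictly increasing self-map is the identity. *)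
Lemma qdet_rowsub (f : 'I_n -> 'I_n) :
  qdet q (rowsub f M) =
  (if injectiveb f then (- q) ^+ ninv f else 0) *: qdet q M.
Proof.
have [m le_m] := ubnP (ninv f); elim: m => // m IH in f le_m *.
have [/existsP[i /existsP[i' /andP[/eqP ii' lt_f]]]|] :=
    boolP [exists i : 'I_n, [exists i' : 'I_n, (i' == i.+1 :> nat) && (f i' < f i)%N]].
  pose g := f \o tperm i i'.
  have gf : f =1 g \o tperm i i' by move=> k; rewrite /g /= tpermK.
  have lt_g : (g i < g i')%N by rewrite /g /= tpermL tpermR.
  have invf : ninv f = (ninv g).+1 by rewrite (eq_ninv gf) ninv_swap.
  have -> : rowsub f M = rowsub (g \o tperm i i') M.
    by apply/matrixP => a b; rewrite !mxE gf.
  rewrite qdet_rowsub_swap // IH; last by move: le_m; rewrite invf.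
  have -> : injectiveb f = injectiveb g.
    apply/injectiveP/injectiveP => injf.
      exact: inj_comp injf (can_inj (tpermK i i')).
    apply: eq_inj (fsym gf).
    exact: inj_comp injf (can_inj (tpermK i i')).
  rewrite invf; case: ifP => _; last by rewrite !scale0r scaler0.
  by rewrite scalerA exprS.
rewrite negb_exists => /forallP noD.
have mono (i i' : 'I_n) : i' = i.+1 :> nat -> (f i <= f i')%N.
  move=> ii'; have := noD i; rewrite negb_exists => /forallP /(_ i').
  by rewrite ii' eqxx /= -leqNgt.
have [/existsP[i /existsP[i' /andP[/eqP ii' /eqP eq_f]]]|] :=
    boolP [exists i : 'I_n, [exists i' : 'I_n, (i' == i.+1 :> nat) && (f i == f i')]].
  rewrite (qdet_rowsub_dup ii' eq_f); case: ifP => [/injectiveP injf|]; last by rewrite scale0r.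
  by move: ii'; rewrite (injf _ _ eq_f); lia.
rewrite negb_exists => /forallP noE.
have smono (i i' : 'I_n) : i' = i.+1 :> nat -> (f i < f i')%N.
  move=> ii'; have := noE i; rewrite negb_exists => /forallP /(_ i').
  by rewrite ii' eqxx /= ltn_neqAle mono // andbT -val_eqE.
(* A strictly increasing map satisfies k <= f k; the mirrored bound [upper], counted from the last
   index, gives equality. *)
have lower k : forall i : 'I_n, i = k :> nat -> (k <= f i)%N.
  elim: k => // k IHk i ik.
  have kn : (k < n)%N by rewrite (leq_ltn_trans _ (ltn_ord i)) // ik.
  have := smono (Ordinal kn) i ik; apply: leq_ltn_trans; exact: IHk.
have upper k : forall i : 'I_n, (i + k).+1 = n -> (f i + k < n)%N.
  elim: k => [|k IHk] i ik; first by rewrite addn0.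
  have i1n : (i.+1 < n)%N by lia.
  have lt_fi := smono i (Ordinal i1n) erefl.
  have : (f (Ordinal i1n) + k < n)%N by apply: IHk => /=; lia.
  by move: lt_fi; lia.
have fid : f =1 id.
  move=> i; apply: val_inj => /=; have := lower i i erefl.
  have := upper (n - i.+1)%N i; have := ltn_ord i; lia.
have -> : injectiveb f by apply/injectiveP; apply: eq_inj (fsym fid) => ? ?.
have -> : ninv f = 0%N by rewrite (eq_ninv fid); apply: eq_card0 => p; rewrite !inE /=; lia.
rewrite expr0 scale1r; congr qdet; apply/matrixP => a b; by rewrite mxE fid.
Qed.

Lemma qdet_rowsub_perm (s : 'S_n) :
  qdet q (rowsub s M) = (- q) ^+ inversions s *: qdet q M.
Proof.
by rewrite qdet_rowsub; have -> : injectiveb s by apply/injectiveP; exact: perm_inj.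
Qed.

End Rows.
End QMatrix.

(** The inverse bijection, [ulsf], deletes the position [i] and the value [j]. *)
Lemma sum_lift_perm (V : nmodType) n (i j : 'I_n.+1) (F : 'S_n.+1 -> V) :
  \sum_(s : 'S_n.+1 | s i == j) F s = \sum_(s : 'S_n) F (lift_perm i j s).
Proof.
rewrite (reindex (lift_perm i j)); last first.
  pose ulsf i (s : 'S_n.+1) k := odflt k (unlift (s i) (s (lift i k))).
  have ulsfK i' (s : 'S_n.+1) k: lift (s i') (ulsf i' s k) = s (lift i' k).
    rewrite /ulsf; have:= neq_lift i' k.
    by rewrite -(can_eq (permK s)) => /unlift_some[] ? ? ->.
  have inj_ulsf: injective (ulsf i _).
    move=> s; apply: can_inj (ulsf (s i) s^-1%g) _ => k'.
    by rewrite {1}/ulsf ulsfK !permK liftK.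
  exists (fun s => perm (inj_ulsf s)) => [s _ | s].
    by apply/permP=> k'; rewrite permE /ulsf lift_perm_lift lift_perm_id liftK.
  move/(s _ =P _) => si0; apply/permP=> k.
  case: (unliftP i k) => [k'|] ->; rewrite ?lift_perm_id //.
  by rewrite lift_perm_lift -si0 permE ulsfK.
by apply: eq_bigl => s; rewrite lift_perm_id eqxx.
Qed.

(** * Laplace expansions and the transpose *)

Section Expand.
Variables (C : fieldType) (q : C) (B : algType C).

(** The factors of each monomial are ordered by rows, so the row that splits off on the left is the
    first one, and on the right the last one. *)
Lemma qdet_expand0 n (X : 'M[B]_n.+1) :
  qdet q X = \sum_(k < n.+1) (- q) ^+ k *: (X ord0 k * qdet q (row' ord0 (col' k X))).
Proof.
rewrite /qdet (partition_big (fun s : 'S_n.+1 => s ord0) xpredT) //=.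
apply: eq_bigr => k _; rewrite sum_lift_perm mulr_sumr scaler_sumr.
apply: eq_bigr => s _.
have -> : inversions (lift_perm ord0 k s) = (k + inversions s)%N.
  apply: (@ninv_lift0 _ (lift_perm ord0 k s)) => [|i].
    by rewrite lift_perm_id.
  by rewrite lift_perm_lift.
rewrite exprD -scalerA -scalerAr big_ord_recl lift_perm_id; do 2 congr (_ *: _).
by congr (_ * _); apply: eq_bigr => i _; rewrite lift_perm_lift !mxE.
Qed.

Lemma qdet_expand_max n (X : 'M[B]_n.+1) :
  qdet q X =
  \sum_(k < n.+1) (- q) ^+ (n - k) *: (qdet q (row' ord_max (col' k X)) * X ord_max k).
Proof.
rewrite /qdet (partition_big (fun s : 'S_n.+1 => s ord_max) xpredT) //=.
apply: eq_bigr => k _; rewrite sum_lift_perm mulr_suml scaler_sumr.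
apply: eq_bigr => s _.
have -> : inversions (lift_perm ord_max k s) = (n - k + inversions s)%N.
  apply: (@ninv_lift_max _ (lift_perm ord_max k s)) => [|i].
    by rewrite lift_perm_id.
  by rewrite lift_perm_lift.
rewrite exprD -scalerA -scalerAl big_ord_recr lift_perm_id; do 2 congr (_ *: _).
congr (_ * _); apply: eq_bigr => i _.
rewrite (_ : widen_ord _ i = lift ord_max i) ?lift_perm_lift ?mxE //.
by apply: val_inj; rewrite /= /bump leqNgt ltn_ord.
Qed.

Section Laplace.
Variables (n : nat) (M : 'M[B]_n.+1).
Hypothesis (qM : is_qmat q M) (q0 : q != 0).

(** Row [j] at position [h], the other positions filled increasingly with the rows different from
    [m]: deleting position [h] always leaves the minor without row [m]. *)
Let insf (h j m : 'I_n.+1) (i : 'I_n.+1) : 'I_n.+1 :=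
  if unlift h i is Some i' then lift m i' else j.

Let inj_insf h j m : injectiveb (insf h j m) = (j == m).
Proof.
apply/injectiveP/eqP => [inj_f|-> x y].
  apply/eqP; apply: contraT => ne; have [m' em _] := unlift_some ne.
  move: ne; rewrite eq_sym => ne.
  have [j' ej _] := unlift_some ne.
  have : insf h j m (lift h j') = insf h j m h.
    by rewrite /insf liftK unlift_none ej.
  by move/inj_f/eqP; rewrite eq_sym (negbTE (neq_lift h j')).
rewrite /insf; case: unliftP => [x'|] ->; case: unliftP => [y'|] ->.
- by move/lift_inj ->.
- by move/eqP; rewrite eq_sym (negbTE (neq_lift _ _)).
- by move/eqP; rewrite (negbTE (neq_lift _ _)).
- by [].
Qed.

(** The left side expands the determinant with rows selected by [insf]; if [j] differs from [m], a
    row is repeated and this determinant vanishes. *)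
Lemma qdet_laplace_row (j m : 'I_n.+1) :
  \sum_(k < n.+1) (- q) ^+ k *: (M j k * qdet q (row' m (col' k M))) =
  ((- q) ^+ m *: qdet q M) *+ (j == m).
Proof.
have := qdet_rowsub qM q0 (insf ord0 j m).
rewrite qdet_expand0 inj_insf => e.
transitivity ((if j == m then (- q) ^+ ninv (insf ord0 j m) else 0) *: qdet q M).
  rewrite -e; apply: eq_bigr => k _; rewrite mxE /insf unlift_none.
  congr (_ *: (_ * qdet _ _)); apply/matrixP => a b.
  by rewrite !mxE liftK.
case: eqP => [->|_]; last by rewrite scale0r.
suff -> : ninv (insf ord0 m m) = m by [].
rewrite (@ninv_lift0 _ _ m 1%g) => [||i]; rewrite /insf ?unlift_none ?liftK ?perm1 //.
by rewrite -[ninv _]/(inversions _) inversions1 addn0.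
Qed.

Lemma qdet_laplace_max (j m : 'I_n.+1) :
  \sum_(k < n.+1) (- q) ^+ (n - k) *: (qdet q (row' m (col' k M)) * M j k) =
  ((- q) ^+ (n - m) *: qdet q M) *+ (j == m).
Proof.
have := qdet_rowsub qM q0 (insf ord_max j m).
rewrite qdet_expand_max inj_insf => e.
transitivity ((if j == m then (- q) ^+ ninv (insf ord_max j m) else 0) *: qdet q M).
  rewrite -e; apply: eq_bigr => k _; rewrite mxE /insf unlift_none.
  congr (_ *: (qdet _ _ * _)); apply/matrixP => a b.
  by rewrite !mxE liftK.
case: eqP => [->|_]; last by rewrite scale0r.
suff -> : ninv (insf ord_max m m) = (n - m)%N by [].
rewrite (@ninv_lift_max _ _ m 1%g) => [||i]; rewrite /insf ?unlift_none ?liftK ?perm1 //.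
by rewrite -[ninv _]/(inversions _) inversions1 addn0.
Qed.

End Laplace.

(* Both sides, multiplied by \sum_s q^(2 i(s)), are the sum of the monomials
   (-q)^(i(s) + i(t)) \prod_i M (s i) (t i) over all pairs (s, t). *)
Lemma qdet_tr n (M : 'M[B]_n) : is_qmat q M -> q != 0 ->
  \sum_(s : 'S_n) q ^+ (2 * inversions s) != 0 -> qdet q M^T = qdet q M.
Proof.
move=> qM q0 c0; set c := \sum_s _ in c0.
have sq (s : 'S_n) : (- q) ^+ inversions s *: ((- q) ^+ inversions s *: qdet q M) =
    q ^+ (2 * inversions s) *: qdet q M.
  by rewrite scalerA -exprD addnn -mul2n exprM sqrrN -exprM.
have sqT (s : 'S_n) : (- q) ^+ inversions s *: ((- q) ^+ inversions s *: qdet q M^T) =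
    q ^+ (2 * inversions s) *: qdet q M^T.
  by rewrite scalerA -exprD addnn -mul2n exprM sqrrN -exprM.
suff : c *: qdet q M^T = c *: qdet q M.
  by move/(congr1 (fun x => c^-1 *: x)); rewrite !scalerA mulVf // !scale1r.
rewrite !scaler_suml -(eq_bigr _ (fun s _ => sq s)) -(eq_bigr _ (fun s _ => sqT s)).
under eq_bigr do rewrite -(qdet_rowsub_perm (is_qmat_tr qM) q0) /qdet scaler_sumr.
under [RHS]eq_bigr do rewrite -(qdet_rowsub_perm qM q0) /qdet scaler_sumr.
rewrite exchange_big /=; apply: eq_bigr => s _; apply: eq_bigr => t _.
rewrite !scalerA mulrC; congr (_ *: _).
by apply: eq_bigr => i _; rewrite !mxE.
Qed.

End Expand.

Section OppositeAlgebra.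
Variables (C : fieldType) (B : algType C).

(** An antimultiplicative map such as the star becomes a homomorphism into this algebra; scalars act
    as before. *)
Definition opp_alg : Type := GRing.converse B.
HB.instance Definition _ := GRing.NzRing.on opp_alg.
HB.instance Definition _ := GRing.Zmodule_isLmodule.Build C opp_alg
  (@scalerA _ B) (@scale1r _ B) (@scalerDr _ B) (@scalerDl _ B).
Fact opp_scalerAl (c : C) (x y : opp_alg) : c *: (x * y) = (c *: x) * y.
Proof. exact: (@scalerAr _ B). Qed.
Fact opp_scalerAr (c : C) (x y : opp_alg) : c *: (x * y) = x * (c *: y).
Proof. exact: (@scalerAl _ B). Qed.
HB.instance Definition _ := GRing.Lmodule_isLalgebra.Build C opp_alg opp_scalerAl.
HB.instance Definition _ := GRing.Lalgebra_isAlgebra.Build C opp_alg opp_scalerAr.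

Lemma opp_algM (x y : B) : (x : opp_alg) * (y : opp_alg) = y * x :> B.
Proof. by []. Qed.
End OppositeAlgebra.

Section Kernels.
Variables (T : finType) (B : nzRingType).
Implicit Types X Y Z : T -> T -> B.

(** Matrices over an arbitrary finite index set: the pairs of indices are needed for the tensor
    square of a quantum matrix. *)
Definition kmul X Y : T -> T -> B := fun a b => \sum_c X a c * Y c b.
Definition kone : T -> T -> B := fun a b => (a == b)%:R.

Lemma kmulA X Y Z : kmul X (kmul Y Z) = kmul (kmul X Y) Z.
Proof.
apply/funext => a; apply/funext => b; rewrite /kmul.
under eq_bigr do rewrite mulr_sumr.
under [RHS]eq_bigr do rewrite mulr_suml.
by rewrite exchange_big /=; do 2 (apply: eq_bigr => ? _); rewrite mulrA.
Qed.

Lemma kmul1 X : kmul X kone = X.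
Proof.
apply/funext => a; apply/funext => b; rewrite /kmul /kone (bigD1 b) //= eqxx mulr1.
by rewrite big1 ?addr0 // => c cb; rewrite (negbTE cb) mulr0.
Qed.

Lemma k1mul X : kmul kone X = X.
Proof.
apply/funext => a; apply/funext => b; rewrite /kmul /kone (bigD1 a) //= eqxx mul1r.
by rewrite big1 ?addr0 // => c cb; rewrite eq_sym (negbTE cb) mul0r.
Qed.

Lemma kcomm_inv X Y Z : kmul X Y = kone -> kmul Y X = kone ->
  kmul Z X = kmul X Z -> kmul Z Y = kmul Y Z.
Proof.
move=> XY YX ZX.
by rewrite -[kmul Z Y]k1mul -YX -kmulA (kmulA X) -ZX -(kmulA Z) XY kmul1.
Qed.

Lemma kinv_unique X Y Z : kmul X Y = kone -> kmul Y Z = kone -> X = Z.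
Proof. by move=> XY YZ; rewrite -[X]kmul1 -YZ kmulA XY k1mul. Qed.
End Kernels.

(** * The inverse of a quantum matrix *)

Section InverseQMatrix.
Variables (C : fieldType) (q : C).
Hypothesis q0 : q != 0.

Let c n (a : 'I_n * 'I_n) : C := if a.1 == a.2 then q else 1.
Let l n (a : 'I_n * 'I_n) : C := (q - q^-1) *+ (a.1 < a.2)%N.

(* The defining relations in the form R U_1 U_2 = U_2 U_1 R. *)
Lemma is_qmatP (B : algType C) n (M : 'M[B]_n) :
  is_qmat q M <-> forall i k j m : 'I_n,
    c (i, k) *: (M k j * M i m) + l (i, k) *: (M i j * M k m) =
    c (j, m) *: (M i m * M k j) + l (j, m) *: (M i j * M k m).
Proof.
have nlt (a b : 'I_n) : (a < b)%N -> (a == b) = false.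
  by move=> ab; apply/eqP => e; move: ab; rewrite e ltnn.
have ngt (a b : 'I_n) : (b < a)%N -> (a == b) = false by rewrite eq_sym; apply: nlt.
have gtF (a b : nat) : (a < b)%N -> (b < a)%N = false by lia.
have key x y : (q *: x = y + (q - q^-1) *: x) <-> (x = q *: y :> B).
  split=> [/eqP|->]; last first.
    by rewrite scalerBl !scalerA mulVf // scale1r addrC subrK.
  rewrite scalerBl addrCA addrC -subr_eq subrr eq_sym subr_eq0 => /eqP ->.
  by rewrite scalerA divff // scale1r.
have key' x y : (y + (q - q^-1) *: x = q *: x) <-> (x = q *: y :> B).
  by rewrite -key; split.
split=> [[h1 h2 h3 h4] i k j m|H].
  have z (x : B) : x *+ 0 = 0 by rewrite mulr0n.
  have [ik|ki|/val_inj eik] := ltngtP i k; have [jm|mj|/val_inj ejm] := ltngtP j m;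
    rewrite ?eik ?ejm /c /l /= ?(nlt _ _ ik) ?(ngt _ _ ki) ?(nlt _ _ jm) ?(ngt _ _ mj)
      ?eqxx ?ltnn ?ik ?jm ?(gtF _ _ ki) ?(gtF _ _ mj)
      ?mulr1n ?mulr0n ?scale0r ?addr0 ?scale1r //.
  - by rewrite (h3 i m k j).
  - by rewrite (h4 i m k j) // -[q - _]opprB scaleNr.
  - by apply/key'/h1.
  - by rewrite (h4 k j i m) // (h3 k m i j) // -[q - _]opprB scaleNr.
  - by rewrite (h3 k j i m).
  - by rewrite (h1 k m i).
  - by apply/key/h2.
  - by rewrite (h2 k m j).
split=> [i j k ij|i j m jm|i j k m ik mj|i j k m ik jm].
- have := H i k j j; rewrite /c /l /= eqxx ltnn ij (nlt _ _ ij) mulr1n mulr0n scale0r addr0 scale1r.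
  by move/key'.
- have := H i i j m; rewrite /c /l /= eqxx ltnn jm (nlt _ _ jm) mulr1n mulr0n scale0r addr0 scale1r.
  by move/key.
- have := H i k m j; rewrite /c /l /= ik mj !nlt // !scale1r.
  by move/addIr ->.
- have := H i k m j; rewrite /c /l /= ik (gtF _ _ jm) nlt // ngt // !scale1r scale0r addr0 => <-.
  by rewrite -[q^-1 - q]opprB scaleNr opprK.
Qed.

Section Inverse.
Variables (B : algType C) (n : nat) (U V : 'M[B]_n).
Hypothesis (UV : forall i j, \sum_k U i k * V k j = (i == j)%:R).
Hypothesis (VU : forall i j, \sum_k V i k * U k j = (i == j)%:R).
Hypothesis (qU : is_qmat q U).

(** The relations say that [R] commutes with the tensor square [X] of [U]. Hence it commutes with
    the inverse [Y] of [X], whose entries are products of entries of [V] in reversed order, that is,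
    products in the opposite algebra. *)
Lemma is_qmat_inv : is_qmat q (V : 'M[opp_alg B]_n).
Proof.
pose T := ('I_n * 'I_n)%type.
pose X (a b : T) := U a.1 b.1 * U a.2 b.2.
pose Y (a b : T) := V a.2 b.2 * V a.1 b.1.
(* The R-matrix composed with the flip of the two tensor factors. *)
pose R (a b : T) : B := (c a *+ (b == (a.2, a.1)) + l a *+ (b == a))%:A.
have csym (a : T) : c (a.2, a.1) = c a by rewrite /c /= eq_sym.
have XY : kmul X Y = @kone _ B.
  apply/funext => a; apply/funext => b; rewrite /kmul /kone /X /Y.
  rewrite -(pair_bigA _ (fun i j => U a.1 i * U a.2 j * (V j b.2 * V i b.1))) /=.
  under eq_bigr => i _.
    under eq_bigr do rewrite mulrA -(mulrA (U a.1 i)).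
    rewrite -mulr_suml -mulr_sumr UV; over.
  case: (a.2 =P b.2) => e2; last first.
    rewrite big1 => [|i _]; last by rewrite mulr0 mul0r.
    by case: eqP => // ab; case: e2; rewrite ab.
  under eq_bigr do rewrite mulr1.
  by rewrite UV; case: a b e2 => [? ?] [? ?] /= ->; rewrite xpair_eqE eqxx andbT.
have YX : kmul Y X = @kone _ B.
  apply/funext => a; apply/funext => b; rewrite /kmul /kone /X /Y.
  rewrite -(pair_bigA _ (fun i j => V a.2 j * V a.1 i * (U i b.1 * U j b.2))) /=.
  rewrite exchange_big /=; under eq_bigr => i _.
    under eq_bigr do rewrite mulrA -(mulrA (V a.2 i)).
    rewrite -mulr_suml -mulr_sumr VU; over.
  case: (a.1 =P b.1) => e1; last first.
    rewrite big1 => [|i _]; last by rewrite mulr0 mul0r.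
    by case: eqP => // ab; case: e1; rewrite ab.
  under eq_bigr do rewrite mulr1.
  by rewrite VU; case: a b e1 => [? ?] [? ?] /= ->; rewrite xpair_eqE eqxx.
have RZ Z a b : kmul R Z a b = c a *: Z (a.2, a.1) b + l a *: Z a b.
  rewrite /kmul /R; under eq_bigr do rewrite -scalerAl mul1r scalerDl.
  rewrite big_split /= (bigD1 (a.2, a.1)) //= eqxx big1 ?addr0; last first.
    by move=> x /negbTE ->; rewrite scale0r.
  congr (_ + _); rewrite (bigD1 a) //= eqxx big1 ?addr0 // => x /negbTE ->.
  by rewrite scale0r.
have ZR Z a b : kmul Z R a b = c b *: Z a (b.2, b.1) + l b *: Z a b.
  rewrite /kmul /R; under eq_bigr do rewrite -scalerAr mulr1 scalerDl.
  rewrite big_split /= (bigD1 (b.2, b.1)) //= -surjective_pairing eqxx csym.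
  rewrite big1 ?addr0; last first.
    move=> x ne; suff /negbTE -> : b != (x.2, x.1) by rewrite scale0r.
    by apply: contra ne => /eqP ->; rewrite -surjective_pairing.
  congr (_ + _); rewrite (bigD1 b) //= eqxx big1 ?addr0 // => x.
  by rewrite eq_sym => /negbTE ->; rewrite scale0r.
have RX : kmul R X = kmul X R.
  apply/funext => -[i k]; apply/funext => -[j m]; rewrite RZ ZR /X /=.
  exact: (is_qmatP U).1.
have RY := kcomm_inv XY YX RX.
apply/is_qmatP => i k j m.
have := congr1 (fun F => F (i, k) (j, m)) RY; rewrite RZ ZR /Y /=.
by [].
Qed.

Lemma sum_ffunS (W : nmodType) (S : finType) m (F : {ffun 'I_m.+1 -> S} -> W) :
  \sum_f F f = \sum_(x : S) \sum_(g : {ffun 'I_m -> S})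
    F [ffun i => if unlift ord0 i is Some j then g j else x].
Proof.
rewrite pair_bigA /=.
pose h (p : S * {ffun 'I_m -> S}) : {ffun 'I_m.+1 -> S} :=
  [ffun i => if unlift ord0 i is Some j then p.2 j else p.1].
rewrite (reindex h) //=.
exists (fun f => (f ord0, [ffun j => f (lift ord0 j)])) => [[x g] _|f _] /=.
  congr (_, _); first by rewrite ffunE unlift_none.
  by apply/ffunP => j; rewrite !ffunE liftK.
apply/ffunP => i; rewrite !ffunE; case: unliftP => [j|] -> //=.
by rewrite ffunE.
Qed.

(** The opposite product reverses the factors [V], so the pair with the last index stands in the
    middle; the sums are contracted from the inside out by U V = 1. *)
Lemma contract_prod m (a b : 'I_m -> 'I_n) :
  \sum_(f : {ffun 'I_m -> 'I_n}) (\prod_i U (a i) (f i)) *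
     (\prod_i (V (f i) (b i) : opp_alg B)) = [forall i, a i == b i]%:R :> B.
Proof.
elim: m => [|m IH] in a b *.
  pose f0 : {ffun 'I_0 -> 'I_n} := [ffun i : 'I_0 => match i with Ordinal _ h => False_rect _ (notF h) end].
  rewrite (bigD1 f0) //= !big_ord0 big1 => [|f /eqP[]]; last first.
    by apply/ffunP => -[].
  by rewrite addr0 mulr1; case: forallP => // -[] [].
rewrite sum_ffunS; pose a' i := a (lift ord0 i); pose b' i := b (lift ord0 i).
transitivity (\sum_x U (a ord0) x * [forall i, a' i == b' i]%:R * V x (b ord0)).
  apply: eq_bigr => x _; rewrite -IH mulr_sumr mulr_suml; apply: eq_bigr => g _.
  rewrite !big_ord_recl ffunE unlift_none [X in _ * X]opp_algM mulrA -(mulrA (U _ _)).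
  congr (_ * (_ * _) * _); apply: eq_bigr => i _; by rewrite ffunE liftK.
case: forallP => h; last first.
  rewrite big1 => [|x _]; last by rewrite mulr0 mul0r.
  by case: forallP => // h'; case: h => i; exact: h'.
under eq_bigr do rewrite mulr1.
rewrite UV; congr (_%:R); congr nat_of_bool; apply/idP/forallP => [e i|]; last exact.
by case: (unliftP ord0 i) => [j|] ->; last exact: e; exact: h.
Qed.

(** Extending the sum over permutations to all maps [f] adds only vanishing terms, by [qdet_rowsub].
    The sum over [f] is then unrestricted, so [contract_prod] applies and leaves only the identity
    permutation. *)
Lemma qdet_inv : qdet q U * qdet q (V : 'M[opp_alg B]_n) = 1.
Proof.
have qV := is_qmat_inv.
transitivity (\sum_(f : {ffun 'I_n -> 'I_n})
   (\prod_i U i (f i)) * qdet q (rowsub f V : 'M[opp_alg B]_n) : B).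
  rewrite (bigID (fun f : {ffun 'I_n -> 'I_n} => injectiveb f)) /= [X in _ + X]big1 ?addr0.
    rewrite (reindex (@pval _)) /=; last first.
      exists (insubd (1%g : 'S_n)) => /= f Uf; first exact: valKd.
      exact: insubdK.
    rewrite {1}/qdet mulr_suml; apply: eq_big => s; first by case: s.
    move=> _; rewrite -scalerAl scalerAr; congr (_ * _).
      by apply: eq_bigr => i _; rewrite -pvalE.
    have -> : rowsub (pval s) V = rowsub s V by apply/matrixP => a b; rewrite !mxE pvalE.
    exact: (esym (qdet_rowsub_perm qV q0 s)).
  move=> f /negbTE nf.
  by rewrite (qdet_rowsub qV q0 f) nf scale0r mulr0.
under eq_bigr do rewrite /qdet mulr_sumr.
rewrite exchange_big /=.
transitivity (\sum_(s : 'S_n) (- q) ^+ inversions s *: ([forall i, i == s i]%:R : B)).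
  apply: eq_bigr => s _; rewrite -(contract_prod id s) scaler_sumr.
  apply: eq_bigr => f _; rewrite -scalerAr; congr (_ *: (_ * _)).
  by apply: eq_bigr => i _; rewrite mxE.
rewrite (bigD1 1%g) //= big1 ?addr0 => [|s s1].
  rewrite inversions1 expr0 scale1r.
  by have -> : [forall i : 'I_n, i == (1%g : 'S_n) i] by apply/forallP => i; rewrite perm1.
case: forallP => [h|]; last by rewrite scaler0.
by case/eqP: s1; apply/permP => i; rewrite perm1; apply/esym/eqP.
Qed.

End Inverse.
End InverseQMatrix.

(** * The *-algebra Uq *)

Section Quotient.
Variables (C : fieldType) (q : C) (N : nat).
Local Notation A := (Uq q N).
Local Notation F := (freeAlg C (Uq_index N)).
Local Notation u := (Uq_u q N).
Local Notation Dinv := (Uq_Dinv q N).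

Definition Uq_proj (x : F) : A := pres_proj (Uq_relator q (N:=N)) x.

Lemma Uq_projD x y : Uq_proj (x + y) = Uq_proj x + Uq_proj y.
Proof. exact: pres_projD. Qed.
Lemma Uq_projM x y : Uq_proj (x * y) = Uq_proj x * Uq_proj y.
Proof. exact: pres_projM. Qed.
Lemma Uq_projZ c x : Uq_proj (c *: x) = c *: Uq_proj x.
Proof. exact: pres_projZ. Qed.
Lemma Uq_proj1 : Uq_proj 1 = 1.
Proof. by []. Qed.
Lemma Uq_proj0 : Uq_proj 0 = 0.
Proof. by rewrite -(scale0r (0 : F)) Uq_projZ scale0r. Qed.
Lemma Uq_projB x y : Uq_proj (x - y) = Uq_proj x - Uq_proj y.
Proof. by rewrite Uq_projD -scaleN1r Uq_projZ scaleN1r. Qed.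
Lemma Uq_proj_surj (a : A) : exists x, a = Uq_proj x.
Proof. by exists (generic_quotient.repr a); rewrite /Uq_proj pres_projK. Qed.
Lemma Uq_proj_gen i : Uq_proj (fgen C i) = if i is Some (j, k) then u j k else Dinv.
Proof. by case: i => [[j k]|] //; rewrite mxE. Qed.
Lemma Uq_proj_rel x : Uq_relator q x -> Uq_proj x = 0.
Proof.
move=> rx; rewrite -Uq_proj0; apply: pres_proj_eq; rewrite subr0.
by rewrite -[x]mul1r -[1 * x]mulr1; exact: ideal_rel.
Qed.

Lemma Uq_proj_qdet :
  Uq_proj (qdet q (\matrix_(j < N, k < N) (fgen C (Some (j, k)) : F))) = Uq_D q N.
Proof.
rewrite /Uq_D /qdet (big_morph _ Uq_projD Uq_proj0); apply: eq_bigr => s _.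
rewrite Uq_projZ (big_morph _ Uq_projM Uq_proj1); congr (_ *: _).
by apply: eq_bigr => i _; rewrite mxE Uq_proj_gen.
Qed.

Lemma Uq_proj_relE x y : Uq_relator q (x - y) -> Uq_proj x = Uq_proj y.
Proof. by move/Uq_proj_rel; rewrite Uq_projB => /eqP; rewrite subr_eq0 => /eqP. Qed.

Lemma Uq_qmat : is_qmat q u.
Proof.
have gen2 (F' S : lalgType C) (phi : F' -> S) (phiM : {morph phi : x y / x * y})
    (phiZ : forall c x, phi (c *: x) = c *: phi x) x y c :
    phi (x * y) = phi (c *: (y * x)) -> phi x * phi y = c *: (phi y * phi x).
  by rewrite -!phiM -phiZ.
have gen4 (F' S : lalgType C) (phi : F' -> S) (phiM : {morph phi : x y / x * y})
    (phiZ : forall c x, phi (c *: x) = c *: phi x)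
    (phiB : {morph phi : x y / x - y}) x y c z w :
    phi (x * y) = phi (y * x - c *: (z * w)) ->
    phi x * phi y = phi y * phi x - c *: (phi z * phi w).
  by move=> e; rewrite -!phiM -phiZ -phiB.
have rel2 x y c (r : Uq_relator q (x * y - c *: (y * x))) :=
  gen2 _ _ _ Uq_projM Uq_projZ _ _ _ (Uq_proj_relE r).
have rel3 x y : Uq_relator q (x * y - y * x) ->
    Uq_proj x * Uq_proj y = Uq_proj y * Uq_proj x.
  by move/Uq_proj_relE => e; rewrite -Uq_projM e Uq_projM {e}.
have rel4 x y c z w (r : Uq_relator q (x * y - (y * x - c *: (z * w)))) :=
  gen4 _ _ _ Uq_projM Uq_projZ Uq_projB _ _ _ _ _ (Uq_proj_relE r).
split=> [i j k ik|i j l jl|i j k l ik lj|i j k l ik jl].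
- by have := rel2 _ _ _ (Uq_col q j ik); rewrite !Uq_proj_gen.
- by have := rel2 _ _ _ (Uq_row q i jl); rewrite !Uq_proj_gen.
- by have := rel3 _ _ (Uq_anti q ik lj); rewrite !Uq_proj_gen.
- by have := rel4 _ _ _ _ _ (Uq_diag q ik jl); rewrite !Uq_proj_gen.
Qed.

Lemma Uq_proj_rel1 x y : Uq_relator q (x * y - 1) -> Uq_proj x * Uq_proj y = 1.
Proof. by move/Uq_proj_relE => e; rewrite -Uq_projM e {e}. Qed.

Lemma Uq_DinvD : Dinv * Uq_D q N = 1.
Proof. by rewrite -(Uq_proj_rel1 (Uq_invl q N)) Uq_proj_gen Uq_proj_qdet. Qed.

Lemma Uq_DDinv : Uq_D q N * Dinv = 1.
Proof. by rewrite -(Uq_proj_rel1 (Uq_invr q N)) Uq_proj_gen Uq_proj_qdet. Qed.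

Lemma Uq_ind (P : A -> Prop) : P 1 -> (forall c a b, P a -> P b -> P (c *: a + b)) ->
  (forall a b, P a -> P b -> P (a * b)) -> (forall j k, P (u j k)) -> P Dinv ->
  forall a, P a.
Proof.
move=> P1 PD PM Pu PDi a; have [x ->] := Uq_proj_surj a.
have P0 : P 0 by rewrite -(addNr 1) -scaleN1r; exact: PD.
have Pw (w : fmonom (Uq_index N)) : P (Uq_proj (mkmalgU w 1)).
  case: w => w; elim: w => [|i w IH]; first by rewrite -fmoneE; exact: P1.
  have -> : FMonom (i :: w) = fmmul (fmu i) (FMonom w) by rewrite fmmulE fmuE.
  have -> : mkmalgU (fmmul (fmu i) (FMonom w)) 1 = fgen C i * (mkmalgU (FMonom w) 1 : F).
    by rewrite -[RHS]/(fgmul _ _) fgmulUU mulr1.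
  rewrite Uq_projM Uq_proj_gen; apply: PM; last exact: IH.
  by case: i => [[j k]|]; [exact: Pu|exact: PDi].
rewrite (monalgE x) (big_morph _ Uq_projD Uq_proj0).
elim/big_ind: _ => // [y z Py Pz|w _]; first by rewrite -[y]scale1r; exact: PD.
have -> : mkmalgU w (mcoeff w x) = mcoeff w x *: mkmalgU w 1.
  by apply/malgP => k; rewrite mcoeffZ !mcoeffU mulrnAr mulr1.
by rewrite Uq_projZ -[_ *: _]addr0; exact: PD.
Qed.

Section Lift.
Variables (S : algType C) (sg : {rmorphism C -> C}) (g : Uq_index N -> S).
Let M : 'M[S]_N := \matrix_(j, k) g (Some (j, k)).
Hypotheses (sgq : sg q = q) (gM : is_qmat q M).
Hypotheses (gD : g None * qdet q M = 1) (Dg : qdet q M * g None = 1).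

Let sgA (c : C) : S := (sg c)%:A.
Fact sgA_additive : additive sgA.
Proof. by move=> x y; rewrite /sgA rmorphB scalerBl. Qed.
Fact sgA_mult : multiplicative sgA.
Proof.
by split=> [x y|]; rewrite /sgA ?rmorphM ?rmorph1 ?scale1r // -scalerAl mul1r scalerA.
Qed.
HB.instance Definition _ := GRing.isAdditive.Build C S sgA sgA_additive.
HB.instance Definition _ := GRing.isMultiplicative.Build C S sgA sgA_mult.

Let wordS (w : fmonom (Uq_index N)) : S := \prod_(i <- w) g i.
Fact wordS_mmorphism : mmorphism wordS.
Proof. by split=> [x y|]; rewrite /wordS ?fmM ?big_cat ?fm1 ?big_nil. Qed.
HB.instance Definition _ :=
  isMultiplicative.Build (fmonom (Uq_index N)) S wordS wordS_mmorphism.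

Let G (x : F) : S := mmap sgA wordS x.
Let GD : {morph G : x y / x + y}. Proof. exact: mmapD. Qed.
Let G0 : G 0 = 0. Proof. exact: mmap0. Qed.
Let GM : multiplicative G.
Proof.
apply: commr_mmap_is_multiplicative => x m m'.
by rewrite /GRing.comm /sgA -scalerAl mul1r -scalerAr mulr1.
Qed.
Let GZ c x : G (c *: x) = sg c *: G x.
Proof.
have -> : c *: x = mkmalgU (fmone _) c * x by rewrite mul_malgC.
by rewrite GM.1 /G mmapU /wordS fmoneE big_nil mulr1 /sgA -scalerAl mul1r.
Qed.
Let Ggen i : G (fgen C i) = g i.
Proof.
rewrite /G mmapU /wordS fmU big_seq1 [X in X * _](_ : _ = 1) ?mul1r // -GM.2.
by rewrite -[1 in RHS]/(mkmalgU (fmone _) 1) /G mmapU /wordS fmoneE big_nil mulr1.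
Qed.
Let GB x y : G (x - y) = G x - G y.
Proof. by rewrite GD -scaleN1r GZ rmorphN1 scaleN1r. Qed.

Let Gqdet : G (qdet q (\matrix_(j < N, k < N) (fgen C (Some (j, k)) : F))) = qdet q M.
Proof.
rewrite /qdet (big_morph _ GD G0); apply: eq_bigr => s _.
rewrite GZ (big_morph _ GM.1 GM.2) rmorphXn rmorphN sgq; congr (_ *: _).
by apply: eq_bigr => i _; rewrite !mxE Ggen.
Qed.

Let G_rel x : Uq_relator q x -> G x = 0.
Proof.
have gen2 (F' : lalgType C) (phi : F' -> S) (phiM : {morph phi : x y / x * y})
    (phiZ : forall c x, phi (c *: x) = sg c *: phi x)
    (phiB : {morph phi : x y / x - y}) a b c :
    phi a * phi b = sg c *: (phi b * phi a) -> phi (a * b - c *: (b * a)) = 0.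
  by rewrite phiB phiZ !phiM => ->; rewrite subrr.
have gen3 (F' : lalgType C) (phi : F' -> S) (phiM : {morph phi : x y / x * y})
    (phiB : {morph phi : x y / x - y}) a b :
    phi a * phi b = phi b * phi a -> phi (a * b - b * a) = 0.
  by rewrite phiB !phiM => ->; rewrite subrr.
have gen4 (F' : lalgType C) (phi : F' -> S) (phiM : {morph phi : x y / x * y})
    (phiZ : forall c x, phi (c *: x) = sg c *: phi x)
    (phiB : {morph phi : x y / x - y}) a b c z w :
    phi a * phi b = phi b * phi a - sg c *: (phi z * phi w) ->
    phi (a * b - (b * a - c *: (z * w))) = 0.
  by rewrite !phiB phiZ !phiM => ->; rewrite subrr.
have gen1 (F' : lalgType C) (phi : F' -> S) (phiM : {morph phi : x y / x * y})
    (phi1 : phi 1 = 1) (phiB : {morph phi : x y / x - y}) a b :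
    phi a * phi b = 1 -> phi (a * b - 1) = 0.
  by rewrite phiB phiM phi1 => ->; rewrite subrr.
have sgV : sg q^-1 = q^-1 by rewrite fmorphV sgq.
have [h1 h2 h3 h4] := gM.
have e j k : G (fgen C (Some (j, k))) = M j k by rewrite Ggen mxE.
case=> [i j k ik|i j l jl|i j k l ik lj|i j k l ik jl||].
- apply: (gen2 _ G GM.1 GZ GB).
  by rewrite (e i j) (e k j) sgq; exact: h1.
- apply: (gen2 _ G GM.1 GZ GB).
  by rewrite (e i j) (e i l) sgq; exact: h2.
- apply: (gen3 _ G GM.1 GB).
  by rewrite (e i j) (e k l); exact: h3.
- apply: (gen4 _ G GM.1 GZ GB).
  by rewrite (e i j) (e k l) (e i l) (e k j) rmorphB sgV sgq; exact: h4.
- apply: (gen1 _ G GM.1 GM.2 GB).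
  by rewrite Gqdet Ggen.
- apply: (gen1 _ G GM.1 GM.2 GB).
  by rewrite Gqdet Ggen.
Qed.

(** Universal property for maps that are semilinear over an endomorphism [sg] fixing [q]; the star
    requires complex conjugation. *)
Lemma Uq_lift : exists Phi : A -> S, [/\ forall c a b, Phi (c *: a + b) = sg c *: Phi a + Phi b,
  forall a b, Phi (a * b) = Phi a * Phi b, Phi 1 = 1
  & forall i, Phi (Uq_proj (fgen C i)) = g i].
Proof.
have Gideal x : two_sided_ideal (Uq_relator q (N:=N)) x -> G x = 0.
  elim=> [a r b Hr||y z _ Hy _ Hz]; last by rewrite GD Hy Hz addr0.
    by rewrite !GM.1 (G_rel Hr) mulr0 mul0r.
  exact: G0.
pose Phi (a : A) := G (generic_quotient.repr a).
have PhiE x : Phi (Uq_proj x) = G x.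
  by apply/eqP; rewrite -subr_eq0 -GB; apply/eqP/Gideal; exact: pres_repr.
exists Phi; split=> [c a b|a b||i].
- have [x ->] := Uq_proj_surj a; have [y ->] := Uq_proj_surj b.
  by rewrite -Uq_projZ -Uq_projD !PhiE GD GZ.
- have [x ->] := Uq_proj_surj a; have [y ->] := Uq_proj_surj b.
  by rewrite -Uq_projM !PhiE GM.1.
- by rewrite -Uq_proj1 PhiE GM.2.
- by rewrite PhiE Ggen.
Qed.
End Lift.
End Quotient.

(** * Cofactors and centrality of the quantum determinant *)

Section CofactorInverse.
Variables (C : fieldType) (q : C) (B : algType C) (n : nat) (M : 'M[B]_n.+1) (Di : B).
Hypotheses (q0 : q != 0) (qM : is_qmat q M).
Hypothesis c0 : forall m, \sum_(s : 'S_m) q ^+ (2 * inversions s) != 0.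
Local Notation D := (qdet q M).

Let q'0 : - q != 0. Proof. by rewrite oppr_eq0. Qed.

Definition qcof (k m : 'I_n.+1) : B :=
  (- q) ^ (k%:Z - m%:Z) *: qdet q (row' m (col' k M)).

Lemma mul_qcof j m : \sum_k M j k * qcof k m = D *+ (j == m).
Proof.
have := qdet_laplace_row qM q0 j m.
move/(congr1 (fun x => (- q) ^- m *: x)).
rewrite -scalerMnr scalerA mulVf ?expf_neq0 // scale1r => <-.
rewrite scaler_sumr; apply: eq_bigr => k _.
by rewrite /qcof -scalerAr scalerA expfzDr // exprnN mulrC.
Qed.

(** This is the expansion of the transpose along its last row; [qdet_tr] turns the transposed matrix
    and its minors back, hence [c0] for different sizes. *)
Lemma qcof_mul j m : \sum_k qcof m k * M k j = D *+ (j == m).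
Proof.
have := qdet_laplace_max (is_qmat_tr qM) q0 j m.
move/(congr1 (fun x => (- q) ^- (n - m) *: x)).
rewrite -scalerMnr scalerA mulVf ?expf_neq0 // scale1r qdet_tr // => <-.
rewrite scaler_sumr; apply: eq_bigr => k _.
have -> : row' m (col' k M^T) = (row' k (col' m M))^T.
  by apply/matrixP => a b; rewrite !mxE.
rewrite qdet_tr //; last exact: is_qmat_minor.
rewrite mxE /qcof -scalerAl scalerA; congr (_ *: _).
rewrite -[(- q) ^+ (n - k)]/((- q) ^ (n - k)%N%:Z) exprnN -expfzDr //.
congr (_ ^ _); have := ltn_ord m; have := ltn_ord k; lia.
Qed.

(** Both sides are the triple product of [M], its cofactor matrix and [M], bracketed in two ways. *)
Lemma qdet_central j k : D * M j k = M j k * D.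
Proof.
transitivity (\sum_m (\sum_l M j l * qcof l m) * M m k).
  rewrite (bigD1 j) //= mul_qcof eqxx mulr1n big1 ?addr0 // => m mj.
  by rewrite mul_qcof eq_sym (negbTE mj) mulr0n mul0r.
under eq_bigr do rewrite mulr_suml.
rewrite exchange_big /=.
transitivity (\sum_l M j l * (\sum_m qcof l m * M m k)).
  by apply: eq_bigr => l _; rewrite mulr_sumr; apply: eq_bigr => m _; rewrite mulrA.
rewrite (bigD1 k) //= qcof_mul eqxx mulr1n big1 ?addr0 // => m mk.
by rewrite qcof_mul eq_sym (negbTE mk) mulr0n mulr0.
Qed.

Hypotheses (DDi : D * Di = 1) (DiD : Di * D = 1).

Lemma qdet_inv_central j k : Di * M j k = M j k * Di.
Proof.
by rewrite -[M j k in LHS]mulr1 -DDi (mulrA (M j k)) -qdet_central -mulrA mulrA mulrA DiD mul1r.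
Qed.

Definition qinv : 'M[B]_n.+1 := \matrix_(k, m) (qcof k m * Di).

Lemma qinvE k m :
  qinv k m = (- q) ^ (k%:Z - m%:Z) *: (qdet q (row' m (col' k M)) * Di).
Proof. by rewrite mxE /qcof -scalerAl. Qed.

Lemma mul_qinv j m : \sum_k M j k * qinv k m = (j == m)%:R.
Proof.
under eq_bigr do rewrite mxE mulrA.
rewrite -mulr_suml mul_qcof; case: eqP => _; last by rewrite mul0r.
by rewrite DDi.
Qed.

Lemma qinv_mul j m : \sum_k qinv j k * M k m = (j == m)%:R.
Proof.
under eq_bigr do rewrite mxE -mulrA qdet_inv_central mulrA.
rewrite -mulr_suml qcof_mul eq_sym; case: eqP => _; last by rewrite mul0r.
by rewrite DDi.
Qed.

End CofactorInverse.

(** * Existence of the star *)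

Section Star.
Variables (C : numClosedFieldType) (q : C).
Hypothesis q_gt0 : 0 < q.

Let q0 : q != 0. Proof. by rewrite gt_eqF. Qed.

Lemma sum_inversions_neq0 m : \sum_(s : 'S_m) q ^+ (2 * inversions s) != 0.
Proof.
rewrite gt_eqF // (bigD1 1%g) //= ltr_pwDl ?exprn_gt0 //.
by apply: sumr_ge0 => s _; rewrite exprn_ge0 // ltW.
Qed.

Section Existence.
Variable n : nat.
Local Notation N := n.+1.
Local Notation A := (Uq q N).
Local Notation u := (Uq_u q N).
Local Notation Dinv := (Uq_Dinv q N).
Let v : 'M[A]_N := qinv q u Dinv.

Let uv j m : \sum_k u j k * v k m = (j == m)%:R.
Proof. exact: mul_qinv q0 (Uq_qmat q N) (Uq_DDinv q N) j m. Qed.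
Let vu j m : \sum_k v j k * u k m = (j == m)%:R.
Proof.
exact: qinv_mul q0 (Uq_qmat q N) sum_inversions_neq0 (Uq_DDinv q N) (Uq_DinvD q N) j m.
Qed.

(** The star is the conjugate-linear homomorphism into the opposite algebra sending u_jk to v_kj and
    [Dinv] to the determinant. It is involutive on generators: applied to u v = 1 it shows that its
    values on [v] form a left inverse of [v], and the inverse of [v] is [u]. *)
Lemma Uq_star_exists : exists s, @is_Uq_star C q N s.
Proof.
have qv : is_qmat q (v : 'M[opp_alg A]_N) := is_qmat_inv q0 uv vu (Uq_qmat q N).
have Dv : qdet q (v : 'M[opp_alg A]_N) = Dinv.
  have := qdet_inv q0 uv vu (Uq_qmat q N).
  move/(congr1 (fun x => Dinv * x)); rewrite mulr1 mulrA.
  by rewrite -[qdet q u]/(Uq_D q N) Uq_DinvD mul1r.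
pose g (i : Uq_index N) : opp_alg A := if i is Some (j, k) then v k j else Uq_D q N.
have gE : (\matrix_(j, k) g (Some (j, k))) = (v : 'M[opp_alg A]_N)^T.
  by apply/matrixP => j k; rewrite mxE [RHS]mxE.
have DvT : qdet q (\matrix_(j, k) g (Some (j, k))) = Dinv.
  rewrite gE (qdet_tr qv q0 (sum_inversions_neq0 _)). exact: Dv.
have qg : is_qmat q (\matrix_(j, k) g (Some (j, k))) by rewrite gE; exact: is_qmat_tr.
have cq : (Num.conj : {rmorphism C -> C}) q = q by apply/CrealP/ger0_real/ltW.
have gD : g None * qdet q (\matrix_(j, k) g (Some (j, k))) = 1.
  by rewrite DvT; exact: Uq_DinvD.
have Dg : qdet q (\matrix_(j, k) g (Some (j, k))) * g None = 1.
  by rewrite DvT; exact: Uq_DDinv.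
have [s [sl sM s1 sg]] := Uq_lift cq qg gD Dg.
have su j k : s (u j k) = v k j by have := sg (Some (j, k)); rewrite Uq_proj_gen.
have sDi : s Dinv = Uq_D q N by have := sg None; rewrite Uq_proj_gen.
have sMA (a b : A) : s (a * b) = (s b : A) * (s a : A) by rewrite sM.
have s0 : s 0 = 0 by have := sl (-1) 1 1; rewrite scaleN1r addNr rmorphN1 scaleN1r addNr.
have sD a b : s (a + b) = s a + s b by have := sl 1 a b; rewrite scale1r rmorph1 scale1r.
have sv l m : s (v l m) = u m l.
  have e' m' j : \sum_k (s (v k m') : A) * v k j = (j == m')%:R.
    transitivity (s (\sum_k u j k * v k m') : A).
      by rewrite (big_morph _ sD s0); apply: eq_bigr => k _; rewrite sMA su.
    by rewrite uv; case: eqP.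
  have WV : kmul (fun m k => s (v k m) : A) (fun k j => v k j) = @kone _ A.
    by apply/funext => m'; apply/funext => j; rewrite /kone eq_sym -e'.
  have VU : kmul (fun k j => v k j) (fun j l => u j l) = @kone _ A.
    by apply/funext => j; apply/funext => k; exact: vu.
  exact: (congr1 (fun F => F m l) (kinv_unique WV VU)).
have sDD : s (Uq_D q N) = Dinv.
  have : (s (Uq_D q N) : A) * Uq_D q N = 1 by rewrite -[X in _ * X]sDi -sMA Uq_DinvD s1.
  by move/(congr1 (fun x => x * Dinv)); rewrite -mulrA Uq_DDinv mulr1 mul1r.
exists (s : A -> A); split=> //.
- elim/Uq_ind => [|c a b sa sb|a b sa sb|j k|].
  + by rewrite !s1.
  + by rewrite !sl sa sb -[X in X *: _]/((c^*)^*) conjCK.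
  + by rewrite !sMA sa sb.
  + by rewrite su sv.
  + by rewrite sDi sDD.
- by move=> j k; rewrite su /v qinvE.
Qed.

End Existence.

Variable N : nat.
Hypothesis N_gt0 : (0 < N)%N.
Local Notation A := (Uq q N).
Local Notation u := (Uq_u q N).
Local Notation Dinv := (Uq_Dinv q N).
Local Notation star := (Uq_star q N).

Lemma Uq_starP : is_Uq_star star.
Proof.
apply: (@xgetPex _ (fun a : A => a) (@is_Uq_star C q N)).
by case: N N_gt0 => // n _; exact: Uq_star_exists.
Qed.

Lemma u_unitary_row j m : \sum_k u j k * star (u m k) = (j == m)%:R.
Proof.
have [_ _ _ sE _] := Uq_starP; under eq_bigr do rewrite sE.
case: N N_gt0 j m => // n _ j m.
rewrite -(mul_qinv q0 (Uq_qmat q n.+1) (Uq_DDinv q n.+1) j m).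
by apply: eq_bigr => k _; rewrite qinvE.
Qed.

Lemma u_unitary_col j m : \sum_k star (u k j) * u k m = (j == m)%:R.
Proof.
have [_ _ _ sE _] := Uq_starP; under eq_bigr do rewrite sE.
case: N N_gt0 j m => // n _ j m.
rewrite -(qinv_mul q0 (Uq_qmat q n.+1) sum_inversions_neq0
  (Uq_DDinv q n.+1) (Uq_DinvD q n.+1) j m).
by apply: eq_bigr => k _; rewrite qinvE.
Qed.

Lemma Dinv_central_u j k : Dinv * u j k = u j k * Dinv.
Proof.
case: N N_gt0 j k => [|n] N0 j k; first case: (notF N0).
exact: qdet_inv_central q0 (Uq_qmat q n.+1) sum_inversions_neq0
  (Uq_DDinv q n.+1) (Uq_DinvD q n.+1) j k.
Qed.

End Star.

(** * Hilbert spaces *)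

Local Open Scope classical_set_scope.
Local Open Scope ring_scope.

Section PlainLinear.
Variables (K : numFieldType) (V W : lmodType K) (T : V -> W).
Hypothesis Tl : linear T.

Lemma linD x y : T (x + y) = T x + T y.
Proof. by rewrite -[x]scale1r Tl !scale1r. Qed.

Lemma lin0 : T 0 = 0.
Proof. by apply: (addrI (T 0)); rewrite -linD !addr0. Qed.

Lemma linZ c x : T (c *: x) = c *: T x.
Proof. by rewrite -[c *: x]addr0 Tl lin0 addr0. Qed.

Lemma linN x : T (- x) = - T x.
Proof. by rewrite -scaleN1r linZ scaleN1r. Qed.

Lemma linB x y : T (x - y) = T x - T y.
Proof. by rewrite linD linN. Qed.

Lemma lin_sum (I : Type) (r : seq I) (P : pred I) (F : I -> V) :
  T (\sum_(i <- r | P i) F i) = \sum_(i <- r | P i) T (F i).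
Proof. exact: (big_morph T linD lin0). Qed.

End PlainLinear.

(* Convergence of sequences for a norm with values in C; the field R[i]
   carries no canonical topology. *)
Definition tends (C : numFieldType) (V : normedZmodType C) (x : nat -> V) (l : V) :=
  forall e : C, 0 < e -> exists n0, forall n, (n0 <= n)%N -> `|x n - l| < e.

Section Tends.
Variables (C : numFieldType) (V : normedZmodType C).
Implicit Types (x y : nat -> V) (l m : V).

Lemma tends_cst l : tends (fun=> l) l.
Proof. by move=> e e0; exists 0%N => n _; rewrite subrr normr0. Qed.

Lemma tendsD x y l m : tends x l -> tends y m -> tends (fun n => x n + y n) (l + m).
Proof.
move=> xl ym e e0; have e2 : 0 < e / 2 by rewrite divr_gt0.
have [n1 h1] := xl _ e2; have [n2 h2] := ym _ e2.
exists (maxn n1 n2) => n; rewrite geq_max => /andP[/h1 {}h1 /h2 {}h2].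
rewrite opprD addrACA (le_lt_trans (ler_normD _ _)) //.
by rewrite [ltRHS]splitr ltrD.
Qed.

Lemma tendsN x l : tends x l -> tends (fun n => - x n) (- l).
Proof.
move=> xl e /xl[n0 h]; exists n0 => n /h; by rewrite -normrN opprD !opprK.
Qed.

Lemma tendsB x y l m : tends x l -> tends y m -> tends (fun n => x n - y n) (l - m).
Proof. by move=> xl ym; apply: tendsD => //; exact: tendsN. Qed.

Lemma tends_unique x l m : tends x l -> tends x m -> l = m.
Proof.
move=> xl xm; apply/eqP; rewrite -subr_eq0 -normr_eq0; apply: contraT => ne.
have e0 : 0 < `|l - m| by rewrite lt_def ne normr_ge0.
have [n0 h] := tendsB xl xm e0.
have := h n0 (leqnn _); by rewrite subrr sub0r normrN ltxx.
Qed.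

(** [M] may be any complex number: the hypothesis forces the right side to be nonnegative, and
    comparison with the norm of [M] plus 1 avoids a division by zero. *)
Lemma tends_dom (W : normedZmodType C) (y : nat -> W) (m : W) x l (M : C) :
  tends y m -> (forall n, `|x n - l| <= M * `|y n - m|) -> tends x l.
Proof.
move=> ym h e e0; have M0 : 0 < `|M| + 1 by rewrite ltr_wpDl.
have [n0 hn] := ym _ (divr_gt0 e0 M0); exists n0 => n /hn lt_n.
have MV : `|M * `|y n - m| | = M * `|y n - m|.
  by rewrite ger0_norm // (le_trans _ (h n)).
apply: (le_lt_trans (h n)).
rewrite -MV normrM normr_id (le_lt_trans (y := (`|M| + 1) * `|y n - m|)) //.
  by rewrite ler_wpM2r // lerDl.
by rewrite mulrC -ltr_pdivlMr.
Qed.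

Lemma tends0P x l : tends (fun n => x n - l) 0 <-> tends x l.
Proof. by split=> h e /h[n0 H]; exists n0 => n /H; rewrite subr0. Qed.

Lemma tends_norm0 x : tends (fun n => `|x n| : C) 0 <-> tends x 0.
Proof. by split=> h e /h[n0 H]; exists n0 => n /H; rewrite !subr0 normr_id. Qed.

Lemma eq_tends x y l : (forall n, x n = y n) -> tends x l -> tends y l.
Proof. by move=> xy xl e /xl[n0 H]; exists n0 => n /H; rewrite xy. Qed.

Lemma tends_bounded x l : tends x l ->
  exists2 M : C, 0 < M & exists n0, forall n, (n0 <= n)%N -> `|x n| <= M.
Proof.
move=> /(_ 1 ltr01)[n0 h]; exists (`|l| + 1); first by rewrite ltr_wpDl.
exists n0 => n /h lt1; rewrite -[x n](subrK l) addrC (le_trans (ler_normD _ _)) //.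
by rewrite lerD2l ltW.
Qed.

Lemma tends_sum (I : Type) (r : seq I) (P : pred I) (F : I -> nat -> V) (L : I -> V) :
  (forall i, P i -> tends (F i) (L i)) ->
  tends (fun n => \sum_(i <- r | P i) F i n) (\sum_(i <- r | P i) L i).
Proof.
move=> h; elim: r => [|i r IH].
  rewrite big_nil; apply: eq_tends (tends_cst 0) => n; by rewrite big_nil.
rewrite big_cons; case: ifP => Pi.
  by apply: eq_tends (tendsD (h i Pi) IH) => n; rewrite big_cons Pi.
by apply: eq_tends IH => n; rewrite big_cons Pi.
Qed.

End Tends.

Section TendsScalar.
Variable C : numClosedFieldType.
Implicit Types (x y : nat -> C) (l m : C).

Lemma tendsM x y l m : tends x l -> tends y m -> tends (fun n => x n * y n) (l * m).
Proof.
move=> xl ym e e0; have [M M0 [n1 hM]] := tends_bounded xl.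
have d1 : 0 < e / 2 / M by rewrite !divr_gt0.
have m0 : 0 < `|m| + 1 by rewrite ltr_wpDl.
have d2 : 0 < e / 2 / (`|m| + 1) by rewrite !divr_gt0.
have [n2 h2] := ym _ d1; have [n3 h3] := xl _ d2.
exists (maxn n1 (maxn n2 n3)) => n; rewrite !geq_max => /and3P[/hM{}hM /h2{}h2 /h3{}h3].
have -> : x n * y n - l * m = x n * (y n - m) + (x n - l) * m by ring.
rewrite (le_lt_trans (ler_normD _ _)) // [ltRHS]splitr !normrM ltr_leD //.
  apply: le_lt_trans (_ : M * `|y n - m| < _); first by rewrite ler_wpM2r.
  by rewrite mulrC -ltr_pdivlMr.
apply: le_trans (_ : `|x n - l| * (`|m| + 1) <= _).
  by rewrite ler_wpM2l // lerDl.
by rewrite -ler_pdivlMr // ltW.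
Qed.

Lemma tends_conj x l : tends x l -> tends (fun n => (x n)^*) l^*.
Proof.
by move=> xl e /xl[n0 h]; exists n0 => n /h; rewrite -rmorphB norm_conjC.
Qed.

Lemma tends_ge0 x l : tends x l -> (forall n, 0 <= x n) -> 0 <= l.
Proof.
move=> xl x0.
have lr : l^* = l.
  apply: tends_unique (tends_conj xl) _; apply: eq_tends xl => n.
  by apply/esym/CrealP/ger0_real.
have {}lr : l \is Num.real by apply/CrealP.
rewrite real_leNgt ?real0 //; apply/negP => l0.
have [n0 h] : exists n0, forall n, (n0 <= n)%N -> `|x n - l| < - l.
  by apply: xl; rewrite oppr_gt0.
have := h n0 (leqnn _); rewrite ger0_norm ?subr_ge0 ?(le_trans (ltW l0)) //.
by rewrite ltrBlDr addNr => /(le_lt_trans (x0 n0)); rewrite ltxx.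
Qed.

End TendsScalar.

Section TendsModule.
Variables (C : numClosedFieldType) (V : normedModType C).

Lemma tendsZ (c : C) (x : nat -> V) l : tends x l -> tends (fun n => c *: x n) (c *: l).
Proof.
by move=> xl; apply: (tends_dom (M := `|c|) xl) => n; rewrite -scalerBr normrZ.
Qed.

End TendsModule.

(** * Positive semidefinite hermitian forms *)

Section Forms.
Variables (C : numClosedFieldType) (V : lmodType C) (b : V -> V -> C).

Definition psd_form := [/\ forall x, scalar (b x), forall x y, b y x = (b x y)^*
  & forall x, 0 <= b x x].

Hypothesis bP : psd_form.
Definition snorm x := sqrtC (b x x).

Let bl x : scalar (b x). Proof. by case: bP. Qed.
Lemma hformC x y : b y x = (b x y)^*. Proof. by case: bP. Qed.
Lemma hform_ge0 x : 0 <= b x x. Proof. by case: bP. Qed.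
Lemma hformDr x : {morph b x : y z / y + z}.
Proof. by move=> y z; have := bl x 1 y z; rewrite scale1r mul1r. Qed.
Lemma hformr0 x : b x 0 = 0.
Proof. by have := bl x 1 0 0; rewrite scale1r mul1r addr0 => /eqP; rewrite eq_sym -subr_eq0 addrK => /eqP. Qed.
Lemma hformZr x c y : b x (c *: y) = c * b x y.
Proof. by have := bl x c y 0; rewrite !addr0 hformr0 addr0. Qed.
Lemma hformNr x y : b x (- y) = - b x y.
Proof. by rewrite -scaleN1r hformZr mulN1r. Qed.
Lemma hformBr x : {morph b x : y z / y - z}.
Proof. by move=> y z; rewrite hformDr hformNr. Qed.
Lemma hformDl x y z : b (y + z) x = b y x + b z x.
Proof. by rewrite hformC hformDr rmorphD /= -!hformC. Qed.
Lemma hformZl x c y : b (c *: y) x = c^* * b y x.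
Proof. by rewrite hformC hformZr rmorphM /= -hformC. Qed.
Lemma hform0l x : b 0 x = 0.
Proof. by rewrite hformC hformr0 rmorph0. Qed.
Lemma hformNl x y : b (- y) x = - b y x.
Proof. by rewrite hformC hformNr rmorphN /= -hformC. Qed.
Lemma hformBl x y z : b (y - z) x = b y x - b z x.
Proof. by rewrite hformDl hformNl. Qed.

Lemma hform_cauchy_schwarz2 x y : `|b x y| ^+ 2 <= b x x * b y y.
Proof.
have sq t : 0 <= b x x - t * b x y - t^* * b y x + `|t| ^+ 2 * b y y.
  have := hform_ge0 (x - t *: y).
  rewrite hformBr !hformBl !hformZr !hformZl normCK.
  by congr (0 <= _); ring.
(* If b y y = 0 while z = b x y is nonzero, a suitable multiple of the conjugate of z as t makes the
   expression in [sq] equal to - b x x - 2, which is negative. Otherwise the minimizing t is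
   inserted. *)
have [y0|y0] := eqVneq (b y y) 0.
  rewrite y0 mulr0 normCK; move: (hform_ge0 x) => x0.
  have n0 : 0 <= b x y * (b x y)^* by rewrite mul_conjC_ge0.
  rewrite real_leNgt ?real0 ?ger0_real //; apply/negP => n1.
  set z := b x y in n0 n1 *; pose k := (b x x + 1) / (z * z^*).
  have kr : k^* = k.
    by apply/CrealP/ger0_real; rewrite divr_ge0 // addr_ge0.
  have := sq (k * z^*).
  rewrite y0 mulr0 addr0 (hformC x y) rmorphM /= conjCK kr -/z.
  have -> : b x x - k * z^* * z - k * z * z^* = - b x x - 2.
    have z0 : z != 0 by apply: contraTneq n1 => ->; rewrite mul0r ltxx.
    by rewrite /k; field; rewrite ?conjC_eq0 z0.
  rewrite -opprD oppr_ge0 => /(lt_le_trans (_ : 0 < b x x + 2)).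
  by rewrite ltr_wpDl // => /(_ isT); rewrite ltxx.
have y1 : 0 < b y y by rewrite lt_def y0 hform_ge0.
have yr : (b y y)^* = b y y by apply/CrealP/ger0_real/ltW.
have := sq ((b x y)^* / b y y); rewrite (hformC x y) rmorphM /= conjCK fmorphV /=.
rewrite yr normrM normfV norm_conjC (ger0_norm (ltW y1)) exprMn.
set z := b x y; set Y := b y y in y0 y1 *; rewrite -(pmulr_lge0 _ y1).
have -> : (b x x - z^* / Y * z - z / Y * z^* + `|z| ^+ 2 * Y^-1 ^+ 2 * Y) * Y
    = b x x * Y - `|z| ^+ 2 by rewrite normCK; field.
by rewrite subr_ge0.
Qed.

Lemma snorm_ge0 x : 0 <= snorm x.
Proof. by rewrite sqrtC_ge0 hform_ge0. Qed.

Lemma snormK x : snorm x ^+ 2 = b x x.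
Proof. exact: sqrtCK. Qed.

Lemma hform_cauchy_schwarz x y : `|b x y| <= snorm x * snorm y.
Proof.
rewrite -(@ler_pXn2r _ 2) ?nnegrE ?mulr_ge0 ?snorm_ge0 //.
by rewrite exprMn !snormK hform_cauchy_schwarz2.
Qed.

Lemma snormD x y : snorm (x + y) <= snorm x + snorm y.
Proof.
rewrite -(@ler_pXn2r _ 2) ?nnegrE ?addr_ge0 ?snorm_ge0 //.
rewrite snormK sqrrD !snormK hformDr !hformDl (hformC x y).
have -> : b x x + (b x y)^* + (b x y + b y y) = b x x + (b x y + (b x y)^*) + b y y by ring.
rewrite lerD2r lerD2l -mulr_natl.
have -> : b x y + (b x y)^* = 2 * 'Re (b x y) by rewrite ReE mulrC divfK // pnatr_eq0.
rewrite ler_pM2l ?ltr0n //; apply: le_trans (hform_cauchy_schwarz x y).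
have := leif_normC_Re_Creal (b x y) => -[+ _]; apply: le_trans.
by rewrite real_ler_norm // Creal_Re.
Qed.

Lemma snormZ c x : snorm (c *: x) = `|c| * snorm x.
Proof.
by rewrite /snorm hformZr hformZl mulrA -normCK sqrtCM ?nnegrE ?exprn_ge0 ?hform_ge0 // sqrCK.
Qed.

Lemma snorm0 : snorm 0 = 0.
Proof. by rewrite /snorm hformr0 sqrtC0. Qed.

End Forms.

Section ComplexSequences.
Variable R : realType.
Local Notation C := R[i].

(** An explicit null sequence: it measures approximations, and it is the distance of the resolvent
    parameters [rho n] from 1. *)
Definition harm (n : nat) : C := n.+1%:R^-1.

Lemma harm_gt0 n : 0 < harm n. Proof. by rewrite invr_gt0 ltr0n. Qed.

Lemma harm_le m n : (m <= n)%N -> harm n <= harm m.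
Proof. by move=> mn; rewrite lef_pV2 ?posrE ?ltr0n // ler_nat ltnS. Qed.

Lemma harm_small (e : C) : 0 < e -> exists n, harm n < e.
Proof.
move=> e0; have er : e = (complex.Re e)%:C%C.
  by rewrite RRe_real // ger0_real // ltW.
have re0 : 0 < complex.Re e by move: e0; rewrite {1}er ltcR.
exists (Num.truncn (complex.Re e)^-1).
have lt_t := truncnS_gt (complex.Re e)^-1.
rewrite [ltRHS]er /harm.
have -> : (Num.truncn (complex.Re e)^-1).+1%:R^-1 =
   ((Num.truncn (complex.Re e)^-1).+1%:R^-1 : R)%:C%C :> C.
  by rewrite rmorphV ?unitfE ?pnatr_eq0 // rmorph_nat.
by rewrite ltcR -[ltRHS]invrK ltf_pV2 ?posrE ?ltr0n ?invr_gt0.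
Qed.

Lemma tends_harm : tends harm 0.
Proof.
move=> e /harm_small[n0 h]; exists n0 => n nn.
by rewrite subr0 ger0_norm ?ltW ?harm_gt0 // (le_lt_trans (harm_le nn)).
Qed.

Lemma tends_le_harm (V : normedZmodType C) (x : nat -> V) l :
  (forall n, `|x n - l| <= harm n) -> tends x l.
Proof.
move=> h; apply: (tends_dom (M := 1) tends_harm) => n.
by rewrite subr0 mul1r (ger0_norm (ltW (harm_gt0 n))).
Qed.

Definition cauchyseq (V : normedZmodType C) (x : nat -> V) := forall e : C, 0 < e ->
  exists n0, forall m n, (n0 <= m)%N -> (n0 <= n)%N -> `|x m - x n| < e.

Lemma tends_cauchy (V : normedZmodType C) (x : nat -> V) l : tends x l -> cauchyseq x.
Proof.
move=> xl e e0; have [n0 h] := xl _ (divr_gt0 e0 (ltr0n _ 2)).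
exists n0 => m n /h hm /h hn.
rewrite -[x m](subrK l) -addrA (le_lt_trans (ler_normD _ _)) // [ltRHS]splitr ltrD //.
by rewrite distrC.
Qed.

Lemma real_cauchyseq (x : nat -> R) : (forall e : R, 0 < e ->
    exists n0, forall m n, (n0 <= m)%N -> (n0 <= n)%N -> `|x m - x n| < e) ->
  exists l : R, forall e : R, 0 < e -> exists n0, forall n, (n0 <= n)%N -> `|x n - l| < e.
Proof.
move=> xc.
have /cvg_ex[l /cvgrPdist_lt xl] : cvg (x @ \oo).
  apply/cauchy_cvgP/cauchy_exP => e e0; have [n0 h] := xc _ e0.
  exists (x n0); exists n0 => // n /= nn; rewrite /ball /=; exact: h.
exists l => e /xl [n0 _ h]; exists n0 => n nn; rewrite distrC; exact: h.
Qed.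

Lemma complex_complete (x : nat -> C) : cauchyseq x -> exists l, tends x l.
Proof.
move=> xc.
have part (f : C -> R) : {morph f : y z / y - z} -> (forall z : C, (`|f z|%:C)%C <= `|z|) ->
    exists l : R, forall e : R, 0 < e ->
      exists n0, forall n, (n0 <= n)%N -> `|f (x n) - l| < e.
  move=> fB hf; apply: real_cauchyseq => e e0.
  have [n0 h] : exists n0, forall m n, (n0 <= m)%N -> (n0 <= n)%N -> `|x m - x n| < e%:C%C.
    by apply: xc; rewrite ltcR.
  exists n0 => m n hm hn; rewrite -fB -ltcR.
  exact: le_lt_trans (hf _) (h _ _ hm hn).
have [a ha] : exists l : R, forall e : R, 0 < e ->
      exists n0, forall n, (n0 <= n)%N -> `|complex.Re (x n) - l| < e.
  by apply: (part (@complex.Re R)) => [[? ?] [? ?]|z] //; exact: normc_ge_Re.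
have [b hb] : exists l : R, forall e : R, 0 < e ->
      exists n0, forall n, (n0 <= n)%N -> `|complex.Im (x n) - l| < e.
  apply: (part (@complex.Im R)) => [[? ?] [? ?] //|z].
  by case: z => c d; rewrite normc_def /= lecR -sqrtr_sqr ler_wsqrtr // lerDr sqr_ge0.
exists (a +i* b)%C => e e0; have er : e = (complex.Re e)%:C%C.
  by rewrite RRe_real // ger0_real // ltW.
have re0 : 0 < complex.Re e / 2 by rewrite divr_gt0 //; move: e0; rewrite {1}er ltcR.
have [n1 h1] := ha _ re0; have [n2 h2] := hb _ re0.
exists (maxn n1 n2) => n; rewrite geq_max => /andP[/h1 {}h1 /h2 {}h2].
rewrite [x n - _]complexE (le_lt_trans (ler_normD _ _)) // normrM complexiE normCi mul1r.
rewrite [ltRHS]er [complex.Re e]splitr rmorphD ltrD //.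
  by rewrite normc_def /= expr0n /= addr0 sqrtr_sqr ltcR raddfB.
by rewrite normc_def /= expr0n /= addr0 sqrtr_sqr ltcR raddfB.
Qed.

End ComplexSequences.

(** * Completion of a semidefinite form *)

Record prehilbert (R : realType) := Prehilbert {
  ph_sort :> lmodType R[i];
  ph_form : ph_sort -> ph_sort -> R[i];
  ph_psd : psd_form ph_form
}.

(* The Hilbert space completion of V: its elements are the pointwise limits of
   the functions b(., x n) for the Cauchy sequences x of V. *)
Section Completion.
Variables (R : realType) (V : prehilbert R).
Local Notation C := R[i].
Local Notation b := (@ph_form R V).
Let bP : psd_form b := @ph_psd R V.
Local Notation p := (snorm b).

Definition pcauchy (x : nat -> V) := forall e : C, 0 < e ->
  exists n0, forall m n, (n0 <= m)%N -> (n0 <= n)%N -> p (x m - x n) < e.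

Lemma pcauchy_lin c x y : pcauchy x -> pcauchy y -> pcauchy (fun n => c *: x n + y n).
Proof.
move=> xc yc e e0; have e2 : 0 < e / 2 by rewrite divr_gt0.
have c0 : 0 < `|c| + 1 by rewrite ltr_wpDl.
have [n1 h1] := xc _ (divr_gt0 e2 c0); have [n2 h2] := yc _ e2.
exists (maxn n1 n2) => m n; rewrite !geq_max => /andP[m1 m2] /andP[n1' n2'].
have -> : c *: x m + y m - (c *: x n + y n) = c *: (x m - x n) + (y m - y n).
  by rewrite scalerBr opprD addrACA.
rewrite (le_lt_trans (snormD bP _ _)) // [ltRHS]splitr ltrD ?h2 // snormZ //.
rewrite (le_lt_trans (y := (`|c| + 1) * p (x m - x n))) //.
  by rewrite ler_wpM2r ?snorm_ge0 // lerDl.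
by rewrite mulrC -ltr_pdivlMr // h1.
Qed.

Lemma pcauchy_cst v : pcauchy (fun=> v).
Proof. by move=> e e0; exists 0%N => *; rewrite subrr snorm0. Qed.

Lemma pcauchy_bounded x : pcauchy x ->
  exists2 M : C, 0 < M & exists n0, forall n, (n0 <= n)%N -> p (x n) <= M.
Proof.
move=> /(_ 1 ltr01)[n0 h]; exists (p (x n0) + 1); first by rewrite ltr_wpDl ?snorm_ge0.
exists n0 => n nn; rewrite -[x n](subrK (x n0)) addrC (le_trans (snormD bP _ _)) //.
by rewrite lerD2l ltW // h.
Qed.

Lemma pcauchy_form x y : pcauchy x -> pcauchy y ->
  exists l, tends (fun n => b (x n) (y n)) l.
Proof.
move=> xc yc; apply: complex_complete => e e0.
have e2 : 0 < e / 2 by rewrite divr_gt0.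
have [M M0 [n1 hM]] := pcauchy_bounded xc; have [K K0 [n2 hK]] := pcauchy_bounded yc.
have [n3 h3] := xc _ (divr_gt0 e2 K0); have [n4 h4] := yc _ (divr_gt0 e2 M0).
exists (maxn (maxn n1 n2) (maxn n3 n4)) => m n; rewrite !geq_max.
move=> /andP[/andP[m1 m2] /andP[m3 m4]] /andP[/andP[k1 k2] /andP[k3 k4]].
have -> : b (x m) (y m) - b (x n) (y n) = b (x m - x n) (y m) + b (x n) (y m - y n).
  by rewrite (hformBl bP) (hformBr bP) addrA subrK.
rewrite (le_lt_trans (ler_normD _ _)) // [ltRHS]splitr ltrD //.
  rewrite (le_lt_trans (hform_cauchy_schwarz bP _ _)) //.
  rewrite (le_lt_trans (y := p (x m - x n) * K)) ?ler_wpM2l ?snorm_ge0 ?hK //.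
  by rewrite -ltr_pdivlMr // h3.
rewrite (le_lt_trans (hform_cauchy_schwarz bP _ _)) //.
rewrite (le_lt_trans (y := M * p (y m - y n))) ?ler_wpM2r ?snorm_ge0 ?hM //.
by rewrite mulrC -ltr_pdivlMr // h4.
Qed.

Definition represents (x : nat -> V) (f : V -> C) :=
  pcauchy x /\ forall w, tends (fun n => b w (x n)) (f w).

Lemma pcauchy_represents x : pcauchy x -> exists f, represents x f.
Proof.
move=> xc; have h w : exists l, tends (fun n => b w (x n)) l.
  exact: (pcauchy_form (pcauchy_cst w) xc).
by have [f hf] := choice h; exists f.
Qed.

Lemma represents_lin c x y f g : represents x f -> represents y g ->
  represents (fun n => c *: x n + y n) (c *: f + g).
Proof.
move=> [xc xf] [yc yg]; split; first exact: pcauchy_lin.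
move=> w; apply: eq_tends (tendsD (tendsM (tends_cst c) (xf w)) (yg w)) => n.
by rewrite (hformDr bP) (hformZr bP).
Qed.

(** A Cauchy sequence that tends to 0 weakly tends to 0 in seminorm: b (x n) (x n) differs little
    from b (x m) (x n) for one fixed late m. Hence [cinner] does not depend on the representing
    sequences. *)
Lemma represents_null x f y : represents x f -> (forall w, f w = 0) -> pcauchy y ->
  tends (fun n => b (x n) (y n)) 0.
Proof.
move=> [xc xf] f0 yc.
have pn e : 0 < e -> exists n0, forall n, (n0 <= n)%N -> p (x n) < e.
  move=> e0; have [M M0 [n1 hM]] := pcauchy_bounded xc.
  have ee : 0 < e ^+ 2 / 2 by rewrite divr_gt0 // exprn_gt0.
  have [n2 h2] := xc _ (divr_gt0 ee M0).
  pose m := maxn n1 n2; have := xf (x m); rewrite f0 => /(_ _ ee)[n3 h3].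
  exists (maxn (maxn n1 n2) n3) => n; rewrite !geq_max => /andP[/andP[k1 k2] k3].
  rewrite -(@ltr_pXn2r _ 2) ?nnegrE ?snorm_ge0 ?(ltW e0) // snormK //.
  have -> : b (x n) (x n) = b (x n - x m) (x n) + b (x m) (x n).
    by rewrite (hformBl bP) subrK.
  have bn : b (x n - x m) (x n) + b (x m) (x n) = `|b (x n - x m) (x n) + b (x m) (x n)|.
    by rewrite -(hformDl bP) subrK ger0_norm // hform_ge0.
  rewrite bn (le_lt_trans (ler_normD _ _)) // [ltRHS]splitr ltrD //; last first.
    by have := h3 _ k3; rewrite subr0.
  rewrite (le_lt_trans (hform_cauchy_schwarz bP _ _)) //.
  rewrite (le_lt_trans (y := p (x n - x m) * M)) ?ler_wpM2l ?snorm_ge0 ?hM //.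
  by rewrite -ltr_pdivlMr // h2 // leq_maxr.
move=> e e0; have [K K0 [n1 hK]] := pcauchy_bounded yc.
have [n2 h2] := pn _ (divr_gt0 e0 K0); exists (maxn n1 n2) => n.
rewrite geq_max => /andP[k1 k2]; rewrite subr0.
rewrite (le_lt_trans (hform_cauchy_schwarz bP _ _)) //.
rewrite (le_lt_trans (y := p (x n) * K)) ?ler_wpM2l ?snorm_ge0 ?hK //.
by rewrite -ltr_pdivlMr // h2.
Qed.

Definition completion_pred : {pred V -> C} := fun f => `[< exists x, represents x f >].

Fact completion_submod : submod_closed completion_pred.
Proof.
split.
  apply/asboolP; exists (fun=> 0); split; first exact: pcauchy_cst.
  by move=> w; apply: eq_tends (tends_cst 0) => n; rewrite (hformr0 bP).
move=> c f g /asboolP[x xf] /asboolP[y yg]; apply/asboolP.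
by exists (fun n => c *: x n + y n); exact: represents_lin.
Qed.
HB.instance Definition _ := GRing.isSubmodClosed.Build C (V -> C) completion_pred
  completion_submod.

Definition completion : Type := {f : V -> C | completion_pred f}.
HB.instance Definition _ := SubType.on completion.
HB.instance Definition _ := [Choice of completion by <:].
HB.instance Definition _ := [SubChoice_isSubLmodule of completion by <:].

Lemma completion_rep (f : completion) : exists x, represents x (val f).
Proof. by have /asboolP := valP f. Qed.

Definition crep (f : completion) : nat -> V := projT1 (cid (completion_rep f)).
Lemma crepP (f : completion) : represents (crep f) (val f).
Proof. exact: (projT2 (cid (completion_rep f))). Qed.

Definition cinner (f g : completion) : C :=
  xget 0 [set l | tends (fun n => b (crep f n) (crep g n)) l].

Lemma cinner_crep f g : tends (fun n => b (crep f n) (crep g n)) (cinner f g).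
Proof.
have [[fc _] [gc _]] := (crepP f, crepP g).
have [l hl] := pcauchy_form fc gc.
exact: (@xgetPex _ 0 [set l | tends (fun n => b (crep f n) (crep g n)) l]) (ex_intro _ l hl).
Qed.

Lemma cinnerP x y (f g : completion) : represents x (val f) -> represents y (val g) ->
  tends (fun n => b (x n) (y n)) (cinner f g).
Proof.
move=> xf yg; have := cinner_crep f g.
have dif z (h : completion) (hz : represents z (val h)) : represents (fun n => -1 *: crep h n + z n)
    (-1 *: val h + val h) by exact: represents_lin (crepP h) hz.
have z0 (h : completion) w : (-1 *: val h + val h : V -> C) w = 0 by rewrite scaleN1r addNr.
move=> lim; have l1 := represents_null (dif _ _ xf) (z0 f) yg.1.
have l2 := represents_null (dif _ _ yg) (z0 g) (crepP f).1.
have := tendsD (tendsD l1 (tends_conj l2)) lim; rewrite rmorph0 !add0r.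
apply: eq_tends => n.
rewrite -(hformC bP) !(hformDl bP, hformDr bP) !(hformZl bP, hformZr bP).
rewrite rmorphN1; ring.
Qed.

Lemma cinner_psd : psd_form cinner.
Proof.
split=> [f c g h|f g|f].
- have hr := represents_lin c (crepP g) (crepP h).
  have := cinnerP (crepP f) (hr : represents _ (val (c *: g + h))).
  move=> l; apply: tends_unique l _.
  apply: eq_tends (tendsD (tendsM (tends_cst c) (cinner_crep f g)) (cinner_crep f h)) => n.
  by rewrite (hformDr bP) (hformZr bP).
- apply: tends_unique (cinner_crep g f) _.
  by apply: eq_tends (tends_conj (cinner_crep f g)) => n; rewrite -(hformC bP).
- by apply: tends_ge0 (cinner_crep f f) _ => n; exact: hform_ge0.
Qed.

Let cnorm := snorm cinner.
(** By the Cauchy-Schwarz inequality a vector of seminorm 0 is the zero function; representing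
    vectors by functions has already identified what a null vector separates. *)
Lemma cnorm_eq0 f : cnorm f = 0 -> f = 0.
Proof.
move=> /eqP; rewrite sqrtC_eq0 => /eqP f0; apply: val_inj; apply/funext => w.
have [fc fl] := crepP f.
apply: tends_unique (fl w) _ => e e0.
have pw : 0 < p w + 1 by rewrite ltr_wpDl ?snorm_ge0.
have ee : 0 < (e / (p w + 1)) ^+ 2 by rewrite exprn_gt0 // divr_gt0.
have := cinner_crep f f; rewrite f0 => /(_ _ ee)[n0 h]; exists n0 => n /h.
rewrite !subr0 ger0_norm ?hform_ge0 // -snormK // => lt_n.
have {}lt_n : p (crep f n) < e / (p w + 1).
  by rewrite -(@ltr_pXn2r _ 2) ?nnegrE ?snorm_ge0 // divr_ge0 // ltW.
rewrite (le_lt_trans (hform_cauchy_schwarz bP _ _)) //.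
rewrite (le_lt_trans (y := (p w + 1) * p (crep f n))) //.
  by rewrite ler_wpM2r ?snorm_ge0 // lerDl.
by rewrite mulrC -ltr_pdivlMr.
Qed.

HB.instance Definition _ := @Lmodule_isNormed.Build C completion cnorm
  (snormD cinner_psd) (fun c f => snormZ cinner_psd c f) cnorm_eq0.

Definition embed_fun (v : V) : V -> C := fun w => b w v.

Lemma embed_rep v : represents (fun=> v) (embed_fun v).
Proof. by split; [exact: pcauchy_cst|move=> w; exact: tends_cst]. Qed.

Lemma embed_subproof v : completion_pred (embed_fun v).
Proof. by apply/asboolP; exists (fun=> v); exact: embed_rep. Qed.

Definition embed (v : V) : completion := exist _ (embed_fun v) (embed_subproof v).

Lemma embed_linear : linear embed.
Proof.
move=> c x y; apply: val_inj; apply/funext => w /=.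
by rewrite /embed_fun (hformDr bP) (hformZr bP).
Qed.

Lemma cinner_embed x y : cinner (embed x) (embed y) = b x y.
Proof.
apply: tends_unique (tends_cst _).
exact: (@cinnerP (fun=> x) (fun=> y) (embed x) (embed y) (embed_rep x) (embed_rep y)).
Qed.

Lemma normc_sq (f : completion) : `|f| ^+ 2 = cinner f f.
Proof. exact: snormK. Qed.

Lemma represents_tends x (f : completion) : represents x (val f) ->
  tends (fun n => embed (x n)) f.
Proof.
move=> xf e e0; have [xc _] := xf.
have e2 : 0 < e / 2 by rewrite divr_gt0.
have [n0 h] := xc _ e2; exists n0 => n nn.
have le_e : e / 2 < e by rewrite gtr_pMr // invf_lt1 ?ltr0n // ltr1n.
apply: le_lt_trans le_e.
rewrite -(@ler_pXn2r _ 2) ?nnegrE ?normr_ge0 ?(ltW e2) // normc_sq.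
have rn : represents (fun m => -1 *: x m + x n) (val (embed (x n) - f)).
  have -> : embed (x n) - f = -1 *: f + embed (x n) by rewrite scaleN1r addrC.
  exact: represents_lin xf (embed_rep (x n)).
have lim := cinnerP rn rn.
rewrite -subr_ge0.
(* The limit is taken along indices at least [n0], where the Cauchy bound holds for every term. *)
pose N m := maxn m n0.
have := @tends_ge0 _ (fun m => (e / 2) ^+ 2 - b (-1 *: x (N m) + x n) (-1 *: x (N m) + x n)).
apply.
  apply: tendsB (tends_cst _) _ => d /lim[n1 h1]; exists n1 => m nm.
  by apply: h1; rewrite (leq_trans nm) // leq_maxl.
move=> m; rewrite subr_ge0 -snormK // ler_pXn2r ?nnegrE ?snorm_ge0 ?(ltW e2) //.
by rewrite ltW // scaleN1r addrC h // leq_maxr.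
Qed.

(** Diagonal argument: each [f n] is replaced by a vector of [V] at distance less than [harm R n],
    and these vectors form a Cauchy sequence in [V]. *)
Lemma completion_seq_complete (f : nat -> completion) : cauchyseq f -> exists l, tends f l.
Proof.
move=> fc.
have near n : exists v, `|embed v - f n| < harm R n.
  have [n0 h] := represents_tends (crepP (f n)) (harm_gt0 R n).
  by exists (crep (f n) n0); exact: h.
have [v hv] := choice near.
have vc : pcauchy v.
  move=> e e0; have e3 : 0 < e / 3 by rewrite divr_gt0.
  have [n1 h1] := fc _ e3; have [n2 h2] := harm_small e3.
  exists (maxn n1 n2) => m n; rewrite !geq_max => /andP[m1 m2] /andP[k1 k2].
  have -> : p (v m - v n) = `|embed (v m) - embed (v n)|.
    have -> : embed (v m) - embed (v n) = embed (v m - v n).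
      rewrite -[v m - v n](_ : -1 *: v n + v m = _); last by rewrite scaleN1r addrC.
      by rewrite embed_linear scaleN1r addrC.
    by rewrite [RHS]/(snorm _ _) /snorm cinner_embed.
  have -> : embed (v m) - embed (v n) =
      (embed (v m) - f m) + ((f m - f n) - (embed (v n) - f n)).
    by rewrite opprB [f m - f n + _]addrA subrK addrA subrK.
  rewrite (le_lt_trans (ler_normD _ _)) //.
  have -> : e = e / 3 + (e / 3 + e / 3) by field.
  have em : `|embed (v m) - f m| < e / 3 := lt_trans (hv m) (le_lt_trans (harm_le R m2) h2).
  have en : `|embed (v n) - f n| < e / 3 := lt_trans (hv n) (le_lt_trans (harm_le R k2) h2).
  apply: ltrD em _; apply: le_lt_trans (ler_normB _ _) _.
  by apply: ltrD en; exact: h1.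
have [g vg] := pcauchy_represents vc.
have gP : completion_pred g by apply/asboolP; exists v.
exists (exist _ g gP).
have lim : tends (fun n => embed (v n)) (exist _ g gP) by exact: represents_tends.
have hf : tends (fun n => embed (v n) - f n) 0.
  by apply: tends_le_harm => n; rewrite subr0 ltW.
have := tendsB lim hf; rewrite subr0; apply: eq_tends => n.
by rewrite opprB addrC subrK.
Qed.

(** A Cauchy filter is reduced to a sequence by choosing centres of balls of radius [harm R n] that
    belong to the filter. *)
Fact completion_complete (F : set_system completion) : ProperFilter F -> cauchy F -> cvg F.
Proof.
move=> FF /cauchyP Fc.
have near n : exists x, F (ball x (harm R n)) by apply: Fc; exact: harm_gt0.
have [x hx] := choice near.
have xc : cauchyseq x.
  move=> e e0; have e2 : 0 < e / 2 by rewrite divr_gt0.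
  have [n0 h0] := harm_small e2; exists n0 => m n hm hn.
  have [y [ym yn]] : exists y, ball (x m) (harm R m) y /\ ball (x n) (harm R n) y.
    exact: (@filter_ex _ _ FF _ (filterI (hx m) (hx n))).
  rewrite -[x m](subrK y) -addrA (le_lt_trans (ler_normD _ _)) // [ltRHS]splitr ltrD //.
    by apply: lt_trans ym _; exact: le_lt_trans (harm_le R hm) h0.
  by rewrite distrC; apply: lt_trans yn _; exact: le_lt_trans (harm_le R hn) h0.
have [l xl] := completion_seq_complete xc.
apply/cvg_ex; exists l; apply/cvgrPdist_lt => e e0.
have e2 : 0 < e / 2 by rewrite divr_gt0.
have [n1 h1] := harm_small e2; have [n2 h2] := xl _ e2.
pose n := maxn n1 n2.
apply: filterS (hx n) => y yn.
rewrite -[l](subrK (x n)) -addrA (le_lt_trans (ler_normD _ _)) // [ltRHS]splitr ltrD //.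
  by rewrite distrC h2 // leq_maxr.
by apply: lt_trans yn _; apply: le_lt_trans (harm_le R _) h1; exact: leq_maxl.
Qed.
HB.instance Definition _ := Uniform_isComplete.Build completion completion_complete.

HB.instance Definition _ := @NormedModule_hasInner.Build C completion cinner
  (fun f => let: And3 h _ _ := cinner_psd in h f)
  (fun f g => hformC cinner_psd f g)
  (fun f => esym (normc_sq f)).

End Completion.

Lemma prehilbert_completion (R : realType) (V : lmodType R[i]) (b : V -> V -> R[i]) :
  psd_form b -> exists (H : hilbertType R[i]) (j : V -> H),
  [/\ linear j, forall x y, inner (j x) (j y) = b x y
    & forall h, exists x : nat -> V, tends (fun n => j (x n)) h].
Proof.
move=> bP; pose P := Prehilbert bP.
exists (completion P : hilbertType R[i]), (@embed R P); split.
- by move=> c x y; exact: (@embed_linear R P c x y).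
- by move=> x y; exact: (@cinner_embed R P x y).
- by move=> h; exists (crep h); exact: represents_tends (crepP h).
Qed.

Section HilbertBasics.
Variables (R : realType) (H : hilbertType R[i]).
Local Notation C := R[i].
Implicit Types (x y z : H) (S : set H).

Lemma inner_psd : psd_form (@inner C H).
Proof.
split; [exact: inner_linear|exact: inner_conj|].
by move=> x; rewrite inner_norm exprn_ge0.
Qed.

Definition innerC := hformC inner_psd.
Definition innerDr := hformDr inner_psd.
Definition innerDl := hformDl inner_psd.
Definition innerBr := hformBr inner_psd.
Definition innerBl := hformBl inner_psd.
Definition innerNr := hformNr inner_psd.
Definition innerNl := hformNl inner_psd.
Definition innerZr := hformZr inner_psd.
Definition innerZl := hformZl inner_psd.
Definition inner0r := hformr0 inner_psd.
Definition inner0l := hform0l inner_psd.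

Lemma snorm_inner x : snorm inner x = `|x|.
Proof. by rewrite /snorm inner_norm sqrCK. Qed.

Lemma inner_CS x y : `|inner x y| <= `|x| * `|y|.
Proof. by rewrite -!snorm_inner; exact: hform_cauchy_schwarz inner_psd x y. Qed.

Lemma inner_eq0 x : inner x x = 0 -> x = 0.
Proof. by rewrite inner_norm => /eqP; rewrite expf_eq0 /= normr_eq0 => /eqP. Qed.

Lemma inner_ext x y : (forall z, inner z x = inner z y) -> x = y.
Proof.
move=> h; apply/eqP; rewrite -subr_eq0; apply/eqP/inner_eq0.
by rewrite innerBr h subrr.
Qed.

Lemma inner_suml (I : Type) (r : seq I) (P : pred I) (F : I -> H) x :
  inner (\sum_(i <- r | P i) F i) x = \sum_(i <- r | P i) inner (F i) x.
Proof.
exact: (big_morph (fun y => inner y x) (fun y z => innerDl x y z) (inner0l x)).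
Qed.

Lemma tends_inner (x y : nat -> H) l m : tends x l -> tends y m ->
  tends (fun n => inner (x n) (y n)) (inner l m).
Proof.
move=> xl ym.
have b1 : tends (fun n => inner l (y n - m)) 0.
  apply: (tends_dom (M := `|l|) ym) => n; rewrite subr0; exact: inner_CS.
have [M M0 [n0 hM]] := tends_bounded ym.
have b2 : tends (fun n => inner (x n - l) (y n)) 0.
  move=> e e0; have [n1 h1] := xl _ (divr_gt0 e0 M0); exists (maxn n0 n1) => n.
  rewrite geq_max => /andP[k0 k1]; rewrite subr0 (le_lt_trans (inner_CS _ _)) //.
  rewrite (le_lt_trans (y := `|x n - l| * M)) ?ler_wpM2l ?hM //.
  by rewrite -ltr_pdivlMr // h1.
apply/tends0P; have := tendsD b1 b2; rewrite addr0; apply: eq_tends => n.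
by rewrite innerBr innerBl addrC addrA subrK.
Qed.

Lemma hilbert_complete (x : nat -> H) : cauchyseq x -> exists l, tends x l.
Proof.
move=> xc; have /cvg_ex[l /cvgrPdist_lt xl] : cvg (x @ \oo).
  apply/cauchy_cvgP/cauchy_exP => e e0; have [n0 h] := xc _ e0.
  by exists (x n0), n0 => // n /= nn; rewrite -ball_normE /=; exact: h.
by exists l => e /xl [n0 _ h]; exists n0 => n nn; rewrite distrC; exact: h.
Qed.

Definition seq_closed S := forall (x : nat -> H) l, (forall n, S (x n)) -> tends x l -> S l.

Lemma seq_closed_closed S : seq_closed S -> closed S.
Proof.
move=> Sc l cl.
have near n : exists x, S x /\ `|x - l| < harm R n.
  have [x [Sx]] := cl _ (nbhsx_ballx l _ (harm_gt0 R n)).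
  by rewrite -ball_normE /= distrC => lt; exists x.
have [x hx] := choice near.
apply: (Sc x); first by move=> n; have [] := hx n.
by apply: tends_le_harm => n; rewrite ltW //; have [] := hx n.
Qed.

Lemma denseP S : dense S <-> forall x, exists s : nat -> H, (forall n, S (s n)) /\ tends s x.
Proof.
split=> [dS x|h O [x Ox] Oo].
  have near n : exists s, S s /\ `|s - x| < harm R n.
    have xi : ((ball x (harm R n))° x) by exact: nbhsx_ballx (harm_gt0 R n).
    have [s [sb Ss]] := dS _ (ex_intro _ x xi) (open_interior _).
    have := interior_subset sb; rewrite -ball_normE /= distrC => lt; by exists s.
  have [s hs] := choice near; exists s; split=> [n|]; first by have [] := hs n.
  by apply: tends_le_harm => n; rewrite ltW //; have [] := hs n.
have [s [Ss sx]] := h x.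
have /nbhs_ballP[e /= e0 Be] : nbhs x O by exact: open_nbhs_nbhs.
have [n0 hn] := sx _ e0; exists (s n0); split; last exact: Ss.
by apply: Be; rewrite -ball_normE /= distrC; exact: hn.
Qed.

End HilbertBasics.

(* Linear identities between vectors, tested against inner products. *)
Ltac vring := apply: inner_ext => ?; rewrite ?(innerDr, innerNr, innerZr, inner0r); ring.

Section LinearMaps.
Variables (R : realType) (H H' : hilbertType R[i]).
Local Notation C := R[i].

Lemma linear_bounded_tends (T : H -> H') (M : C) : linear T ->
  (forall x, `|T x| <= M * `|x|) -> forall x l, tends x l -> tends (fun n => T (x n)) (T l).
Proof.
move=> Tl Tb x l xl; apply: (tends_dom (M := M) xl) => n.
have -> : T (x n) - T l = T (x n - l).
  by rewrite linB.
exact: Tb.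
Qed.

Lemma linear_bounded_cont (T : H -> H') (M : C) : linear T ->
  (forall x, `|T x| <= M * `|x|) -> continuous T.
Proof.
move=> Tl Tb x; apply/cvgrPdist_lt => e e0.
have M0 : 0 < `|M| + 1 by rewrite ltr_wpDl.
have ee : 0 < e / (`|M| + 1) by rewrite divr_gt0.
apply: filterS (nbhsx_ballx x _ ee) => y; rewrite -ball_normE /= => xy.
rewrite -(linB Tl); apply: le_lt_trans (Tb _) _.
have h0 : 0 <= M * `|x - y| := le_trans (normr_ge0 _) (Tb _).
rewrite -(ger0_norm h0) normrM normr_id.
apply: (le_lt_trans (y := (`|M| + 1) * `|x - y|)).
  by rewrite ler_wpM2r // lerDl.
by rewrite mulrC -ltr_pdivlMr.
Qed.

Lemma continuous_tends (T : H -> H') : continuous T ->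
  forall x l, tends x l -> tends (fun n => T (x n)) (T l).
Proof.
move=> Tc x l xl e e0.
have /cvgrPdist_lt /(_ _ e0) /nbhs_ballP[d /= d0 Bd] := Tc l.
have [n0 h] := xl _ d0; exists n0 => n nn; rewrite distrC; apply: Bd.
by rewrite -ball_normE /= distrC; exact: h.
Qed.

Lemma isometry_norm (T : H -> H') : isometry T -> forall x, `|T x| = `|x|.
Proof. by move=> [_ Ti] x; rewrite -!snorm_inner /snorm Ti. Qed.

Lemma isometry_tends (T : H -> H') : isometry T ->
  forall x l, tends x l -> tends (fun n => T (x n)) (T l).
Proof.
move=> Ti; apply: (linear_bounded_tends (M := 1) Ti.1) => x.
by rewrite mul1r isometry_norm.
Qed.

Lemma isometry_inj (T : H -> H') : isometry T -> injective T.
Proof.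
move=> Ti x y e; apply/eqP; rewrite -subr_eq0 -normr_eq0.
rewrite -(isometry_norm Ti) normr_eq0.
by rewrite (linB Ti.1) e subrr.
Qed.

End LinearMaps.

(** * Orthogonal projections, extension from dense subspaces, Riesz representation *)

Section Projection.
Variables (R : realType) (H : hilbertType R[i]).
Local Notation C := R[i].

Lemma parallelogram (x y : H) :
  `|x + y| ^+ 2 + `|x - y| ^+ 2 = 2 * `|x| ^+ 2 + 2 * `|y| ^+ 2.
Proof.
rewrite -!inner_norm !(innerDr, innerDl, innerNr, innerNl); ring.
Qed.

Lemma projection_exists (S : set H) : subspace_set S -> seq_closed S ->
  forall x, exists m, S m /\ forall y, S y -> inner y (x - m) = 0.
Proof.
move=> [S0 Sl] Sc x.
pose sq (y : H) : R := complex.Re (`|x - y| ^+ 2).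
have sqE y : (sq y)%:C%C = `|x - y| ^+ 2.
  by rewrite /sq RRe_real // realX // normr_real.
have sq_ge0 y : 0 <= sq y by rewrite -lecR sqE exprn_ge0.
pose E := [set sq y | y in S].
have Einf : has_inf E.
  split; first by exists (sq 0), 0.
  by exists 0 => _ [y _ <-]; exact: sq_ge0.
pose d := inf E.
have d_le y : S y -> d <= sq y by move=> Sy; apply: (inf_lbound Einf.2); exists y.
have near n : exists y, S y /\ sq y < d + n.+1%:R^-1.
  have pos : (0 : R) < n.+1%:R^-1 by rewrite invr_gt0.
  have [_ [y Sy <-] lt_y] := inf_adherent pos Einf.
  by exists y.
have [s hs] := choice near.
have Ss n : S (s n) by have [] := hs n.
have hb n : `|x - s n| ^+ 2 <= d%:C%C + harm R n.
  rewrite -sqE /harm.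
  have -> : n.+1%:R^-1 = (n.+1%:R^-1 : R)%:C%C :> C.
    by rewrite rmorphV ?unitfE ?pnatr_eq0 // rmorph_nat.
  by rewrite -rmorphD lecR ltW //; have [] := hs n.
(* The midpoint lies in [S], so the parallelogram law turns near-minimality of both distances into
   closeness of [s m] and [s n]. *)
have mid m n : `|s m - s n| ^+ 2 <= 2 * harm R m + 2 * harm R n.
  have := parallelogram (x - s m) (x - s n).
  have -> : (x - s m) - (x - s n) = - (s m - s n).
    by rewrite opprB opprB addrC addrA subrK.
  have -> : (x - s m) + (x - s n) = 2 *: (x - 2^-1 *: (s m + s n)).
    rewrite scalerBr scalerA divff ?pnatr_eq0 // scale1r scaler_nat mulr2n.
    by rewrite addrACA opprD.
  rewrite normrN normrZ ger0_norm ?ler0n // exprMn => e.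
  have Sm : S (2^-1 *: (s m + s n)).
    rewrite -[2^-1 *: _]addr0; apply: (Sl) => //.
    by rewrite -[s m]scale1r; apply: (Sl).
  have := d_le _ Sm; rewrite -lecR sqE => dm.
  have -> : `|s m - s n| ^+ 2 = 2 * `|x - s m| ^+ 2 + 2 * `|x - s n| ^+ 2
      - 2 ^+ 2 * `|x - 2^-1 *: (s m + s n)| ^+ 2 by rewrite -e addrAC subrr add0r.
  apply: le_trans (_ : 2 * (d%:C%C + harm R m) + 2 * (d%:C%C + harm R n) -
     2 ^+ 2 * d%:C%C <= _); last by rewrite le_eqVlt; apply/orP; left; apply/eqP; ring.
  by rewrite lerB ?ler_wpM2l ?lerD ?ler_wpM2l ?ler0n ?exprn_ge0 ?hb.
have sc : cauchyseq s.
  move=> e e0; have e2 : 0 < e ^+ 2 / 4 by rewrite divr_gt0 ?exprn_gt0 ?ltr0n.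
  have [n0 h0] := harm_small e2; exists n0 => m n hm hn.
  rewrite -(@ltr_pXn2r _ 2) ?nnegrE ?normr_ge0 ?(ltW e0) //.
  apply: le_lt_trans (mid m n) _.
  have -> : e ^+ 2 = 2 * (e ^+ 2 / 4) + 2 * (e ^+ 2 / 4) by field.
  by rewrite ltrD // ltr_pM2l ?ltr0n // (le_lt_trans (harm_le R _) h0).
have [m sm] := hilbert_complete sc.
have Sm : S m := Sc _ _ Ss sm.
have md : `|x - m| ^+ 2 <= d%:C%C.
  rewrite -subr_ge0.
  apply: (@tends_ge0 _ (fun n => d%:C%C + harm R n - `|x - s n| ^+ 2)).
    apply: tendsB.
      by have := tendsD (tends_cst (d%:C%C : C)) (@tends_harm R); rewrite addr0.
    have nm : tends (fun n => `|x - s n|) `|x - m|.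
      apply: (tends_dom (M := 1) sm) => n; rewrite mul1r.
      apply: le_trans (ler_dist_dist _ _) _.
      by rewrite opprB addrC addrA subrK distrC.
    by rewrite [X in tends _ X]expr2; apply: eq_tends (tendsM nm nm) => n; rewrite expr2.
  by move=> n; rewrite subr_ge0.
exists m; split=> // y Sy; apply/eqP; rewrite -normr_eq0; apply: contraT => ne.
set v := x - m; set z := inner y v in ne *.
have zz : 0 < `|z| ^+ 2 by rewrite exprn_gt0 // lt_def ne normr_ge0.
(* Moving [m] by c z y changes the squared distance by - c |z|^2 (2 - c |y|^2); this [c] keeps the
   last factor positive without a division by |y|^2. *)
pose c : C := (`|y| ^+ 2 + 1)^-1.
have y1 : 0 < `|y| ^+ 2 + 1 by rewrite ltr_wpDl ?exprn_ge0.
have c0 : 0 < c by rewrite invr_gt0.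
have cr : c^* = c by apply/CrealP/ger0_real/ltW.
have := d_le (m + (c * z) *: y); rewrite -lecR sqE => h.
have {}h : `|v| ^+ 2 <= `|v - (c * z) *: y| ^+ 2.
  apply: le_trans md _; rewrite /v -addrA -opprD; apply: h.
  by rewrite addrC; apply: Sl.
have E0 t : inner (v - t *: y) (v - t *: y) =
    inner v v - t * inner v y - t^* * inner y v + t^* * t * inner y y.
  clearbody v; rewrite !(innerDr, innerDl, innerNr, innerNl, innerZr, innerZl); ring.
move: h; rewrite -!inner_norm E0 rmorphM /= cr (innerC y v) -/z.
have -> : inner v v - c * z * z^* - c * z^* * z + c * z^* * (c * z) * inner y y =
   inner v v - c * `|z| ^+ 2 * (2 - c * `|y| ^+ 2).
  by rewrite (inner_norm y) normCK; ring.
have pos : 0 < c * `|z| ^+ 2 * (2 - c * `|y| ^+ 2).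
  apply: mulr_gt0; first exact: mulr_gt0.
  rewrite subr_gt0 /c mulrC ltr_pdivrMr //.
  by rewrite mulrDr mulr1 ltr_pwDr // ler_peMl ?exprn_ge0 // ler1n.
by rewrite lerBrDr gerDl => /(lt_le_trans pos); rewrite ltxx.
Qed.

End Projection.

Section ProjectionMap.
Variables (R : realType) (H : hilbertType R[i]) (S : set H).
Local Notation C := R[i].
Hypotheses (Ssub : subspace_set S) (Scl : seq_closed S).

Definition proj_on (x : H) : H :=
  xget 0 [set m | S m /\ forall y, S y -> inner y (x - m) = 0].

Lemma proj_onP x : S (proj_on x) /\ forall y, S y -> inner y (x - proj_on x) = 0.
Proof.
have [m hm] := projection_exists Ssub Scl x.
exact: (@xgetPex _ 0 [set m | S m /\ forall y, S y -> inner y (x - m) = 0]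
  (ex_intro _ m hm)).
Qed.

Lemma proj_on_in x : S (proj_on x). Proof. by have [] := proj_onP x. Qed.
Lemma proj_on_ortho x y : S y -> inner y (x - proj_on x) = 0.
Proof. by have [_] := proj_onP x; apply. Qed.

Lemma subspace_lin c x y : S x -> S y -> S (c *: x + y).
Proof. by case: Ssub => _; apply. Qed.
Lemma subspace_sub x y : S x -> S y -> S (x - y).
Proof. by move=> Sx Sy; rewrite addrC -scaleN1r; exact: subspace_lin. Qed.

Lemma proj_on_uniq x m : S m -> (forall y, S y -> inner y (x - m) = 0) -> proj_on x = m.
Proof.
move=> Sm om; apply/eqP; rewrite -subr_eq0; apply/eqP/inner_eq0.
have Sd : S (proj_on x - m) by apply: subspace_sub => //; exact: proj_on_in.
have -> : inner (proj_on x - m) (proj_on x - m) =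
   inner (proj_on x - m) ((x - m) - (x - proj_on x)).
  by congr inner; rewrite opprB [RHS]addrC addrA subrK.
by rewrite innerBr om // proj_on_ortho // subrr.
Qed.

Lemma proj_on_linear : linear proj_on.
Proof.
move=> c x y; apply: proj_on_uniq; first by apply: subspace_lin; exact: proj_on_in.
move=> z Sz; rewrite opprD addrACA -scalerBr innerDr innerZr !proj_on_ortho //.
by rewrite mulr0 addr0.
Qed.

Lemma proj_on_id x : S x -> proj_on x = x.
Proof. by move=> Sx; apply: proj_on_uniq => // y _; rewrite subrr inner0r. Qed.

Lemma proj_on_compl x : ortho S (x - proj_on x).
Proof. by move=> y Sy; exact: proj_on_ortho. Qed.

End ProjectionMap.

Section Ortho.
Variables (R : realType) (H : hilbertType R[i]) (S : set H).

Lemma ortho_subspace : subspace_set (ortho S).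
Proof.
split=> [y _|c x y ox oy z Sz]; first exact: inner0r.
by rewrite innerDr innerZr ox // oy // mulr0 addr0.
Qed.

Lemma ortho_seq_closed : seq_closed (ortho S).
Proof.
move=> x l ox xl y Sy; apply: tends_unique (tends_inner (tends_cst y) xl) _.
by apply: eq_tends (tends_cst 0) => n; rewrite ox.
Qed.
End Ortho.

Section Extension.
Variables (R : realType) (H H' : hilbertType R[i]) (V : lmodType R[i]).
Local Notation C := R[i].

(** [j] may fail to be injective: the bound by the norm of [j v] makes the value at [j v] well
    defined, and completeness of [H'] supplies the limits. *)
Lemma dense_extension (j : V -> H) (T0 : V -> H') (M : C) :
  linear j -> linear T0 -> (forall v, `|T0 v| <= M * `|j v|) ->
  (forall h, exists x : nat -> V, tends (fun n => j (x n)) h) ->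
  exists T : H -> H', [/\ linear T, forall h, `|T h| <= M * `|h|
    & forall v, T (j v) = T0 v].
Proof.
move=> jl Tl Tb dj; have [s hs] := choice dj.
have Tc (x : nat -> V) h : tends (fun n => j (x n)) h ->
    exists l, tends (fun n => T0 (x n)) l.
  move=> xh; apply: hilbert_complete => e e0.
  have M0 : 0 < `|M| + 1 by rewrite ltr_wpDl.
  have [n0 h0] := tends_cauchy xh (divr_gt0 e0 M0); exists n0 => m n hm hn.
  rewrite -(linB Tl); apply: le_lt_trans (Tb _) _.
  have p0 : 0 <= M * `|j (x m - x n)| := le_trans (normr_ge0 _) (Tb _).
  rewrite -(ger0_norm p0) normrM normr_id (linB jl).
  apply: (le_lt_trans (y := (`|M| + 1) * `|j (x m) - j (x n)|)).
    by rewrite ler_wpM2r // lerDl.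
  by rewrite mulrC -ltr_pdivlMr //; exact: h0.
have [T hT] := choice (fun h => Tc _ _ (hs h)).
have TP (x : nat -> V) h : tends (fun n => j (x n)) h -> tends (fun n => T0 (x n)) (T h).
  move=> xh; have := tendsB xh (hs h); rewrite subrr => d0.
  have d : tends (fun n => T0 (x n) - T0 (s h n)) 0.
    apply: (tends_dom (M := M) (y := fun n => j (x n) - j (s h n)) (m := 0)) => // n.
    by rewrite !subr0 -(linB Tl) -(linB jl).
  by have := tendsD d (hT h); rewrite add0r; apply: eq_tends => n; rewrite subrK.
exists T; split=> [c x y|h|v].
- apply: tends_unique (TP _ _ (_ : tends (fun n => j (c *: s x n + s y n)) _)) _.
    by apply: eq_tends (tendsD (tendsZ c (hs x)) (hs y)) => n; rewrite jl.
  by apply: eq_tends (tendsD (tendsZ c (hT x)) (hT y)) => n; rewrite Tl.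
- rewrite -subr_ge0.
  have n1 : tends (fun n => `|T0 (s h n)|) `|T h|.
    by apply: (tends_dom (M := 1) (hT h)) => n; rewrite mul1r; exact: ler_dist_dist.
  have n2 : tends (fun n => `|j (s h n)|) `|h|.
    by apply: (tends_dom (M := 1) (hs h)) => n; rewrite mul1r; exact: ler_dist_dist.
  apply: tends_ge0 (tendsB (tendsM (tends_cst M) n2) n1) _ => n.
  by rewrite subr_ge0.
- apply: tends_unique (TP _ _ (tends_cst (j v))) (tends_cst _).
Qed.

End Extension.

Lemma gram_isometry (R : realType) (H H' : hilbertType R[i]) (X : lmodType R[i])
    (f : X -> H) (g : X -> H') : linear f -> linear g ->
  (forall x y, inner (f x) (f y) = inner (g x) (g y)) ->
  dense (range f) -> exists V : H -> H', isometry V /\ forall x, V (f x) = g x.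
Proof.
move=> fl gl fg /denseP df.
have {}df h : exists x : nat -> X, tends (fun n => f (x n)) h.
  have [s [sr sh]] := df h.
  have [x hx] := choice (fun n => let: ex_intro2 y _ e := sr n in ex_intro (fun y => f y = s n) y e).
  by exists x; apply: eq_tends sh => n; rewrite hx.
have nfg x : `|g x| = `|f x| by rewrite -!snorm_inner /snorm fg.
have [V [Vl Vb Vf]] := dense_extension (M := 1) fl gl
  (fun x => eq_ind_r (fun z => z <= _) (eq_ind_r (fun z => _ <= z) (lexx _) (mul1r _)) (nfg x)) df.
exists V; split=> //; split=> // x y.
have [[s hs] [t ht]] := (df x, df y).
have Vs := linear_bounded_tends Vl Vb hs; have Vt := linear_bounded_tends Vl Vb ht.
apply: tends_unique (tends_inner Vs Vt) _.
by apply: eq_tends (tends_inner hs ht) => n; rewrite !Vf fg.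
Qed.

(** Source of the unitary equivalences: it is applied to cyclic cocycles with equal inner
    products. *)
Lemma gram_unitary (R : realType) (H H' : hilbertType R[i]) (X : lmodType R[i])
    (f : X -> H) (g : X -> H') : linear f -> linear g ->
  (forall x y, inner (f x) (f y) = inner (g x) (g y)) ->
  dense (range f) -> dense (range g) ->
  exists V : H -> H', unitary V /\ forall x, V (f x) = g x.
Proof.
move=> fl gl fg df dg.
have [V [Vi Vf]] := gram_isometry fl gl fg df.
have [W [Wi Wg]] := gram_isometry gl fl (fun x y => esym (fg x y)) dg.
exists V; split=> //; split=> //.
apply/seteqP; split=> // h _; exists (W h) => //.
have /denseP/(_ h)[s [sr sh]] := dg.
apply: tends_unique (isometry_tends Vi (isometry_tends Wi sh)) _.
by apply: eq_tends sh => n; have [x _ <-] := sr n; rewrite Wg Vf.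
Qed.

Lemma riesz (R : realType) (H : hilbertType R[i]) (phi : H -> R[i]) (M : R[i]) :
  scalar phi -> (forall x, `|phi x| <= M * `|x|) -> exists h, forall g, inner h g = phi g.
Proof.
move=> pl pb.
have pB x y : phi (x - y) = phi x - phi y.
  by rewrite addrC -scaleN1r pl mulN1r addrC.
have p0 : phi 0 = 0 by rewrite -(subrr 0) pB subrr.
have pZ c x : phi (c *: x) = c * phi x by have := pl c x 0; rewrite !addr0 p0 addr0.
pose S := [set x | phi x = 0].
have Ssub : subspace_set S by split=> // c x y Sx Sy; rewrite /S /= pl Sx Sy mulr0 addr0.
have Scl : seq_closed S.
  move=> x l Sx xl; have : tends (fun n => phi (x n)) (phi l).
    by apply: (tends_dom (M := M) xl) => n; rewrite -pB; exact: pb.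
  move=> t; apply: tends_unique t _; by apply: eq_tends (tends_cst 0) => n; rewrite Sx.
have [all0|] := pselect (forall x, phi x = 0).
  by exists 0 => g; rewrite inner0l all0.
move=> /existsNP[x /eqP nx].
pose v := x - proj_on S x.
have pv : phi v = phi x by rewrite /v pB (proj_on_in Ssub Scl x) subr0.
have vn : inner v v != 0.
  by apply: contra nx => /eqP /inner_eq0 v0; rewrite -pv v0 p0.
exists (((phi v)^* / inner v v) *: v) => g.
rewrite innerZl rmorphM /= conjCK fmorphV /= -(innerC v v).
have Sg : S (g - (phi g / phi v) *: v).
  by rewrite /S /= pB pZ divfK ?subrr // pv.
have := proj_on_compl Ssub Scl x Sg; rewrite -/v innerC => e.
have {}e : inner v (g - (phi g / phi v) *: v) = 0.
  by rewrite -[LHS]conjCK e rmorph0.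
move: e; rewrite innerBr innerZr => /eqP; rewrite subr_eq0 => /eqP ->.
by field; rewrite vn pv nx.
Qed.

(** The Hilbert space is the completion of [H] for the degenerate form <P x, P y>, and the extension
    of [P] to it is the inclusion. *)
Lemma subspace_hilbert (R : realType) (H : hilbertType R[i]) (S : set H) :
  subspace_set S -> seq_closed S ->
  exists (K : hilbertType R[i]) (j : K -> H), isometry j /\ range j = S.
Proof.
move=> Ssub Scl; pose P := proj_on S.
have Pl : linear P := proj_on_linear Ssub Scl.
have bP : psd_form (fun x y : H => inner (P x) (P y)).
  split=> [x c y z|x y|x]; last by rewrite inner_norm exprn_ge0.
  - by rewrite Pl innerDr innerZr.
  - exact: innerC.
have [K [i [il ii di]]] := prehilbert_completion bP.
have [j [jl jb ji]] : exists T : K -> H, [/\ linear T, forall h, `|T h| <= 1 * `|h|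
    & forall v, T (i v) = P v].
  apply: (dense_extension il Pl) => // v.
  by rewrite mul1r -!snorm_inner /snorm ii.
exists K, j; split.
  split=> // x y; have [[s hs] [t ht]] := (di x, di y).
  apply: tends_unique (tends_inner (linear_bounded_tends jl jb hs)
    (linear_bounded_tends jl jb ht)) _.
  by apply: eq_tends (tends_inner hs ht) => n; rewrite !ji ii.
apply/seteqP; split=> [_ [k _ <-]|x Sx].
  have [s hs] := di k; apply: (Scl) (linear_bounded_tends jl jb hs) => n.
  by rewrite ji; exact: (proj_on_in Ssub Scl).
by exists (i x) => //; rewrite ji; exact: (proj_on_id Ssub Scl).
Qed.

(** * Resolvents of a contraction and the mean ergodic theorem *)

Section Resolvent.
Variables (R : realType) (H : hilbertType R[i]) (T : H -> H) (S : set H).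
Local Notation C := R[i].
Hypotheses (Tl : linear T) (Tc : forall x, `|T x| <= `|x|).
Hypotheses (Ssub : subspace_set S) (Scl : seq_closed S) (ST : forall x, S x -> S (T x)).

Let Tt (x : nat -> H) l : tends x l -> tends (fun n => T (x n)) (T l).
Proof. by apply: (linear_bounded_tends (M := 1) Tl) => y; rewrite mul1r. Qed.

Lemma resolvent_lb (r : C) f : 0 <= r -> (1 - r) * `|f| <= `|f - r *: T f|.
Proof.
move=> r0; rewrite mulrBl mul1r.
apply: le_trans (_ : `|f| - `|r *: T f| <= _); last exact: lerB_dist.
by rewrite lerD2l lerN2 normrZ ger0_norm // ler_wpM2l.
Qed.

Let res_sub (r : C) f g : f - g - r *: T (f - g) = f - r *: T f - (g - r *: T g).
Proof. by rewrite (linB Tl) scalerBr !opprD addrACA. Qed.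

Lemma resolvent_uniq (r : C) f g : 0 <= r < 1 -> f - r *: T f = g - r *: T g -> f = g.
Proof.
move=> /andP[r0 r1] e; apply/eqP; rewrite -subr_eq0 -normr_eq0.
have := resolvent_lb (f - g) r0.
rewrite res_sub e subrr.
rewrite normr0 pmulr_rle0 ?subr_gt0 // => h.
by rewrite eq_le h normr_ge0.
Qed.

(** By [resolvent_lb] the range of 1 - r T on [S] is closed. A vector z of [S] orthogonal to it
    satisfies <z, z> = r <T z, z> and vanishes because r < 1. *)
Lemma resolvent_exists (r : C) y : 0 <= r < 1 -> S y -> exists f, S f /\ f - r *: T f = y.
Proof.
move=> /andP[r0 r1] Sy; have r1' : 0 < 1 - r by rewrite subr_gt0.
pose L := [set w | exists f, S f /\ f - r *: T f = w].
have Lsub : subspace_set L.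
  split.
    exists 0; split; first by case: Ssub.
    by rewrite (lin0 Tl) scaler0 subrr.
  move=> c _ _ [f [Sf <-]] [g [Sg <-]]; exists (c *: f + g); split.
    exact: subspace_lin.
  by rewrite Tl scalerDr scalerA mulrC -scalerA opprD addrACA scalerBr.
have Lcl : seq_closed L.
  move=> w l Lw wl; have [f hf] := choice Lw.
  have fc : cauchyseq f.
    move=> e e0; have [n0 h0] := tends_cauchy wl (mulr_gt0 e0 r1').
    exists n0 => m n hm hn; rewrite -(ltr_pM2r r1') mulrC.
    apply: le_lt_trans (resolvent_lb _ r0) _; apply: le_lt_trans (h0 _ _ hm hn).
    by rewrite res_sub (hf m).2 (hf n).2.
  have [g fg] := hilbert_complete fc.
  exists g; split; first by apply: Scl fg => n; have [] := hf n.
  apply: tends_unique _ wl.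
  apply: eq_tends (tendsB fg (tendsZ r (Tt fg))) => n; by have [] := hf n.
have [m [[f [Sf fm]] om]] := projection_exists Lsub Lcl y.
pose z := y - m.
have Sz : S z.
  apply: subspace_sub => //; rewrite -fm; apply: subspace_sub => //.
  rewrite -[_ *: _]addr0; apply: subspace_lin => //; first exact: ST.
  by case: Ssub.
have := om (z - r *: T z) (ex_intro _ z (conj Sz erefl)).
rewrite -/z innerBl innerZl => /eqP; rewrite subr_eq0 => /eqP zz.
have z0 : z = 0.
  apply/eqP; rewrite -normr_eq0; apply: contraT => ne.
  have n0 : 0 < `|z| by rewrite lt_def ne normr_ge0.
  have : `|inner z z| <= r * `|z| ^+ 2.
    rewrite {1}zz normrM norm_conjC (ger0_norm r0); apply: ler_wpM2l => //.
    apply: le_trans (inner_CS _ _) _; by rewrite expr2 ler_wpM2r.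
  rewrite inner_norm ger0_norm ?exprn_ge0 //.
  by rewrite ler_pMl ?exprn_gt0 // => /(lt_le_trans r1); rewrite ltxx.
exists f; split=> //; rewrite fm; apply/eqP; rewrite -subr_eq0.
by move/eqP: z0; rewrite -oppr_eq0 opprB.
Qed.

Definition rho n : C := 1 - harm R n.
Lemma rho_itv n : 0 <= rho n < 1.
Proof.
rewrite /rho subr_ge0 gtrBl harm_gt0 andbT invf_le1 ?ltr0n //.
by rewrite ler1n.
Qed.

Definition resolvent n (x : H) : H := xget 0 [set f | S f /\ f - rho n *: T f = x].

Lemma resolventP n x : S x -> S (resolvent n x) /\ resolvent n x - rho n *: T (resolvent n x) = x.
Proof.
move=> Sx; have [f hf] := resolvent_exists (rho_itv n) Sx.
exact: (@xgetPex _ 0 [set f | S f /\ f - rho n *: T f = x] (ex_intro _ f hf)).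
Qed.

Lemma resolvent_in n x : S x -> S (resolvent n x).
Proof. by move=> /(resolventP n)[]. Qed.

Lemma resolventE n f x : S f -> f - rho n *: T f = x -> resolvent n x = f.
Proof.
move=> Sf fx; apply: resolvent_uniq (rho_itv n) _; rewrite fx.
have Sx : S x.
  rewrite -fx; apply: subspace_sub => //; rewrite -[_ *: _]addr0.
  by apply: subspace_lin => //; [exact: ST|case: Ssub].
by have [] := resolventP n Sx.
Qed.

Lemma resolvent_lin n c x y : S x -> S y ->
  resolvent n (c *: x + y) = c *: resolvent n x + resolvent n y.
Proof.
move=> Sx Sy; have [Sf ef] := resolventP n Sx; have [Sg eg] := resolventP n Sy.
apply: resolventE; first exact: subspace_lin.
rewrite -[in RHS]ef -[in RHS]eg Tl scalerDr scalerA mulrC -scalerA opprD addrACA.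
by rewrite scalerBr.
Qed.

Lemma harm_resolvent_le n x : S x -> `|harm R n *: resolvent n x| <= `|x|.
Proof.
move=> Sx; have [_ e] := resolventP n Sx.
have /andP[r0 _] := rho_itv n; have := resolvent_lb (resolvent n x) r0.
by rewrite e /rho opprB addrC subrK normrZ (ger0_norm (ltW (harm_gt0 R n))).
Qed.

(** Both sides equal g - T g for g = [resolvent n w]. *)
Lemma resolvent_coboundary n w : S w ->
  resolvent n (w - T w) = w - harm R n *: T (resolvent n w).
Proof.
move=> Sw; have [Sg e] := resolventP n Sw; set g := resolvent n w in Sg e *.
have -> : w - harm R n *: T g = g - T g.
  by rewrite -[in LHS]e /rho scalerBl scale1r opprB addrA addrAC addrK.
apply: resolventE; first by apply: subspace_sub => //; exact: ST.
by rewrite res_sub e; congr (_ - _); rewrite -[in RHS]e (linB Tl) (linZ Tl).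
Qed.

(** For a contraction |m - T m|^2 is at most 2 <m, m> - 2 Re <m, T m>, which is 0 here. *)
Lemma ortho_coboundary_fixed m : inner (m - T m) m = 0 -> T m = m.
Proof.
rewrite innerBl => /eqP; rewrite subr_eq0 => /eqP h.
have h' : inner m (T m) = inner m m by rewrite innerC -h -innerC.
apply/eqP; rewrite -subr_eq0; apply/eqP/inner_eq0.
apply/eqP; rewrite eq_le; apply/andP; split; last by rewrite inner_norm exprn_ge0.
rewrite innerBr !innerBl h' -h subrr subr0 subr_le0 !inner_norm.
by rewrite ler_pXn2r ?nnegrE.
Qed.

(** [x] is split along the closure [L] of the coboundaries w - T w. On [L] the averages tend to 0 by
    [resolvent_coboundary]; the component [m] orthogonal to [L] is fixed by [T], hence by the
    averages. The orthogonality in the conclusion serves to show, in [corner], that a particular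
    limit vanishes. *)
Lemma mean_ergodic x : S x ->
  exists m, [/\ S m, T m = m, inner (x - m) m = 0
    & tends (fun n => harm R n *: resolvent n x) m].
Proof.
move=> Sx.
pose L := [set l | S l /\ forall e : C, 0 < e -> exists w, S w /\ `|w - T w - l| < e].
have Lsub : subspace_set L.
  split.
    split; first by case: Ssub.
    move=> e e0; exists 0; split; first by case: Ssub.
    by rewrite (lin0 Tl) !subr0 normr0.
  move=> c k l [Sk hk] [Sl hl]; split; first exact: subspace_lin.
  move=> e e0; have e2 : 0 < e / 2 by rewrite divr_gt0.
  have c0 : 0 < `|c| + 1 by rewrite ltr_wpDl.
  have [w [Sw hw]] := hk _ (divr_gt0 e2 c0); have [v [Sv hv]] := hl _ e2.
  exists (c *: w + v); split; first exact: subspace_lin.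
  have -> : c *: w + v - T (c *: w + v) - (c *: k + l) =
     c *: (w - T w - k) + (v - T v - l).
    by rewrite Tl !scalerBr opprD [X in X + _ = _]addrACA opprD [LHS]addrACA.
  apply: le_lt_trans (ler_normD _ _) _; rewrite [ltRHS]splitr ltrD // normrZ.
  apply: (le_lt_trans (y := (`|c| + 1) * `|w - T w - k|)).
    by rewrite ler_wpM2r // lerDl.
  by rewrite mulrC -ltr_pdivlMr.
have Lcl : seq_closed L.
  move=> k l Lk kl; split; first by apply: Scl kl => n; have [] := Lk n.
  move=> e e0; have e2 : 0 < e / 2 by rewrite divr_gt0.
  have [n0 h] := kl _ e2; have [_ /(_ _ e2)[w [Sw hw]]] := Lk n0.
  exists w; split=> //.
  have -> : w - T w - l = (w - T w - k n0) + (k n0 - l) by rewrite addrA subrK.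
  by apply: le_lt_trans (ler_normD _ _) _; rewrite [ltRHS]splitr ltrD // h.
have [l [Ll om]] := projection_exists Lsub Lcl x.
pose m := x - l; have Sm : S m by apply: subspace_sub => //; case: Ll.
have Tm : T m = m.
  apply: ortho_coboundary_fixed; apply: om; split.
    by apply: subspace_sub => //; exact: ST.
  by move=> e e0; exists m; rewrite subrr normr0.
exists m; split=> //.
  by rewrite /m opprB addrC subrK; exact: om.
have hm n : harm R n *: resolvent n m = m.
  rewrite (resolventE (f := (harm R n)^-1 *: m)).
  - by rewrite scalerA divff ?scale1r // gt_eqF ?harm_gt0.
  - by rewrite -[_ *: m]addr0; apply: subspace_lin => //; case: Ssub.
  - rewrite (linZ Tl) Tm scalerA -scalerBl /rho mulrBl mul1r divff; last first.
      by rewrite gt_eqF ?harm_gt0.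
    by rewrite opprB addrC subrK scale1r.
have [Sl hl] := Ll.
have l0 : tends (fun n => harm R n *: resolvent n l) 0.
  move=> e e0; have e2 : 0 < e / 2 by rewrite divr_gt0.
  have [w [Sw hw]] := hl _ e2.
  have w0 : 0 < 2 * `|w| + 1 by rewrite ltr_wpDl // mulr_ge0.
  have [n0 h0] := harm_small (divr_gt0 e2 w0); exists n0 => n hn.
  have Sd : S (w - T w) by apply: subspace_sub => //; exact: ST.
  have Se : S (l - (w - T w)) by apply: subspace_sub.
  have -> : resolvent n l = resolvent n (l - (w - T w)) + resolvent n (w - T w).
    by have := resolvent_lin n 1 Se Sd; rewrite !scale1r subrK.
  rewrite subr0 scalerDr; apply: le_lt_trans (ler_normD _ _) _.
  rewrite [ltRHS]splitr ltrD //.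
    by apply: le_lt_trans (harm_resolvent_le n Se) _; rewrite -normrN opprB.
  rewrite resolvent_coboundary // normrZ (ger0_norm (ltW (harm_gt0 R n))).
  apply: (le_lt_trans (y := harm R n * (2 * `|w| + 1))); last first.
    by rewrite -ltr_pdivlMr //; exact: le_lt_trans (harm_le R hn) h0.
  rewrite ler_wpM2l ?(ltW (harm_gt0 R n)) //.
  apply: le_trans (ler_normB _ _) _.
  apply: (le_trans (y := `|w| + `|w|)); last by rewrite mulr_natl mulr2n lerDl.
  rewrite lerD2l -(linZ Tl); apply: le_trans (Tc _) _; exact: harm_resolvent_le.
have := tendsD l0 (tends_cst m); rewrite add0r; apply: eq_tends => n.
have := resolvent_lin n 1 Sl Sm; rewrite !scale1r /m [l + _]addrC subrK => ->.
by rewrite scalerDr -/m hm.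
Qed.

End Resolvent.

(** * Approximation of cocycles by coboundaries *)

Section ScalarFunctional.
Variables (C : comNzRingType) (V : lmodType C) (psi : V -> C).
Hypothesis psil : scalar psi.

Lemma scD : {morph psi : a b / a + b}.
Proof. by move=> a b; have := psil 1 a b; rewrite scale1r mul1r. Qed.
Lemma sc0 : psi 0 = 0.
Proof. by apply: (addrI (psi 0)); rewrite -scD !addr0. Qed.
Lemma scZ c a : psi (c *: a) = c * psi a.
Proof. by have := psil c a 0; rewrite sc0 !addr0. Qed.
Lemma scN a : psi (- a) = - psi a.
Proof. by rewrite -scaleN1r scZ mulN1r. Qed.
Lemma scB : {morph psi : a b / a - b}.
Proof. by move=> a b; rewrite scD scN. Qed.
Lemma sc_sum (I : Type) (r : seq I) (P : pred I) (F : I -> V) :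
  psi (\sum_(i <- r | P i) F i) = \sum_(i <- r | P i) psi (F i).
Proof. exact: (big_morph _ scD sc0). Qed.
End ScalarFunctional.

(* The theory below is developed for an abstract algebra A with the properties
   of Uq q N; the notions prefixed by g are those of the statement with Uq q N
   replaced by A. In Uq q N itself the unfolding of the quotient makes rewriting
   prohibitively slow. *)
Record qgroup (C : numClosedFieldType) (q : C) (N : nat) (A : algType C)
    (u : 'M[A]_N) (Dinv : A) (star : A -> A) (eps : A -> C) : Prop := QGroup {
  qg_ind : forall P : A -> Prop, P 1 ->
    (forall c a b, P a -> P b -> P (c *: a + b)) ->
    (forall a b, P a -> P b -> P (a * b)) ->
    (forall j k, P (u j k)) -> P Dinv -> forall a, P a;
  qg_qmat : is_qmat q u;
  qg_row : forall j m, \sum_k u j k * star (u m k) = (j == m)%:R;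
  qg_col : forall j m, \sum_k star (u k j) * u k m = (j == m)%:R;
  qg_Dl : Dinv * star Dinv = 1;
  qg_Dr : star Dinv * Dinv = 1;
  qg_D : star Dinv = qdet q u;
  qg_central : forall j k, Dinv * u j k = u j k * Dinv;
  qg_starP : forall c a b, star (c *: a + b) = c^* *: star a + star b;
  qg_starM : forall a b, star (a * b) = star b * star a;
  qg_starK : involutive star;
  qg_eps : scalar eps;
  qg_epsM : {morph eps : a b / a * b};
  qg_eps1 : eps 1 = 1;
  qg_eps_u : forall j k, eps (u j k) = (j == k)%:R;
  qg_eps_Dinv : eps Dinv = 1 }.

Section GenericNotions.
Variables (C : numClosedFieldType) (A : algType C) (star : A -> A) (eps : A -> C).

Definition gK (n : nat) : set A :=
  lspan [set a | exists x : 'I_n -> A,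
           (forall i, eps (x i) = 0) /\ a = \prod_(i < n) x i].

Definition gGF (psi : A -> C) :=
  [/\ scalar psi, forall b, psi (star b) = (psi b)^*, psi 1 = 0
    & forall b, gK 1 b -> 0 <= psi (star b * b)].

Definition ggaussian (psi : A -> C) := gGF psi /\ forall a, gK 3 a -> psi a = 0.

Section Rep.
Variables (H : hilbertType C) (pi : A -> H -> H).

Definition gsrep :=
  [/\ (forall a, linear (pi a)) /\ (forall a, continuous (pi a)),
      forall c a b x, pi (c *: a + b) x = c *: pi a x + pi b x,
      forall x, pi 1 x = x,
      forall a b x, pi (a * b) x = pi a (pi b x)
    & forall a x y, inner (pi (star a) x) y = inner x (pi a y)].

Definition gcocycle (eta : A -> H) :=
  linear eta /\ forall a b, eta (a * b) = pi a (eta b) + eps b *: eta a.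

Definition gtriple (eta : A -> H) (psi : A -> C) :=
  [/\ gsrep, gcocycle eta, scalar psi
    & forall a b, inner (eta a) (eta b) =
        psi (star a * b) - psi (star a) * eps b - eps (star a) * psi b].

Definition ggauss : set H := [set x | forall a, gK 1 a -> pi a x = 0].

End Rep.
End GenericNotions.

Section QGroup.
Variables (R : realType) (q : R[i]) (N : nat) (A : algType R[i]).
Variables (u : 'M[A]_N) (Dinv : A) (star : A -> A) (eps : A -> R[i]).
Hypothesis q01 : 0 < q < 1.
Hypothesis Q : qgroup q u Dinv star eps.
Local Notation C := R[i].
Local Notation K := (gK eps).

Let q_gt0 : 0 < q. Proof. by case/andP: q01. Qed.
Let q_lt1 : q < 1. Proof. by case/andP: q01. Qed.
Let q0 : q != 0. Proof. by rewrite gt_eqF. Qed.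
Let q1 : 1 - q != 0. Proof. by rewrite gt_eqF // subr_gt0. Qed.

Lemma gstarD : {morph star : a b / a + b}.
Proof. by move=> a b; have := qg_starP Q 1 a b; rewrite rmorph1 !scale1r. Qed.

Lemma gstar0 : star 0 = 0.
Proof. by apply: (addrI (star 0)); rewrite -gstarD !addr0. Qed.

Lemma gstarZ c a : star (c *: a) = c^* *: star a.
Proof. by have := qg_starP Q c a 0; rewrite gstar0 !addr0. Qed.

Lemma gstarN a : star (- a) = - star a.
Proof. by rewrite -scaleN1r gstarZ rmorphN1 scaleN1r. Qed.

Lemma gstarB : {morph star : a b / a - b}.
Proof. by move=> a b; rewrite gstarD gstarN. Qed.

Lemma gstar1 : star 1 = 1.
Proof. by have := qg_starM Q (star 1) 1; rewrite mulr1 (qg_starK Q) mulr1. Qed.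

Lemma gstar_sum (I : Type) (r : seq I) (P : pred I) (F : I -> A) :
  star (\sum_(i <- r | P i) F i) = \sum_(i <- r | P i) star (F i).
Proof. exact: (big_morph _ gstarD gstar0). Qed.

Lemma eps0 : eps 0 = 0. Proof. exact: sc0 (qg_eps Q). Qed.
Lemma epsZ c a : eps (c *: a) = c * eps a. Proof. exact: scZ (qg_eps Q) c a. Qed.
Lemma epsB : {morph eps : a b / a - b}. Proof. exact: scB (qg_eps Q). Qed.
Lemma eps_center a : eps (a - eps a *: 1) = 0.
Proof. by rewrite epsB epsZ (qg_eps1 Q) mulr1 subrr. Qed.

(** The matrix of the values chi(u_jk) is diagonal with unimodular entries, so the row relation
    determines chi(star u_jk) as the conjugate of chi(u_jk). *)
Lemma character_star (chi : A -> C) (t : 'I_N -> C) (s : C) : scalar chi ->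
  {morph chi : a b / a * b} -> chi 1 = 1 -> (forall j k, chi (u j k) = t j *+ (j == k)) ->
  chi Dinv = s -> (forall j, t j * (t j)^* = 1) -> s * s^* = 1 ->
  forall a, chi (star a) = (chi a)^*.
Proof.
move=> cl cM c1 cu cD tt ss.
have cDD a b : chi (a + b) = chi a + chi b by have := cl 1 a b; rewrite scale1r mul1r.
have c0 : chi 0 = 0 by apply: (addrI (chi 0)); rewrite -cDD !addr0.
apply: (qg_ind Q) => [|c a b ha hb|a b ha hb|j k|].
- by rewrite gstar1 c1 rmorph1.
- by rewrite (qg_starP Q) !cl ha hb rmorphD rmorphM.
- by rewrite (qg_starM Q) !cM ha hb rmorphM mulrC.
- have := congr1 chi (qg_row Q k j).
  rewrite (big_morph _ cDD c0) (bigD1 k) //= big1 ?addr0; last first.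
    by move=> i ik; rewrite cM cu eq_sym (negbTE ik) mulr0n mul0r.
  rewrite cM !cu eqxx mulr1n => e.
  have tk : t k != 0.
    apply/eqP => tk; have := tt k; rewrite tk mul0r => /eqP.
    by rewrite eq_sym oner_eq0.
  apply: (mulfI tk); rewrite e; case: eqP => [->|ne].
    by rewrite eqxx /= mulr1n c1 tt.
  by rewrite eq_sym; case: eqP => [e'|_]; [case: ne|rewrite /= mulr0n rmorph0 mulr0 c0].
- have sn : s != 0.
    by apply/eqP => s0; have := ss; rewrite s0 mul0r => /eqP; rewrite eq_sym oner_eq0.
  apply: (mulfI sn); rewrite cD ss -cD -cM (qg_Dl Q) c1 //.
Qed.

Lemma eps_star a : eps (star a) = (eps a)^*.
Proof.
apply: (character_star (t := fun=> 1) (s := 1)) (qg_eps Q) (qg_epsM Q) (qg_eps1 Q) _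
  (qg_eps_Dinv Q) _ _ a => [j k|j|]; rewrite ?rmorph1 ?mulr1 //.
exact: (qg_eps_u Q).
Qed.

Lemma gK_lin n c a b : K n a -> K n b -> K n (c *: a + b).
Proof.
move=> [m1 [c1 [v1 [h1 ->]]]] [m2 [c2 [v2 [h2 ->]]]].
exists (m1 + m2)%N, (fun i : 'I_(m1 + m2) => match fintype.split i with inl j => c * c1 j | inr j => c2 j end),
  (fun i : 'I_(m1 + m2) => match fintype.split i with inl j => v1 j | inr j => v2 j end); split.
  by move=> i; case: (fintype.split i).
rewrite big_split_ord /= scaler_sumr; congr (_ + _); apply: eq_bigr => i _.
  by rewrite -[lshift _ i]/(unsplit (inl i)) unsplitK scalerA.
by rewrite -[rshift _ i]/(unsplit (inr i)) unsplitK.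
Qed.

Lemma gK0 n : K n 0.
Proof.
exists 0%N, (fun=> 0), (fun=> 0); split; first by case.
by rewrite big_ord0.
Qed.

Lemma gKD n a b : K n a -> K n b -> K n (a + b).
Proof. by move=> ha hb; rewrite -[a]scale1r; exact: gK_lin. Qed.
Lemma gKZ n c a : K n a -> K n (c *: a).
Proof. by move=> ha; rewrite -[_ *: _]addr0; apply: gK_lin => //; exact: gK0. Qed.
Lemma gKN n a : K n a -> K n (- a).
Proof. by rewrite -scaleN1r; exact: gKZ. Qed.
Lemma gKB n a b : K n a -> K n b -> K n (a - b).
Proof. by move=> ha hb; apply: gKD => //; exact: gKN. Qed.
Lemma gK_sum n (I : Type) (r : seq I) (P : pred I) (F : I -> A) :
  (forall i, P i -> K n (F i)) -> K n (\sum_(i <- r | P i) F i).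
Proof.
by move=> h; elim/big_ind: _ => //; [exact: gK0|exact: gKD].
Qed.

Lemma gK_prod n (x : 'I_n -> A) : (forall i, eps (x i) = 0) -> K n (\prod_i x i).
Proof.
move=> hx; exists 1%N, (fun=> 1), (fun=> \prod_i x i); split; first by move=> _; exists x.
by rewrite big_ord_recl big_ord0 addr0 scale1r.
Qed.

Lemma gK_ind n (P : A -> Prop) : P 0 -> (forall c a b, P a -> P b -> P (c *: a + b)) ->
  (forall x : 'I_n -> A, (forall i, eps (x i) = 0) -> P (\prod_i x i)) ->
  forall a, K n a -> P a.
Proof.
move=> P0 Pl Pp a [m [c [v [hv ->]]]].
elim/big_ind: _ => [//|x y Px Py|i _].
  by rewrite -[x]scale1r; exact: Pl.
rewrite -[_ *: _]addr0; apply: Pl => //; have [x [hx ->]] := hv i; exact: Pp.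
Qed.

Lemma gK1P a : K 1 a <-> eps a = 0.
Proof.
split=> [|ea].
  move: a; apply: gK_ind => [|c a b ha hb|x hx]; first exact: eps0.
    by rewrite (qg_eps Q) ha hb mulr0 addr0.
  by rewrite big_ord_recl big_ord0 mulr1.
have -> : a = \prod_(i < 1) a by rewrite big_ord_recl big_ord0 mulr1.
exact: gK_prod.
Qed.

Lemma gK2M a b : eps a = 0 -> eps b = 0 -> K 2 (a * b).
Proof.
move=> ea eb; have -> : a * b = \prod_(i < 2) (if i == ord0 then a else b).
  by rewrite !big_ord_recl big_ord0 mulr1.
by apply: gK_prod => i; case: ifP.
Qed.

Lemma gK3M a b c : eps a = 0 -> eps b = 0 -> eps c = 0 -> K 3 (a * b * c).
Proof.
move=> ea eb ec; have -> : a * b * c =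
    \prod_(i < 3) (if i == ord0 then a else if i == lift ord0 ord0 then b else c).
  by rewrite !big_ord_recl big_ord0 mulr1 /= mulrA.
by apply: gK_prod => i; do 2 case: ifP => // _.
Qed.

Lemma gK2_ind (P : A -> Prop) : P 0 -> (forall c a b, P a -> P b -> P (c *: a + b)) ->
  (forall a b, eps a = 0 -> eps b = 0 -> P (a * b)) -> forall a, K 2 a -> P a.
Proof.
move=> P0 Pl Pp; apply: gK_ind => // x hx.
by rewrite !big_ord_recl big_ord0 mulr1; exact: Pp.
Qed.

Lemma gK3_ind (P : A -> Prop) : P 0 -> (forall c a b, P a -> P b -> P (c *: a + b)) ->
  (forall a b c, eps a = 0 -> eps b = 0 -> eps c = 0 -> P (a * b * c)) ->
  forall a, K 3 a -> P a.
Proof.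
move=> P0 Pl Pp; apply: gK_ind => // x hx.
by rewrite !big_ord_recl big_ord0 mulr1 mulrA; exact: Pp.
Qed.

Lemma gK21 a : K 2 a -> eps a = 0.
Proof.
move: a; apply: gK2_ind => [|c a b ha hb|a b ha hb]; first exact: eps0.
  by rewrite (qg_eps Q) ha hb mulr0 addr0.
by rewrite (qg_epsM Q) ha mul0r.
Qed.

Lemma gK32 a : K 3 a -> K 2 a.
Proof.
move: a; apply: gK3_ind => [|c a b|a b c ha hb hc]; [exact: gK0|exact: gK_lin|].
by apply: gK2M; rewrite // (qg_epsM Q) ha mul0r.
Qed.

Lemma gK2r a b : K 2 a -> eps b = 0 -> K 3 (a * b).
Proof.
move=> + eb; move: a; apply: gK2_ind => [|c x y hx hy|x y ex ey].
- by rewrite mul0r; exact: gK0.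
- by rewrite mulrDl -scalerAl; exact: gK_lin.
- exact: gK3M.
Qed.

Lemma gK2l a b : eps a = 0 -> K 2 b -> K 3 (a * b).
Proof.
move=> ea; move: b; apply: gK2_ind => [|c x y hx hy|x y ex ey].
- by rewrite mulr0; exact: gK0.
- by rewrite mulrDr -scalerAr; exact: gK_lin.
- by rewrite mulrA; exact: gK3M.
Qed.

Lemma gK2_star a : K 2 a -> K 2 (star a).
Proof.
move: a; apply: gK2_ind => [|c x y hx hy|x y ex ey].
- by rewrite gstar0; exact: gK0.
- by rewrite (qg_starP Q); exact: gK_lin.
- by rewrite (qg_starM Q); apply: gK2M; rewrite eps_star ?ex ?ey rmorph0.
Qed.

(** * Vectors fixed by the diagonal generators *)

Section Representation.
Variables (H : hilbertType C) (pi : A -> H -> H).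
Hypothesis pis : gsrep star pi.
Implicit Types (x y : H) (a b : A).

Lemma piL a : linear (pi a). Proof. by case: pis => -[]. Qed.
Lemma piA c a b x : pi (c *: a + b) x = c *: pi a x + pi b x.
Proof. by case: pis. Qed.
Lemma pi1 x : pi 1 x = x. Proof. by case: pis. Qed.
Lemma piM a b x : pi (a * b) x = pi a (pi b x). Proof. by case: pis. Qed.
Lemma pi_adj a x y : inner (pi (star a) x) y = inner x (pi a y). Proof. by case: pis. Qed.
Lemma pi_tends a (x : nat -> H) l : tends x l -> tends (fun n => pi a (x n)) (pi a l).
Proof. by case: pis => -[_ cts] _ _ _ _; exact: continuous_tends. Qed.
Lemma piD a b x : pi (a + b) x = pi a x + pi b x.
Proof. by rewrite -[a]scale1r piA !scale1r. Qed.
Lemma pi0 x : pi 0 x = 0.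
Proof. by apply: (addrI (pi 0 x)); rewrite -piD !addr0. Qed.
Lemma piZ c a x : pi (c *: a) x = c *: pi a x.
Proof. by rewrite -[c *: a]addr0 piA pi0 addr0. Qed.
Lemma piN a x : pi (- a) x = - pi a x.
Proof. by rewrite -scaleN1r piZ scaleN1r. Qed.
Lemma piB a b x : pi (a - b) x = pi a x - pi b x.
Proof. by rewrite piD piN. Qed.
Lemma pi_sum (I : Type) (r : seq I) (P : pred I) (F : I -> A) x :
  pi (\sum_(i <- r | P i) F i) x = \sum_(i <- r | P i) pi (F i) x.
Proof. exact: (big_morph (fun a => pi a x) (fun a b => piD a b x) (pi0 x)). Qed.
Definition piv0 a : pi a 0 = 0 := lin0 (piL a).
Definition pivD a x y : pi a (x + y) = pi a x + pi a y := linD (piL a) x y.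
Definition pivB a x y : pi a (x - y) = pi a x - pi a y := linB (piL a) x y.
Definition pivN a x : pi a (- x) = - pi a x := linN (piL a) x.
Definition pivZ a c x : pi a (c *: x) = c *: pi a x := linZ (piL a) c x.

Lemma pi_adj' a x y : inner x (pi (star a) y) = inner (pi a x) y.
Proof. by rewrite -{2}(qg_starK Q a) pi_adj. Qed.

(** Each column of [u] acts as an isometry of [H] into N copies of [H]; contractivity of all u_jk
    follows. *)
Lemma pi_col k x : \sum_j `|pi (u j k) x| ^+ 2 = `|x| ^+ 2.
Proof.
rewrite -(inner_norm x).
have -> : inner x x = inner (pi (\sum_j star (u j k) * u j k) x) x.
  by rewrite (qg_col Q) eqxx pi1.
by rewrite pi_sum inner_suml; apply: eq_bigr => j _; rewrite piM pi_adj inner_norm.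
Qed.

Lemma pi_u_le j k x : `|pi (u j k) x| <= `|x|.
Proof.
rewrite -(@ler_pXn2r _ 2) ?nnegrE // -(pi_col k x) (bigD1 j) //= lerDl.
by apply: sumr_ge0 => i _; rewrite exprn_ge0.
Qed.

Lemma pi_col_fixed k x : pi (u k k) x = x -> forall j, j != k -> pi (u j k) x = 0.
Proof.
move=> e j jk; have := pi_col k x; rewrite (bigD1 k) //= e => /eqP.
rewrite -subr_eq0 addrAC subrr add0r psumr_eq0 => [|i _]; last by rewrite exprn_ge0.
move/allP => /(_ j (mem_index_enum _)); rewrite jk expf_eq0 /= normr_eq0.
by move/eqP.
Qed.

(** The scale along which the induction descends: all of [H] for k = N, the gaussian vectors for k =
    0. *)
Definition fix_from (k : nat) : set H :=
  [set x | forall j : 'I_N, (k <= j)%N -> pi (u j j) x = x].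

Lemma fix_from_subspace k : subspace_set (fix_from k).
Proof.
split=> [j _|c x y hx hy j kj]; first exact: piv0.
by rewrite piL hx // hy.
Qed.

Lemma fix_from_closed k : seq_closed (fix_from k).
Proof.
move=> x l hx xl j kj; apply: tends_unique (pi_tends (u j j) xl) _.
by apply: eq_tends xl => n; rewrite hx.
Qed.

(** For k <= j the norm identity of column j leaves nothing for u_ij x. For j < k <= i the row
    relation gives u_ij x = q u_ii u_ij x, and q < 1 with u_ii contractive forces 0. *)
Lemma fix_from_offdiag k x (i j : 'I_N) : fix_from k x -> i != j ->
  (k <= i)%N || (k <= j)%N -> pi (u i j) x = 0.
Proof.
move=> hx ij; case: (leqP k j) => [kj _|jk]; first by apply: pi_col_fixed => //; exact: hx.
rewrite orbF => ki.
have ji : (j < i)%N := leq_trans jk ki.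
have [_ h2 _ _] := qg_qmat Q.
have e : pi (u i j) x = q *: pi (u i i) (pi (u i j) x).
  by rewrite -piM -piZ -h2 // piM hx.
apply/eqP; rewrite -normr_eq0; apply: contraT => ne.
have n0 : 0 < `|pi (u i j) x| by rewrite lt_def ne normr_ge0.
have : `|pi (u i j) x| <= q * `|pi (u i j) x|.
  by rewrite {1}e normrZ (ger0_norm (ltW q_gt0)) ler_wpM2l ?(ltW q_gt0) // pi_u_le.
by rewrite ler_pMl // => /(lt_le_trans q_lt1); rewrite ltxx.
Qed.

(** For i, l < k <= j the commutator of u_il and u_jj has u_jl as its right factor, which kills [x]
    by [fix_from_offdiag]. *)
Lemma fix_from_inv k a x : fix_from k x -> fix_from k (pi a x).
Proof.
have [k0 kl] := fix_from_subspace k.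
move: a x; apply: (qg_ind Q) => [|c a b ha hb|a b ha hb|i l|] x hx.
- by rewrite pi1.
- by rewrite piA; apply: kl; [exact: ha|exact: hb].
- by rewrite piM; apply/ha/hb.
- have [/orP kil|] := boolP ((k <= i)%N || (k <= l)%N).
    have [eil|nil] := eqVneq i l.
      by rewrite -eil hx //; move: kil; rewrite -eil => -[].
    by rewrite (fix_from_offdiag hx nil) //; apply/orP.
  rewrite negb_or -!ltnNge => /andP[ik lk] j kj.
  have [_ _ _ h4] := qg_qmat Q.
  have := h4 i l j j (leq_trans ik kj) (leq_trans lk kj).
  move/(congr1 (fun a => pi a x)); rewrite piM hx // piB piZ !piM.
  rewrite (fix_from_offdiag hx (i := j)) ?kj // => [|]; last first.
    by rewrite neq_ltn (leq_trans lk kj) orbT.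
  by rewrite piv0 scaler0 subr0.
- by move=> j kj; rewrite -piM -(qg_central Q) piM hx.
Qed.

(** The generator [Dinv] is reached through its inverse, the determinant, which acts on such a
    vector by its counit. *)
Lemma fix_from0 x : fix_from 0 x <-> ggauss eps pi x.
Proof.
split=> [hx a /(gK1P a) ea|gx j _]; last first.
  apply/eqP; rewrite -subr_eq0 -{2}[x]pi1 -piB; apply/eqP/gx/gK1P.
  by rewrite epsB (qg_eps_u Q) (qg_eps1 Q) eqxx subrr.
suff e b : pi b x = eps b *: x by rewrite e ea scale0r.
have P1 : pi 1 x = eps 1 *: x by rewrite pi1 (qg_eps1 Q) scale1r.
have Pl c b1 b2 : pi b1 x = eps b1 *: x -> pi b2 x = eps b2 *: x ->
    pi (c *: b1 + b2) x = eps (c *: b1 + b2) *: x.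
  by move=> h1 h2; rewrite piA h1 h2 (qg_eps Q) scalerDl scalerA.
have Pm b1 b2 : pi b1 x = eps b1 *: x -> pi b2 x = eps b2 *: x ->
    pi (b1 * b2) x = eps (b1 * b2) *: x.
  by move=> h1 h2; rewrite piM h2 pivZ h1 (qg_epsM Q) scalerA mulrC.
have Pu i j : pi (u i j) x = eps (u i j) *: x.
  rewrite (qg_eps_u Q); have [->|ij] := eqVneq i j; first by rewrite hx // scale1r.
  by rewrite scale0r (fix_from_offdiag hx ij).
have PD : pi (star Dinv) x = eps (star Dinv) *: x.
  rewrite (qg_D Q) /qdet; elim/big_ind: _ => [|b1 b2 h1 h2|s _].
  - by rewrite pi0 eps0 scale0r.
  - by rewrite -[b1]scale1r; exact: Pl.
  - rewrite -[_ *: _]addr0; apply: Pl; last by rewrite pi0 eps0 scale0r.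
    by elim/big_ind: _ => // *; exact: Pm.
have PDi : pi Dinv x = eps Dinv *: x.
  have := congr1 (fun a => pi a x) (qg_Dl Q).
  by rewrite piM PD eps_star (qg_eps_Dinv Q) rmorph1 !scale1r pi1.
exact: (qg_ind Q (P := fun b => pi b x = eps b *: x)) => //.
Qed.

Lemma ggauss_subspace : subspace_set (ggauss eps pi).
Proof.
split=> [a _|c x y hx hy a Ka]; first exact: piv0.
by rewrite piL hx // hy // scaler0 addr0.
Qed.

Lemma ggauss_closed : seq_closed (ggauss eps pi).
Proof.
move=> x l hx xl a Ka; apply: tends_unique (pi_tends a xl) _.
by apply: eq_tends (tends_cst 0) => n; rewrite hx.
Qed.

Lemma pi_ggauss a x : ggauss eps pi x -> pi a x = eps a *: x.
Proof.
move=> gx; rewrite -[a in LHS](subrK (eps a *: 1)) piD gx ?add0r ?piZ ?pi1 //.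
by apply/gK1P; exact: eps_center.
Qed.

Section Cocycle.
Variable eta : A -> H.
Hypothesis etac : gcocycle eps pi eta.

Lemma etaL : linear eta. Proof. by case: etac. Qed.
Lemma etaM a b : eta (a * b) = pi a (eta b) + eps b *: eta a. Proof. by case: etac. Qed.
Lemma eta1 : eta 1 = 0.
Proof.
have := etaM 1 1; rewrite mulr1 pi1 (qg_eps1 Q) scale1r => e.
by apply: (addrI (eta 1)); rewrite addr0 -e.
Qed.
Definition etaB a b : eta (a - b) = eta a - eta b := linB etaL a b.
Definition etaZ c a : eta (c *: a) = c *: eta a := linZ etaL c a.
Lemma eta_center a : eta (a - eps a *: 1) = eta a.
Proof. by rewrite etaB etaZ eta1 scaler0 subr0. Qed.
Lemma etaK a b : eps b = 0 -> eta (a * b) = pi a (eta b).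
Proof. by move=> eb; rewrite etaM eb scale0r addr0. Qed.

(** * One step of the descending induction *)

Section Step.
Variable k : 'I_N.
Hypothesis etaF : forall a, fix_from k.+1 (eta a).
Let T := pi (u k k).
Let S := fix_from k.+1.
Let Tl : linear T := piL (u k k).
Let Tc x : `|T x| <= `|x| := pi_u_le k k x.
Let Ssub : subspace_set S := fix_from_subspace k.+1.
Let Scl : seq_closed S := @fix_from_closed k.+1.
Let ST x : S x -> S (T x) := @fix_from_inv k.+1 (u k k) x.
Let Sinv a x : S x -> S (pi a x) := @fix_from_inv k.+1 a x.
(** For a coboundary eta(a) = pi(a - eps a) f one has f - T f = y. As 1 - T need not be invertible,
    [f n] solves this equation with the factor [r n] < 1 in front of [T]. *)
Let y := - eta (u k k).
Let Sy : S y.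
Proof. by rewrite /y -scaleN1r -[_ *: _]addr0; apply: Ssub.2; [exact: etaF|exact: Ssub.1]. Qed.
Let Rn := resolvent T S.
Let f n := Rn n y.
Let r := rho R.
Let h := harm R.

Let Sf n : S (f n). Proof. exact: (resolvent_in Tl Tc Ssub Scl ST). Qed.
Let fE n : f n - r n *: T (f n) = y.
Proof. exact: (resolventP Tl Tc Ssub Scl ST n Sy).2. Qed.
Let rh n : 1 - r n = h n. Proof. by rewrite /r /rho opprB addrC subrK. Qed.

Let Fk x : S x -> T x = x -> fix_from k x.
Proof.
move=> Sx Tx j; rewrite leq_eqVlt => /orP[/eqP/val_inj <- //|kj]; exact: Sx.
Qed.

Let FT x : fix_from k x -> T x = x. Proof. by move=> hx; exact: hx. Qed.

Let lim_f : exists m, fix_from k m /\ tends (fun n => h n *: f n) m.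
Proof.
have [m [Sm Tm _ hm]] := mean_ergodic Tl Tc Ssub Scl ST Sy.
by exists m; split=> //; exact: Fk.
Qed.

(** For a commuting with u_kk and in the kernel of the counit, pi(a) f_n is the resolvent of eta(a)
    - T eta(a). The same expression is the leading term in [corner]. *)
Let lim_res x : S x -> exists m, fix_from k m /\ tends (fun n => Rn n (x - T x)) (x - m).
Proof.
move=> Sx; have [m [Sm Tm _ hm]] := mean_ergodic Tl Tc Ssub Scl ST Sx.
exists m; split; first exact: Fk.
rewrite -{1}Tm; apply: eq_tends (tendsB (tends_cst x) (pi_tends (u k k) hm)) => n.
by rewrite /Rn (resolvent_coboundary Tl Tc Ssub Scl ST) // pivZ.
Qed.

Let tends_gap (c : C) (x : nat -> H) : 0 <= c < 1 ->
  tends (fun n => x n - c *: T (x n)) 0 -> tends x 0.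
Proof.
move=> /andP[c0 c1] t; have c2 : 0 < 1 - c by rewrite subr_gt0.
apply: (tends_dom (M := (1 - c)^-1) t) => n; rewrite !subr0.
by rewrite -(ler_pM2l c2) mulrA divff ?gt_eqF // mul1r; exact: resolvent_lb.
Qed.

Let q_itv : 0 <= q < 1. Proof. by rewrite q_lt1 ltW. Qed.

(** Both eta(w) and pi(w) f_n solve an equation z - c T z = pi(w) y, with c = q and c = q r_n. Their
    difference d satisfies d - q T d = (1 - r_n) q T pi(w) f_n. The right side tends to 0 if pi(w)
    kills the limit of (1 - r_n) f_n, and then so does d, as 1 - q T is bounded below. *)
Let off w : w * u k k = q *: (u k k * w) -> eps w = 0 ->
  [/\ eta w - q *: T (eta w) = pi w y,
      forall n, pi w (f n) - (r n * q) *: T (pi w (f n)) = pi w y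
    & (forall m, fix_from k m -> pi w m = 0) -> tends (fun n => pi w (f n)) (eta w)].
Proof.
move=> wk ew.
have a : eta w - q *: T (eta w) = pi w y.
  have := congr1 eta wk; rewrite etaZ etaM etaK // (qg_eps_u Q) eqxx scale1r => e.
  rewrite /y pivN -e; vring.
have b n : pi w (f n) - (r n * q) *: T (pi w (f n)) = pi w y.
  by rewrite -(fE n) pivB pivZ -scalerA /T -!piM wk piZ.
split=> // wm.
have [m [Fm hm]] := lim_f.
have t0 : tends (fun n => q *: T (pi w (h n *: f n))) 0.
  have := tendsZ q (pi_tends (u k k) (pi_tends w hm)).
  by rewrite wm // piv0 scaler0.
have d0 : tends (fun n => eta w - pi w (f n)) 0.
  apply: (tends_gap q_itv); apply: eq_tends t0 => n.
  have -> : eta w - pi w (f n) - q *: T (eta w - pi w (f n)) =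
      (eta w - q *: T (eta w)) - (pi w (f n) - q *: T (pi w (f n))).
    rewrite (linB Tl); vring.
  rewrite a -(b n) pivZ (linZ Tl) -rh; vring.
have := tendsB (tends_cst (eta w)) d0; rewrite subr0.
by apply: eq_tends => n; rewrite opprB addrC subrK.
Qed.

(* For i, l < k, subtracting the commutation relations of u_il - delta_il and
   u_kk applied to eta and to the coboundary of f n leaves an error term which
   tends to 0 by the mean ergodic theorem. *)
Let corner a p w (lam : C) : a * u k k = u k k * a - lam *: (p * w) ->
  p * u k k = q *: (u k k * p) -> w * u k k = q *: (u k k * w) ->
  eps a = 0 -> eps w = 0 -> (forall m, fix_from k m -> pi p m = 0) ->
  (forall m, fix_from k m -> pi w m = 0) ->
  exists m, fix_from k m /\ tends (fun n => pi a (f n)) (eta a - m).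
Proof.
move=> ak pk wk ea ew pm wm.
have [Xa Yb] := off wk ew => /(_ wm);  set X := eta w in Xa *; pose Y n := pi w (f n).
move=> Ylim.
have hE : eta a - T (eta a) = pi a y - lam *: pi p X.
  have := congr1 eta ak.
  rewrite etaM (qg_eps_u Q) eqxx scale1r etaB etaZ !etaK // => e.
  have -> : eta a - T (eta a) = (pi a (eta (u k k)) + eta a) - T (eta a) - pi a (eta (u k k)).
    vring.
  rewrite e -/T -/X /y pivN /T; vring.
have gE n : pi a (f n) - r n *: T (pi a (f n)) = pi a y - (r n * lam) *: pi p (Y n).
  rewrite -(fE n) pivB pivZ /T -[pi a (pi (u k k) _)]piM ak piB piZ !piM -/(Y n); vring.
(* [lam] times [v n] is the amount by which 1 - r_n T fails to map pi(a) f_n to eta(a) - T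
   eta(a). *)
pose v n := pi p (X - r n *: Y n).
have SY n : S (Y n) := Sinv w (Sf n).
have SX : S X by exact: etaF.
have Sd n : S (X - r n *: Y n).
  by rewrite addrC -scaleNr; apply: Ssub.2; [exact: SY|exact: SX].
have Sv n : S (v n) := Sinv p (Sd n).
have Sh : S (eta a - T (eta a)) := (subspace_sub Ssub (etaF a) (ST (etaF a))).
have gR n : pi a (f n) = Rn n (eta a - T (eta a)) + lam *: Rn n (v n).
  have e := resolvent_lin Tl Tc Ssub Scl ST n lam (Sv n) Sh.
  rewrite addrC -e; apply: esym; apply: (resolventE Tl Tc Ssub Scl ST) (Sinv a (Sf n)) _.
  rewrite gE hE /v pivB pivZ; vring.
have eE n : (X - r n *: Y n) - q *: T (X - r n *: Y n) = h n *: Y n.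
  have -> : (X - r n *: Y n) - q *: T (X - r n *: Y n) =
     (X - q *: T X) - r n *: (Y n - q *: T (Y n)).
    rewrite (linB Tl) (linZ Tl); vring.
  rewrite Xa -(Yb n) -/(Y n) -rh; vring.
(* Moving [T] past [w] and past [p] costs a factor q each, hence a gap equation with q^2. *)
have vE n : v n - q ^+ 2 *: T (v n) = h n *: pi p (Y n).
  transitivity (pi p (h n *: Y n)); last by rewrite pivZ.
  rewrite -eE [RHS]pivB [in RHS]pivZ -/(v n); congr (_ - _).
  by rewrite -[in RHS]piM pk piZ piM scalerA -expr2.
have q2 : 0 <= q ^+ 2 < 1 by rewrite expr2 mulr_ge0 ?mulr_ilt1 ?(ltW q_gt0).
have RT n z : S z -> Rn n (T z) = T (Rn n z).
  move=> Sz; have [SR eR] := resolventP Tl Tc Ssub Scl ST n Sz.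
  apply: (resolventE Tl Tc Ssub Scl ST); first exact: ST.
  by rewrite -[in RHS]eR (linB Tl) (linZ Tl).
have SpY n : S (pi p (Y n)) := Sinv p (SY n).
have SpX : S (pi p X) := Sinv p SX.
have PE n : Rn n (v n) - q ^+ 2 *: T (Rn n (v n)) = h n *: Rn n (pi p (Y n)).
  rewrite -(RT n _ (Sv n)).
  have e1 := resolvent_lin Tl Tc Ssub Scl ST n (- q ^+ 2) (ST (Sv n)) (Sv n).
  have e2 := resolvent_lin Tl Tc Ssub Scl ST n (h n) (SpY n) Ssub.1.
  have R0 : Rn n 0 = 0.
    by apply: (resolventE Tl Tc Ssub Scl ST); [exact: Ssub.1|rewrite (lin0 Tl) scaler0 subr0].
  rewrite -/Rn R0 !addr0 in e2; rewrite -e2 -vE addrC -scaleNr -e1.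
  by rewrite -/Rn addrC scaleNr.
have [m [Sm Tm om hm]] := mean_ergodic Tl Tc Ssub Scl ST SpX.
have Fm := Fk Sm Tm.
(* The adjoint of pi(p) maps the ergodic limit [m] into [fix_from k], where pi(p) vanishes; so it
   kills [m], and [m] is orthogonal to pi(p) X. *)
have m0 : m = 0.
  apply: inner_eq0; have e : inner (pi p X) m = 0.
    rewrite -pi_adj'; set w' := pi (star p) m.
    suff -> : w' = 0 by rewrite inner0r.
    apply: inner_eq0; rewrite {1}/w' pi_adj pm ?inner0r //.
    exact: fix_from_inv.
  by move/eqP: om; rewrite innerBl e sub0r oppr_eq0 => /eqP.
have P0 : tends (fun n => Rn n (v n)) 0.
  apply: (tends_gap q2); apply: (eq_tends (x := fun n => h n *: Rn n (pi p (Y n)))).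
    by move=> n; rewrite PE.
  have d0 : tends (fun n => pi p (Y n - X)) 0.
    by have := pi_tends p (tendsB Ylim (tends_cst X)); rewrite subrr piv0.
  have SpD n : S (pi p (Y n - X)).
    exact: (Sinv p (subspace_sub Ssub (SY n) SX)).
  have d1 : tends (fun n => h n *: Rn n (pi p (Y n - X))) 0.
    apply: (tends_dom (M := 1) d0) => n; rewrite !subr0 mul1r.
    exact: (harm_resolvent_le Tl Tc Ssub Scl ST).
  have := tendsD d1 hm; rewrite m0 addr0; apply: eq_tends => n.
  have e := resolvent_lin Tl Tc Ssub Scl ST n 1 (SpD n) SpX.
  rewrite -scalerDr; congr (_ *: _); rewrite /Rn; rewrite !scale1r in e; rewrite -e pivB.
  by rewrite subrK.
have [m' [Fm' lm]] := lim_res (etaF a).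
exists m'; split=> //; have := tendsD lm (tendsZ lam P0).
by rewrite scaler0 addr0; apply: eq_tends => n; rewrite gR.
Qed.

Let eps_off i j : i != j -> eps (u i j) = 0.
Proof. by move=> /negbTE ij; rewrite (qg_eps_u Q) ij. Qed.

Let u_qcomm (i l m : 'I_N) : i != l -> (i == m) && (l < m)%N || (l == m) && (i < m)%N ->
  u i l * u m m = q *: (u m m * u i l).
Proof.
have [h1 h2 _ _] := qg_qmat Q.
by move=> il /orP[/andP[/eqP -> lm]|/andP[/eqP -> im]]; [exact: h2|exact: h1].
Qed.

(** Since pi(u_mm) fixes the range of [eta], the relation of u_il with u_mm gives eta(u_il) = q
    eta(u_il). *)
Let eta_off_zero (i l m : 'I_N) : i != l ->
  (i == m) && (l < m)%N || (l == m) && (i < m)%N -> (k < m)%N -> eta (u i l) = 0.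
Proof.
move=> il ilm km; have := congr1 eta (u_qcomm il ilm).
rewrite etaM (qg_eps_u Q) eqxx scale1r etaZ etaK ?eps_off // etaF //.
rewrite (fix_from_offdiag (etaF (u m m)) il) ?add0r; last first.
  by case/orP: ilm => /andP[/eqP -> _]; rewrite km ?orbT.
move=> e; have : (1 - q) *: eta (u i l) = 0 by rewrite scalerBl scale1r {1}e subrr.
by move/eqP; rewrite scaler_eq0 (negbTE q1) /= => /eqP.
Qed.

Lemma cocycle_step : exists (g : nat -> H) (zeta : A -> H),
  [/\ gcocycle eps pi zeta, forall a, fix_from k (zeta a)
    & forall a, tends (fun n => pi (a - eps a *: 1) (g n)) (eta a - zeta a)].
Proof.
(* By the cocycle identity this property passes to products, so it has to be checked only on
   generators. *)
pose Good a := exists m, fix_from k m /\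
  tends (fun n => pi (a - eps a *: 1) (f n)) (eta a - m).
have Fs := fix_from_subspace k.
have GoodE a : eps a = 0 -> (exists m, fix_from k m /\
    tends (fun n => pi a (f n)) (eta a - m)) -> Good a.
  by move=> ea [m [Fm hm]]; exists m; split=> //; rewrite ea scale0r subr0.
have Good0 i l : i != l -> (forall n, pi (u i l) (f n) = 0) -> eta (u i l) = 0 ->
    Good (u i l).
  move=> il pf e; apply: GoodE (eps_off il) _; exists 0; split; first exact: Fs.1.
  by rewrite e subrr; apply: eq_tends (tends_cst 0) => n; rewrite pf.
have all_good a : Good a.
  move: a; apply: (qg_ind Q) => [|c a b|a b|i l|].
  - exists 0; split; first exact: Fs.1.
    rewrite eta1 subr0; apply: eq_tends (tends_cst 0) => n.
    by rewrite (qg_eps1 Q) scale1r subrr pi0.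
  - move=> [m1 [F1 h1]] [m2 [F2 h2]]; exists (c *: m1 + m2); split.
      by apply: Fs.2.
    rewrite etaL opprD addrACA -scalerBr.
    apply: eq_tends (tendsD (tendsZ c h1) h2) => n.
    by rewrite -piA (qg_eps Q) scalerDl -scalerA scalerBr opprD addrACA.
  - move=> [m1 [F1 h1]] [m2 [F2 h2]]; exists (pi a m2 + eps b *: m1); split.
      by rewrite addrC; apply: Fs.2 => //; exact: fix_from_inv.
    have -> : eta (a * b) - (pi a m2 + eps b *: m1) =
        pi a (eta b - m2) + eps b *: (eta a - m1).
      by rewrite etaM pivB scalerBr opprD addrACA.
    apply: eq_tends (tendsD (pi_tends a h2) (tendsZ (eps b) h1)) => n.
    rewrite -piM -piZ -piD; congr pi.
    rewrite mulrBr scalerBr -scalerAr mulr1 addrA subrK scalerA (qg_epsM Q).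
    by rewrite mulrC.
  - have [eil|il] := eqVneq i l.
      rewrite -eil; have eu : eps (u i i) = 1 by rewrite (qg_eps_u Q) eqxx.
      have [ik|ki|/val_inj eik] := ltngtP i k.
      + pose a := u i i - 1.
        have [m [Fm hm]] : exists m, fix_from k m /\ tends (fun n => pi a (f n)) (eta a - m).
          have [h1 h2 _ h4] := qg_qmat Q.
          apply: (corner (p := u i k) (w := u k i) (lam := q^-1 - q)).
          * by rewrite /a mulrBl mulrBr mul1r mulr1 h4 // addrAC.
          * exact: h1.
          * exact: h2.
          * by rewrite epsB eu (qg_eps1 Q) subrr.
          * by rewrite eps_off // neq_ltn ik orbT.
          * by move=> m Fm; rewrite (fix_from_offdiag Fm) ?leqnn ?orbT // neq_ltn ik.
          * by move=> m Fm; rewrite (fix_from_offdiag Fm) ?leqnn // neq_ltn ik orbT.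
        exists m; split=> //; rewrite eu scale1r; move: hm.
        by rewrite /a etaB eta1 subr0.
      (* Here u_ii fixes [f n], so all of eta(u_ii) must go into the remainder; [eta] applied to the
         relation between u_kk and u_ii shows that u_kk fixes it. *)
      + exists (eta (u i i)); split; last first.
          rewrite subrr; apply: eq_tends (tends_cst 0) => n.
          by rewrite eu scale1r piB pi1 (Sf n) // subrr.
        apply: Fk; first exact: etaF.
        have [_ _ _ h4] := qg_qmat Q.
        have := congr1 eta (h4 k k i i ki ki).
        rewrite etaB etaZ !etaM eu (qg_eps_u Q) eqxx !scale1r.
        rewrite (etaF (u k k)) // eps_off; last by rewrite neq_ltn ki orbT.
        rewrite scale0r (fix_from_offdiag (etaF (u i k))) ?ki ?orbT //; last first.
          by rewrite neq_ltn ki.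
        by rewrite addr0 scaler0 subr0 addrC => /addrI.
      (* The remainder is minus the ergodic limit of (1 - r_n) f_n, because T f_n - f_n = - y + (1 -
         r_n) T f_n. *)
      + rewrite eik; have [m [Fm hm]] := lim_f; exists (- m); split.
          by rewrite -scaleN1r -[_ *: _]addr0; apply: Fs.2 => //; exact: Fs.1.
        have ku : eps (u k k) = 1 by rewrite (qg_eps_u Q) eqxx.
        have -> : eta (u k k) - - m = - y + T m by rewrite /y !opprK FT.
        apply: eq_tends (tendsD (tends_cst (- y)) (pi_tends (u k k) hm)) => n.
        rewrite ku scale1r piB pi1 -(fE n) -/T (linZ Tl) -rh; vring.
    have [m_le|m_gt] := boolP ((i <= k)%N && (l <= k)%N); last first.
      have kil : (k < i)%N || (k < l)%N by rewrite !ltnNge -negb_and.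
      apply: Good0 => // [n|]; first exact: fix_from_offdiag (Sf n) il kil.
      have [li|il'|/val_inj e] := ltngtP l i; last by rewrite e eqxx in il.
        apply: (eta_off_zero (m := i)) => //; first by rewrite eqxx li.
        by case/orP: kil => // kl; exact: ltn_trans kl li.
      apply: (eta_off_zero (m := l)) => //; first by rewrite eqxx il' orbT.
      by case/orP: kil => // ki; exact: ltn_trans ki il'.
    case/andP: m_le => ik lk; apply: GoodE (eps_off il) _.
    have [ilk|] := boolP ((i == k) || (l == k)).
      have ilk' : (i == k) && (l < k)%N || (l == k) && (i < k)%N.
        case/orP: ilk => /eqP e; apply/orP; [left|right]; move: il; rewrite e eqxx /=.
          by rewrite ltn_neqAle lk andbT eq_sym.
        by rewrite ltn_neqAle ik andbT.
      exists 0; split; first exact: Fs.1.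
      rewrite subr0; have [_ _] := off (u_qcomm il ilk') (eps_off il); apply=> m Fm.
      apply: (fix_from_offdiag Fm il).
      by case/orP: ilk => /eqP ->; rewrite leqnn ?orbT.
    rewrite negb_or => /andP[nik nlk].
    have {}ik : (i < k)%N by rewrite ltn_neqAle nik.
    have {}lk : (l < k)%N by rewrite ltn_neqAle nlk.
    have [h1 h2 _ h4] := qg_qmat Q.
    apply: (corner (p := u i k) (w := u k l) (lam := q^-1 - q)).
    + exact: h4.
    + exact: h1.
    + exact: h2.
    + exact: eps_off.
    + by rewrite eps_off // eq_sym.
    + by move=> m Fm; rewrite (fix_from_offdiag Fm nik) ?leqnn ?orbT.
    + by move=> m Fm; rewrite (fix_from_offdiag Fm) ?leqnn // eq_sym.
  - pose a := Dinv - 1; have ed := qg_eps_Dinv Q.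
    have Dk : Dinv * u k k = u k k * Dinv := qg_central Q k k.
    have hE : eta a - T (eta a) = pi a y.
      have := congr1 eta Dk; rewrite !etaM ed (qg_eps_u Q) eqxx !scale1r => e.
      rewrite /a etaB eta1 subr0 /y pivN piB pi1.
      have -> : eta Dinv - T (eta Dinv) = (pi Dinv (eta (u k k)) + eta Dinv) -
          T (eta Dinv) - pi Dinv (eta (u k k)) by vring.
      by rewrite e -/T; vring.
    have [m [Fm hm]] := lim_res (etaF a).
    exists m; split=> //; rewrite ed scale1r.
    rewrite -[eta Dinv]subr0 -eta1 -etaB -/a.
    apply: eq_tends hm => n; rewrite hE; apply: (resolventE Tl Tc Ssub Scl ST) (Sinv a (Sf n)) _.
    rewrite -(fE n) pivB pivZ; congr (_ - _ *: _).
    by rewrite /T -!piM /a mulrBl mulrBr Dk mul1r mulr1.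
(* The remainders form a cocycle because coboundaries do and limits are unique. *)
have [l hl] := choice all_good.
have tz a : tends (fun n => pi (a - eps a *: 1) (f n)) (eta a - l a) by have [] := hl a.
exists f, l; split=> // [|a]; last by have [] := hl a.
split=> [c a b|a b].
  have e := tends_unique (tz (c *: a + b)) (_ : tends _ (c *: (eta a - l a) + (eta b - l b))).
  have {e} : eta (c *: a + b) - l (c *: a + b) = c *: (eta a - l a) + (eta b - l b).
    apply: e; apply: eq_tends (tendsD (tendsZ c (tz a)) (tz b)) => n.
    by rewrite -piA (qg_eps Q) scalerDl -scalerA scalerBr opprD addrACA.
  rewrite etaL scalerBr addrACA -opprD => /addrI /oppr_inj //.
have : eta (a * b) - l (a * b) = pi a (eta b - l b) + eps b *: (eta a - l a).
  apply: tends_unique (tz (a * b)) _.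
  apply: eq_tends (tendsD (pi_tends a (tz b)) (tendsZ (eps b) (tz a))) => n.
  rewrite -piM -piZ -piD; congr pi.
  by rewrite mulrBr scalerBr -scalerAr mulr1 addrA subrK scalerA (qg_epsM Q) mulrC.
by rewrite etaM pivB scalerBr addrACA -opprD => /addrI /oppr_inj.
Qed.

End Step.
End Cocycle.

(** Each step treats the remainder cocycle of the previous one, so the approximating vectors of the
    steps add up. *)
Lemma cocycle_approx_from k : (k <= N)%N -> forall eta, gcocycle eps pi eta ->
  (forall a, fix_from k (eta a)) -> exists (f : nat -> H) (zeta : A -> H),
  (forall a, fix_from 0 (zeta a)) /\
  forall a, tends (fun n => pi (a - eps a *: 1) (f n)) (eta a - zeta a).
Proof.
elim: k => [_ eta etac etaF|k IH kN eta etac etaF].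
  exists (fun=> 0), eta; split=> // a; rewrite subrr.
  by apply: eq_tends (tends_cst 0) => n; rewrite piv0.
have [f [zeta [zc zF hf]]] := cocycle_step (k := Ordinal kN) etac etaF.
have [g [xi [xF hg]]] := IH (ltnW kN) zeta zc zF.
exists (fun n => f n + g n), xi; split=> // a.
have -> : eta a - xi a = (eta a - zeta a) + (zeta a - xi a) by rewrite addrA subrK.
by apply: eq_tends (tendsD (hf a) (hg a)) => n; rewrite pivD.
Qed.

(** The last remainder has gaussian values, while limits of coboundaries are orthogonal to the
    gaussian vectors; this identifies the remainder as the projection. *)
Lemma cocycle_approx eta : gcocycle eps pi eta -> exists f : nat -> H, forall a,
  tends (fun n => pi (a - eps a *: 1) (f n))
    (eta a - proj_on (ggauss eps pi) (eta a)).
Proof.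
move=> etac.
have FN a : fix_from N (eta a) by move=> j; rewrite leqNgt ltn_ord.
have [f [zeta [zF hf]]] := cocycle_approx_from (leqnn N) etac FN.
exists f => a; suff -> : proj_on (ggauss eps pi) (eta a) = zeta a by [].
apply: (proj_on_uniq ggauss_subspace ggauss_closed); first exact/fix_from0.
move=> g Gg; apply: tends_unique (tends_inner (tends_cst g) (hf a)) _.
apply: eq_tends (tends_cst 0) => n; rewrite -pi_adj Gg ?inner0l //.
by apply/gK1P; rewrite eps_star eps_center rmorph0.
Qed.

End Representation.
End QGroup.

(** * Derivatives of the characters eps_theta *)

Section TrigonometricPolynomials.
Variables (R : realType) (N : nat).
Local Notation C := R[i].
Implicit Types (v w x : 'rV[R]_N) (s : seq (C * 'rV[R]_N)).

Lemma is_derive_line (f : 'rV[R]_N -> R) x v l :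
  is_derive (0 : R) (1 : R) (fun h => f (h *: v + x)) l -> is_derive x v f l.
Proof.
have e : (fun h : R => h^-1 *: (((fun h => f (h *: v + x)) \o shift 0) (h *: 1)
      - f ((0 : R) *: v + x))) = (fun h : R => h^-1 *: ((f \o shift x) (h *: v) - f x)).
  apply/funext => h /=; rewrite addr0 scale0r add0r.
  by rewrite -[h *: 1]/(h * 1) mulr1.
move=> [d dl]; split; first by move: d; rewrite /derivable e.
by move: dl; rewrite /derive e.
Qed.

Definition dot w x : R := \sum_i w 0 i * x 0 i.

Lemma dotD w h v x : dot w (h *: v + x) = h * dot w v + dot w x.
Proof.
rewrite /dot mulr_sumr -big_split; apply: eq_bigr => i _ /=.
by rewrite !mxE; ring.
Qed.

Lemma dot_delta w k : dot w (delta_mx 0 k) = w 0 k.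
Proof.
rewrite /dot (bigD1 k) //= big1 => [|i ik]; rewrite mxE eqxx.
  by rewrite eqxx mulr1 addr0.
by rewrite (negbTE ik) mulr0.
Qed.

(** Lists of pairs (coefficient, frequency) stand for finite sums of exponentials. All functions x
    |-> [et x a] have this form, so partial derivatives turn into the formal operation [dtrig]. *)
Definition trig s x : C := \sum_(p <- s) p.1 * expi (dot p.2 x).

Definition dtrig (k : 'I_N) s : seq (C * 'rV[R]_N) :=
  [seq ((0 +i* p.2 0 k)%C * p.1, p.2) | p : C * 'rV[R]_N <- s].

Lemma is_derive_trig_line (c d a b : R) :
  is_derive (0 : R) (1 : R) (fun h : R => c * cos (h * b + a) + d * sin (h * b + a))
    (b * (d * cos a - c * sin a)).
Proof.
have D : is_derive (0 : R) (1 : R) (fun h : R => h * b + a) b.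
  by apply: is_derive_eq; rewrite /GRing.scale /=; ring.
have Dc : is_derive (0 : R) (1 : R) (cos \o (fun h : R => h * b + a)) (- sin a * b).
  apply: is_derive_eq; rewrite mul0r add0r /GRing.scale /=; ring.
have Ds : is_derive (0 : R) (1 : R) (sin \o (fun h : R => h * b + a)) (cos a * b).
  apply: is_derive_eq; rewrite mul0r add0r /GRing.scale /=; ring.
have E : is_derive (0 : R) (1 : R) (c \*: (cos \o (fun h : R => h * b + a))
    + d \*: (sin \o (fun h : R => h * b + a))) (b * (d * cos a - c * sin a)).
  apply: is_derive_eq; rewrite /GRing.scale /=; ring.
exact: E.
Qed.

Lemma is_derive_trig_term (c d : R) w x v :
  is_derive x v (fun x => c * cos (dot w x) + d * sin (dot w x))
    (dot w v * (d * cos (dot w x) - c * sin (dot w x))).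
Proof.
apply: is_derive_line; have := is_derive_trig_line c d (dot w x) (dot w v).
by under [X in is_derive _ _ X _ -> _]eq_fun do rewrite -dotD.
Qed.

Lemma is_derive_trig k s x :
  is_derive x (delta_mx 0 k) (fun x => complex.Re (trig s x))
    (complex.Re (trig (dtrig k s) x)) /\
  is_derive x (delta_mx 0 k) (fun x => complex.Im (trig s x))
    (complex.Im (trig (dtrig k s) x)).
Proof.
have ReD (a b : C) : complex.Re (a + b) = complex.Re a + complex.Re b by case: a b => ? ? [].
have ImD (a b : C) : complex.Im (a + b) = complex.Im a + complex.Im b by case: a b => ? ? [].
elim: s => [|[[c d] w] s [IHr IHi]].
  rewrite /trig big_nil /=; split; under eq_fun do rewrite big_nil /=;
  exact: is_derive_cst.
have eT y : trig ((c +i* d, w)%C :: s) y = (c +i* d)%C * expi (dot w y) + trig s y.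
  by rewrite /trig big_cons.
have eD : trig (dtrig k ((c +i* d, w)%C :: s)) x =
    (0 +i* w 0 k)%C * (c +i* d)%C * expi (dot w x) + trig (dtrig k s) x.
  by rewrite /trig big_cons.
split.
  have -> : (fun y => complex.Re (trig ((c +i* d, w)%C :: s) y)) =
     (fun y => c * cos (dot w y) + (- d) * sin (dot w y)) + (fun y => complex.Re (trig s y)).
    apply/funext => y; rewrite eT ReD /= -[RHS]/(c * _ + - d * _ + _); ring.
  have H := is_derive_trig_term c (- d) w x (delta_mx 0 k).
  by apply: is_derive_eq; rewrite eD ReD /= dot_delta; ring.
have -> : (fun y => complex.Im (trig ((c +i* d, w)%C :: s) y)) =
   (fun y => d * cos (dot w y) + c * sin (dot w y)) + (fun y => complex.Im (trig s y)).
  apply/funext => y; rewrite eT ImD /= -[RHS]/(d * _ + c * _ + _); ring.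
have H := is_derive_trig_term d c w x (delta_mx 0 k).
by apply: is_derive_eq; rewrite eD ImD /= dot_delta; ring.
Qed.

Lemma partial_trig k s : partial k (trig s) = trig (dtrig k s).
Proof.
apply/funext => x; have [[_ r] [_ i]] := is_derive_trig k s x.
by rewrite /partial r i; case: (trig _ _).
Qed.

Lemma expi0 : expi 0 = 1 :> C.
Proof. by rewrite /expi cos0 sin0. Qed.

Lemma expi_conj (t : R) : (expi t)^* = expi (- t).
Proof. by rewrite /expi cosN sinN. Qed.

Lemma trig_cat s t x : trig (s ++ t) x = trig s x + trig t x.
Proof. by rewrite /trig big_cat. Qed.

Definition sctrig c s : seq (C * 'rV[R]_N) := [seq (c * p.1, p.2) | p : C * 'rV[R]_N <- s].

Lemma trig_sc c s x : trig (sctrig c s) x = c * trig s x.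
Proof. by rewrite /trig big_map mulr_sumr; apply: eq_bigr => p _ /=; rewrite mulrA. Qed.

Definition multrig s t : seq (C * 'rV[R]_N) :=
  [seq (p.1 * p'.1, p.2 + p'.2) | p : C * 'rV[R]_N <- s, p' : C * 'rV[R]_N <- t].

Lemma trig_mul s t x : trig (multrig s t) x = trig s x * trig t x.
Proof.
rewrite /trig big_allpairs_dep mulr_suml; apply: eq_bigr => p _.
rewrite mulr_sumr; apply: eq_bigr => p' _ /=.
have -> : dot (p.2 + p'.2) x = dot p.2 x + dot p'.2 x.
  by rewrite /dot -big_split; apply: eq_bigr => i _; rewrite mxE mulrDl.
by rewrite expiD; ring.
Qed.

Lemma dtrig_mul k s t x : trig (dtrig k (multrig s t)) x =
  trig (dtrig k s) x * trig t x + trig s x * trig (dtrig k t) x.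
Proof.
have E s' : trig (dtrig k s') x = \sum_(p <- s') (0 +i* p.2 0 k)%C * (p.1 * expi (dot p.2 x)).
  by rewrite /trig /dtrig big_map; apply: eq_bigr => p _ /=; rewrite mulrA.
rewrite !E /trig big_allpairs_dep !mulr_suml -big_split; apply: eq_bigr => p _ /=.
rewrite !mulr_sumr -big_split; apply: eq_bigr => p' _ /=.
have -> : dot (p.2 + p'.2) x = dot p.2 x + dot p'.2 x.
  by rewrite /dot -big_split; apply: eq_bigr => i _; rewrite mxE mulrDl.
rewrite mxE expiD.
have -> : (0 +i* (p.2 0 k + p'.2 0 k))%C = (0 +i* p.2 0 k)%C + (0 +i* p'.2 0 k)%C :> C.
  by apply/eqP; rewrite eq_complex /= addr0 !eqxx.
by ring.
Qed.

Lemma dtrig_mulE k s t : trig (dtrig k (multrig s t)) =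
  trig (multrig (dtrig k s) t ++ multrig s (dtrig k t)).
Proof. by apply/funext => x; rewrite dtrig_mul trig_cat !trig_mul. Qed.

Lemma dtrig_cat k s t : dtrig k (s ++ t) = dtrig k s ++ dtrig k t.
Proof. exact: map_cat. Qed.

Lemma dtrig_sc k c s : dtrig k (sctrig c s) = sctrig c (dtrig k s).
Proof.
by rewrite /dtrig /sctrig -!map_comp; apply: eq_map => p /=; rewrite mulrCA.
Qed.

Definition conjtrig s : seq (C * 'rV[R]_N) := [seq (p.1^*, - p.2) | p : C * 'rV[R]_N <- s].

Lemma trig_conj s x : trig (conjtrig s) x = (trig s x)^*.
Proof.
rewrite /trig big_map rmorph_sum; apply: eq_bigr => p _ /=.
rewrite rmorphM /= expi_conj; congr (_ * expi _).
by rewrite /dot -sumrN; apply: eq_bigr => i _; rewrite mxE mulNr.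
Qed.

Lemma dtrig_conj k s : dtrig k (conjtrig s) = conjtrig (dtrig k s).
Proof.
rewrite /dtrig /conjtrig -!map_comp; apply: eq_map => p /=.
by rewrite mxE rmorphM; congr (_ * _, _).
Qed.
End TrigonometricPolynomials.

Section GenericDerivatives.
Variables (R : realType) (N : nat) (A : algType R[i]).
Variables (u : 'M[A]_N) (Dinv : A) (star : A -> A) (eps : A -> R[i]).
Variable et : 'rV[R]_N -> A -> R[i].
Local Notation C := R[i].

Definition gdiag (k : 'I_N.+1) : A :=
  if unlift ord_max k is Some j then u j j else Dinv.

Definition gd (i : 'I_N) : A :=
  let g := gdiag (lift ord0 i) in (2 * 'i)^-1 *: (g - star g).

Definition gprojP (P : A -> A) : Prop :=
  [/\ linear P, range P = gK eps 2, forall a, gK eps 2 a -> P a = a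
    & [set a | P a = 0] = lspan ([set 1] `|` range gd)].

Definition gdrift (psi : A -> C) :=
  gGF star eps psi /\ forall a, gK eps 2 a -> psi a = 0.

Definition ge1 (j : 'I_N) (a : A) : C := partial j (et^~ a) 0.

Definition ge2 (j k : 'I_N) (a : A) : C := partial j (partial k (et^~ a)) 0.

Definition gdrift_term (r : 'rV[R]_N) (a : A) : C := \sum_j (r 0 j)%:C%C * ge1 j a.

Definition gquad (M : 'M[R]_N) (a : A) : C :=
  2^-1 * \sum_j \sum_k (M j k)%:C%C * ge2 j k a.
End GenericDerivatives.

(** * Derivatives at the counit and the projection onto K_2 *)

Section Derivatives.
Variables (R : realType) (q : R[i]) (N : nat) (A : algType R[i]).
Variables (u : 'M[A]_N) (Dinv : A) (star : A -> A) (eps : A -> R[i]).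
Variable et : 'rV[R]_N -> A -> R[i].
Hypothesis N_gt0 : (0 < N)%N.
Hypothesis q01 : 0 < q < 1.
Hypothesis Q : qgroup q u Dinv star eps.
Hypothesis et_lin : forall x, scalar (et x).
Hypothesis etM : forall x, {morph et x : a b / a * b}.
Hypothesis et1 : forall x, et x 1 = 1.
Hypothesis et_u : forall x j k,
  et x (u j k) = expi (angle x (lift ord_max j)) *+ (j == k).
Hypothesis et_Dinv : forall x, et x Dinv = expi (angle x ord_max).
Local Notation C := R[i].
Local Notation K := (gK eps).
Local Notation g := (gdiag u Dinv).
Local Notation d := (gd u Dinv star).
Local Notation e1 := (ge1 et).
Local Notation e2 := (ge2 et).

(** Coefficients of the angles as linear forms in the free parameters; theta_1 is minus their sum,
    hence the constant row. *)
Definition angle_row (k : 'I_N.+1) : 'rV[R]_N :=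
  if unlift ord0 k is Some i then delta_mx 0 i else const_mx (-1).

Lemma angleE x k : angle x k = dot (angle_row k) x.
Proof.
rewrite /angle /angle_row; case: unlift => [i|].
  rewrite /dot (bigD1 i) //= big1 => [|j ji]; rewrite mxE eqxx.
    by rewrite eqxx mul1r addr0.
  by rewrite (negbTE ji) mul0r.
by rewrite /dot -sumrN; apply: eq_bigr => i _; rewrite mxE mulN1r.
Qed.

Lemma et_g x k : et x (g k) = expi (angle x k).
Proof.
rewrite /gdiag; case: unliftP => [j ->|->]; last exact: et_Dinv.
by rewrite et_u eqxx.
Qed.

Definition trig_rep a s := forall x, et x a = trig s x.

Lemma trig_rep_g k : trig_rep (g k) [:: (1, angle_row k)].
Proof. by move=> x; rewrite et_g angleE /trig big_seq1 mul1r. Qed.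

Lemma trig_rep1 : trig_rep 1 [:: (1, 0)].
Proof.
move=> x; rewrite et1 /trig big_seq1 mul1r /dot big1 ?expi0 // => i _.
by rewrite mxE mul0r.
Qed.

Lemma trig_repD c a b s t : trig_rep a s -> trig_rep b t ->
  trig_rep (c *: a + b) (sctrig c s ++ t).
Proof. by move=> ha hb x; rewrite et_lin trig_cat trig_sc ha hb. Qed.

Lemma trig_repM a b s t : trig_rep a s -> trig_rep b t -> trig_rep (a * b) (multrig s t).
Proof. by move=> ha hb x; rewrite etM trig_mul ha hb. Qed.

Lemma trig_rep_ex a : exists s, trig_rep a s.
Proof.
apply: (qg_ind Q (P := fun a => exists s, trig_rep a s)) a => [|c a b [s ha] [t hb]|a b [s ha] [t hb]|j k|].
- by exists [:: (1, 0)]; exact: trig_rep1.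
- by exists (sctrig c s ++ t); exact: trig_repD.
- by exists (multrig s t); exact: trig_repM.
- have [->|jk] := eqVneq j k.
    by have := trig_rep_g (lift ord_max k); rewrite /gdiag liftK; eexists; exact: H.
  by exists [::] => x; rewrite et_u (negbTE jk) /trig big_nil.
- by have := trig_rep_g ord_max; rewrite /gdiag unlift_none; eexists; exact: H.
Qed.

Lemma et_star x a : et x (star a) = (et x a)^*.
Proof.
apply: (character_star Q (et_lin x) (@etM x) (et1 x) (et_u x) (et_Dinv x)) => [j|].
  by rewrite expi_conj -expiD subrr expi0.
by rewrite expi_conj -expiD subrr expi0.
Qed.

Lemma trig_rep_star a s : trig_rep a s -> trig_rep (star a) (conjtrig s).
Proof. by move=> ha x; rewrite et_star trig_conj ha. Qed.

Lemma et0 a : et 0 a = eps a.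
Proof.
have e0 k : expi (angle (0 : 'rV[R]_N) k) = 1.
  rewrite angleE /dot big1 ?expi0 // => i _; by rewrite mxE mulr0.
apply: (qg_ind Q (P := fun a => et 0 a = eps a)) a => [|c a b ha hb|a b ha hb|j k|].
- by rewrite et1 (qg_eps1 Q).
- by rewrite et_lin (qg_eps Q) ha hb.
- by rewrite etM (qg_epsM Q) ha hb.
- by rewrite et_u (qg_eps_u Q) e0.
- by rewrite et_Dinv (qg_eps_Dinv Q) e0.
Qed.

Lemma e1P j a s : trig_rep a s -> e1 j a = trig (dtrig j s) 0.
Proof. by move=> /funext h; rewrite /ge1 h partial_trig. Qed.

Lemma e2P j k a s : trig_rep a s -> e2 j k a = trig (dtrig j (dtrig k s)) 0.
Proof. by move=> /funext h; rewrite /ge2 h !partial_trig. Qed.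

Local Opaque ge1 ge2.

Lemma e1_lin j : scalar (e1 j).
Proof.
move=> c a b; have [s ha] := trig_rep_ex a; have [t hb] := trig_rep_ex b.
by rewrite (e1P j ha) (e1P j hb) (e1P j (trig_repD c ha hb)) dtrig_cat trig_cat dtrig_sc trig_sc.
Qed.

Lemma e2_lin j k : scalar (e2 j k).
Proof.
move=> c a b; have [s ha] := trig_rep_ex a; have [t hb] := trig_rep_ex b.
rewrite (e2P j k ha) (e2P j k hb) (e2P j k (trig_repD c ha hb)).
by rewrite !dtrig_cat trig_cat !dtrig_sc trig_sc.
Qed.

Lemma e1_star j a : e1 j (star a) = (e1 j a)^*.
Proof.
have [s ha] := trig_rep_ex a.
by rewrite (e1P j ha) (e1P j (trig_rep_star ha)) dtrig_conj trig_conj.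
Qed.

Lemma e2_star j k a : e2 j k (star a) = (e2 j k a)^*.
Proof.
have [s ha] := trig_rep_ex a.
by rewrite (e2P j k ha) (e2P j k (trig_rep_star ha)) !dtrig_conj trig_conj.
Qed.

Lemma e1_1 j : e1 j 1 = 0.
Proof.
rewrite (e1P j trig_rep1) /trig big_map big_seq1 /= mxE.
by rewrite (_ : (0 +i* 0)%C = 0) // !mul0r.
Qed.

Lemma e2_1 j k : e2 j k 1 = 0.
Proof.
rewrite (e2P j k trig_rep1) /trig !big_map big_seq1 /= !mxE.
by rewrite (_ : (0 +i* 0)%C = 0) // !mul0r.
Qed.

Lemma e1M j a b : e1 j (a * b) = e1 j a * eps b + eps a * e1 j b.
Proof.
have [s ha] := trig_rep_ex a; have [t hb] := trig_rep_ex b.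
by rewrite (e1P j ha) (e1P j hb) (e1P j (trig_repM ha hb)) dtrig_mul -!et0 ha hb.
Qed.

Lemma e2M j k a b : e2 j k (a * b) = e2 j k a * eps b + e1 j a * e1 k b
  + e1 k a * e1 j b + eps a * e2 j k b.
Proof.
have [s ha] := trig_rep_ex a; have [t hb] := trig_rep_ex b.
rewrite (e2P j k ha) (e2P j k hb) (e1P j ha) (e1P j hb) (e1P k ha) (e1P k hb).
rewrite -!et0 ha hb (e2P j k (trig_repM ha hb)).
rewrite -partial_trig dtrig_mulE partial_trig dtrig_cat trig_cat !dtrig_mul.
ring.
Qed.

Lemma e1_g j m : e1 j (g m) = 'i * (angle_row m 0 j)%:C%C.
Proof.
rewrite (e1P j (trig_rep_g m)) /trig big_map big_seq1 /=.
have -> : dot (angle_row m) 0 = 0 by rewrite /dot big1 // => i _; rewrite mxE mulr0.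
rewrite expi0 !mulr1; apply/eqP.
by rewrite -complexiE eq_complex /= !mul0r !mul1r subrr add0r !eqxx.
Qed.

Lemma e2_g j k m : e2 j k (g m) = - (angle_row m 0 j * angle_row m 0 k)%:C%C.
Proof.
rewrite (e2P j k (trig_rep_g m)) /trig !big_map big_seq1 /=.
have -> : dot (angle_row m) 0 = 0 by rewrite /dot big1 // => i _; rewrite mxE mulr0.
rewrite expi0 !mulr1; apply/eqP.
rewrite eq_complex /=; apply/andP; split; apply/eqP; ring.
Qed.

Lemma e1_0 j : e1 j 0 = 0. Proof. exact: sc0 (e1_lin j). Qed.
Lemma e1Z j c a : e1 j (c *: a) = c * e1 j a. Proof. exact: scZ (e1_lin j) c a. Qed.
Lemma e1B j : {morph e1 j : a b / a - b}. Proof. exact: scB (e1_lin j). Qed.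
Lemma e2_0 j k : e2 j k 0 = 0. Proof. exact: sc0 (e2_lin j k). Qed.
Lemma e2Z j k c a : e2 j k (c *: a) = c * e2 j k a. Proof. exact: scZ (e2_lin j k) c a. Qed.
Lemma e2B j k : {morph e2 j k : a b / a - b}. Proof. exact: scB (e2_lin j k). Qed.

Lemma d_star i : star (d i) = d i.
Proof.
rewrite /gd (gstarZ Q) (gstarB Q) (qg_starK Q) -opprB scalerN -scaleNr; congr (_ *: _).
by rewrite fmorphV rmorphM /= conjCi rmorph_nat mulrN invrN opprK.
Qed.

Lemma conjC_real (x : R) : (x%:C%C)^* = x%:C%C :> C.
Proof. by apply/eqP; rewrite eq_complex /= oppr0 !eqxx. Qed.

Lemma angle_row_lift i : angle_row (lift ord0 i) = delta_mx 0 i.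
Proof. by rewrite /angle_row liftK. Qed.

(** Under [et x] the element [d i] becomes the sine of the i-th parameter; hence the [e1 j] are dual
    to the [d i], and the second derivatives of [d i] at 0 vanish. *)
Lemma e1_d j i : e1 j (d i) = (j == i)%:R.
Proof.
rewrite /gd e1Z e1B e1_star e1_g rmorphM /= conjCi conjC_real angle_row_lift mxE eqxx /=.
have -> : (2 * 'i)^-1 * ('i * (j == i)%:R%:C%C - - 'i * (j == i)%:R%:C%C) = (j == i)%:R%:C%C :> C.
  by field; rewrite neq0Ci.
by case: eqP.
Qed.

Lemma e2_d j k i : e2 j k (d i) = 0.
Proof. by rewrite /gd e2Z e2B e2_star e2_g rmorphN /= conjC_real subrr mulr0. Qed.

Lemma gdE i : d i = (2 * 'i)^-1 *: (g (lift ord0 i) - star (g (lift ord0 i))).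
Proof. by []. Qed.

Local Opaque gd.

Lemma eps_g m : eps (g m) = 1.
Proof.
by rewrite /gdiag; case: unlift => [j|]; rewrite ?(qg_eps_u Q) ?eqxx ?(qg_eps_Dinv Q).
Qed.

Lemma eps_d i : eps (d i) = 0.
Proof. by rewrite gdE (epsZ Q) (epsB Q) (eps_star Q) eps_g rmorph1 subrr mulr0. Qed.

Lemma e1_K2 j a : K 2 a -> e1 j a = 0.
Proof.
move: a; apply: (gK2_ind) => [|c a b ha hb|a b ha hb]; first exact: e1_0.
  by rewrite e1_lin ha hb mulr0 addr0.
by rewrite e1M ha hb mulr0 mul0r addr0.
Qed.

Lemma e2_K3 j k a : K 3 a -> e2 j k a = 0.
Proof.
move: a; apply: (gK3_ind) => [|c a b ha hb|a b c ha hb hc]; first exact: e2_0.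
  by rewrite e2_lin ha hb mulr0 addr0.
by rewrite (e2M j k (a * b)) (e1M j a) (e1M k a) (qg_epsM Q a) ha hb hc
  !(mulr0, mul0r, addr0).
Qed.

(** An explicit candidate for the projection: the first order Taylor part at the counit is
    subtracted. That its values lie in K_2 amounts to saying that 1 and the [d i] span the algebra
    modulo K_2. *)
Definition K2proj a := a - eps a *: 1 - \sum_i e1 i a *: d i.

Lemma K2projE a : a = eps a *: 1 + \sum_i e1 i a *: d i + K2proj a.
Proof. by rewrite /K2proj -(addrA a) -opprD [RHS]addrC subrK. Qed.

Lemma K2proj_lin : linear K2proj.
Proof.
move=> c a b; rewrite /K2proj (qg_eps Q).
have -> : \sum_i e1 i (c *: a + b) *: d i =
    c *: (\sum_i e1 i a *: d i) + \sum_i e1 i b *: d i.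
  rewrite scaler_sumr -big_split; apply: eq_bigr => i _ /=.
  by rewrite e1_lin scalerDl -(scalerA c (e1 i a)).
rewrite scalerDl -scalerA !scalerBr.
by rewrite (opprD (c *: _)) addrACA opprD; exact: addrACA.
Qed.

Lemma K2projD a b : K2proj (a + b) = K2proj a + K2proj b.
Proof. exact: (linD K2proj_lin). Qed.
Lemma K2projZ c a : K2proj (c *: a) = c *: K2proj a.
Proof. exact: (linZ K2proj_lin). Qed.
Lemma K2projN a : K2proj (- a) = - K2proj a.
Proof. exact: (linN K2proj_lin). Qed.
Lemma K2proj_id a : K 2 a -> K2proj a = a.
Proof.
move=> Ka; rewrite /K2proj (gK21 Q Ka) scale0r subr0 big1 ?subr0 // => i _.
by rewrite e1_K2 // scale0r.
Qed.

Lemma K2proj1 : K2proj 1 = 0.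
Proof.
rewrite /K2proj (qg_eps1 Q) scale1r subrr sub0r big1 ?oppr0 // => i _.
by rewrite e1_1 scale0r.
Qed.

Lemma K2proj_d i : K2proj (d i) = 0.
Proof.
rewrite /K2proj eps_d scale0r subr0 (bigD1 i) //= e1_d eqxx scale1r.
rewrite big1 ?addr0 ?subrr // => j ji.
by rewrite e1_d (negbTE ji) scale0r.
Qed.

Lemma K2proj_star a : K2proj (star a) = star (K2proj a).
Proof.
rewrite /K2proj !(gstarB Q) (gstarZ Q) (gstar1 Q) (eps_star Q); congr (_ - _).
rewrite (gstar_sum Q); apply: eq_bigr => i _.
by rewrite (gstarZ Q) d_star e1_star.
Qed.

Lemma K2projM a b : K2proj (a * b) =
  (a - eps a *: 1) * (b - eps b *: 1) + eps a *: K2proj b + eps b *: K2proj a.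
Proof.
have K2projc x : K2proj (x - eps x *: 1) = K2proj x.
  by rewrite K2projD K2projN K2projZ K2proj1 scaler0 subr0.
have E : a * b = (a - eps a *: 1) * (b - eps b *: 1) + eps a *: (b - eps b *: 1)
   + eps b *: (a - eps a *: 1) + (eps a * eps b) *: 1.
  rewrite -{1}[a](subrK (eps a *: 1)) -{1}[b](subrK (eps b *: 1)).
  move: (a - _) (b - _) => a0 b0.
  rewrite mulrDl !mulrDr -!scalerAl -!scalerAr !(mul1r, mulr1, scalerA).
  by rewrite -!addrA; congr (_ + _); rewrite addrCA.
rewrite E !K2projD !K2projZ K2proj1 scaler0 addr0 !K2projc K2proj_id //.
by apply: gK2M; exact: (eps_center Q).
Qed.

Lemma K2_idealr a b : K 2 a -> K 2 (a * b).
Proof.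
move=> Ka; rewrite -[b](subrK (eps b *: 1)) mulrDr -scalerAr mulr1.
apply: gKD; last exact: gKZ.
by apply/(gK32 Q)/(gK2r Ka)/(eps_center Q).
Qed.

Lemma K2_ideall a b : K 2 b -> K 2 (a * b).
Proof.
move=> Kb; rewrite -[a](subrK (eps a *: 1)) mulrDl -scalerAl mul1r.
apply: gKD; last exact: gKZ.
by apply/(gK32 Q)/gK2l => //; exact: (eps_center Q).
Qed.

Let q1 : 1 - q != 0. Proof. by case/andP: q01 => _ ?; rewrite gt_eqF // subr_gt0. Qed.

(** With i = min(j, k) one has u_ii u_jk = q u_jk u_ii; written in terms of u_ii - 1 this expresses
    (q - 1) u_jk by products of elements of the kernel. *)
Lemma K2_u j k : j != k -> K 2 (u j k).
Proof.
move=> jk.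
have euu (i : 'I_N) : eps (u i i - 1) = 0.
  by rewrite (epsB Q) (qg_eps_u Q) eqxx (qg_eps1 Q) subrr.
have eu : eps (u j k) = 0 by rewrite (qg_eps_u Q) (negbTE jk).
have [h1 h2 _ _] := qg_qmat Q.
suff [i hi] : exists i, u i i * u j k = q *: (u j k * u i i).
  have E : (u i i - 1) * u j k - q *: (u j k * (u i i - 1)) = (q - 1) *: u j k.
    rewrite mulrBl mul1r hi mulrBr mulr1 scalerBr scalerBl scale1r.
    by rewrite opprB addrC addrA subrK.
  have -> : u j k = (q - 1)^-1 *: ((q - 1) *: u j k).
    by rewrite scalerA mulVf ?scale1r // -opprB oppr_eq0.
  rewrite -E; apply/gKZ/gKB; first exact: gK2M.
  by apply/gKZ/gK2M.
move: jk; rewrite neq_ltn => /orP[jk|kj]; [exists j; exact: h2|exists k; exact: h1].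
Qed.

(** Since 2 - x - star x equals (x - 1)(star x - 1) minus x star x - 1, such an x is 1 plus a
    skew-adjoint element modulo K_2. *)
Lemma K2_unitary_sum x : eps x = 1 -> K 2 (x * star x - 1) -> K 2 (x + star x - 2).
Proof.
move=> ex Kx; rewrite -opprB; apply: gKN.
have -> : 2 - (x + star x) = (x - 1) * (star x - 1) - (x * star x - 1).
  rewrite mulrBl !mulrBr mulr1 mul1r -[2]/(1 + 1).
  move: (x * star x) (star x) => y z.
  rewrite !opprB opprD [RHS](AC (2*2*2) ((1*6)*((3*5)*(2*4))))/=; by rewrite subrr add0r mul1r.
apply: gKB => //; apply: gK2M; rewrite (epsB Q) (qg_eps1 Q) ?(eps_star Q) ex ?rmorph1 subrr //.
Qed.

Lemma K2_g m : K 2 (g m + star (g m) - 2).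
Proof.
apply: K2_unitary_sum; first exact: eps_g.
rewrite /gdiag; case: unlift => [j|]; last by rewrite (qg_Dl Q) subrr; exact: gK0.
have := qg_row Q j j; rewrite eqxx mulr1n (bigD1 j) //= => <-.
rewrite opprD addNKr; apply/gKN/gK_sum => k kj; rewrite eq_sym in kj.
by apply: gK2M; rewrite ?(eps_star Q) (qg_eps_u Q) (negbTE kj) ?rmorph0.
Qed.

Lemma K2proj_g_lift i : K2proj (g (lift ord0 i)) =
  2^-1 *: (g (lift ord0 i) + star (g (lift ord0 i)) - 2).
Proof.
rewrite /K2proj eps_g scale1r (bigD1 i) //= big1 => [|j ji]; last first.
  by rewrite e1_g angle_row_lift mxE (negbTE ji) andbF mulr0 scale0r.
rewrite e1_g angle_row_lift mxE !eqxx mulr1 addr0 gdE scalerA.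
set x := g _; have -> : 'i / (2 * 'i) = 2^-1 :> C.
  by rewrite invfM mulrCA mulfV ?mulr1 ?neq0Ci.
have h2 : 2^-1 + 2^-1 = 1 :> C by field.
have h (z : A) : z = (2^-1 : C) *: z + (2^-1 : C) *: z by rewrite -scalerDl h2 scale1r.
have e : (2^-1 : C) *: (2 : A) = 1 by rewrite scalerDr -h.
rewrite !scalerBr scalerDr e {1}[x]h opprB.
by rewrite (AC (2*1*2) (1*(4*3)*(2*5)))/= subrr addr0 addrA.
Qed.

Lemma K2proj_prod (r : seq 'I_N) :
  eps (\prod_(j <- r) u j j) = 1 /\
  K 2 (K2proj (\prod_(j <- r) u j j) - \sum_(j <- r) K2proj (u j j)).
Proof.
elim: r => [|j r [e IH]].
  by rewrite !big_nil (qg_eps1 Q) K2proj1 subrr; split => //; exact: gK0.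
rewrite !big_cons (qg_epsM Q) e (qg_eps_u Q) eqxx mulr1; split=> //.
rewrite K2projM e (qg_eps_u Q) eqxx !scale1r.
have Z (p y z s : A) : p + y + z - (z + s) = p + (y - s).
  by rewrite -!addrA; congr (_ + (_ + _)); rewrite opprD addNKr.
rewrite Z; clear Z.
apply: gKD => //; apply: gK2M; by rewrite (epsB Q) (qg_eps1 Q) ?e ?(qg_eps_u Q) ?eqxx subrr.
Qed.

Lemma K2_K2proj_lift i : K 2 (K2proj (g (lift ord0 i))).
Proof. by rewrite K2proj_g_lift; apply/gKZ/K2_g. Qed.

Lemma K2_prod (r : seq 'I_N) (F : 'I_N -> A) i : i \in r -> K 2 (F i) ->
  K 2 (\prod_(j <- r) F j).
Proof.
elim: r => // j r IH; rewrite in_cons big_cons => /orP[/eqP <-|ir] Fi.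
  exact: K2_idealr.
by apply: K2_ideall; exact: IH.
Qed.

Lemma K2_K2proj_nz m : m != ord0 -> K 2 (K2proj (g m)).
Proof. by case: (unliftP ord0 m) => [i -> _|->]; [exact: K2_K2proj_lift|rewrite eqxx]. Qed.

Lemma g_lift j : g (lift ord_max j) = u j j.
Proof. by rewrite /gdiag liftK. Qed.

Lemma K2_K2proj_Dinv : K 2 (K2proj Dinv).
Proof.
have := @K2_K2proj_nz ord_max; rewrite /gdiag unlift_none; apply.
by rewrite -val_eqE /= -lt0n.
Qed.

(* Modulo K_2 the map K2proj is a derivation, and the quantum determinant is
   the product of the u_jj; hence u_11, which is missing among the dgen, is
   reached from D. *)
Lemma K2_K2proj_u j : K 2 (K2proj (u j j)).
Proof.
pose j0 := Ordinal N_gt0.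
have nz k : k != j0 -> K 2 (K2proj (u k k)).
  move=> kj; rewrite -g_lift; apply: K2_K2proj_nz; apply: contra kj => /eqP e.
  have := congr1 val e; rewrite /= /bump leqNgt ltn_ord add0n => k0.
  by apply/eqP/val_inj.
have [->|] := eqVneq j j0; last exact: nz.
have [_ hp] := K2proj_prod (index_enum 'I_N).
have KD : K 2 (K2proj (star Dinv)).
  by rewrite K2proj_star; apply: (gK2_star Q); exact: K2_K2proj_Dinv.
suff hP : K 2 (K2proj (\prod_j u j j)).
  have := gKB hP hp; rewrite opprB addrCA subrr addr0 (bigD1 j0) //= => h.
  rewrite -[X in K 2 X](addrK (\sum_(k | k != j0) K2proj (u k k))).
  by apply: gKB => //; apply: gK_sum => k; exact: nz.
have := KD; rewrite (qg_D Q) /qdet (bigD1 (1%g : 'S_N)) //= inversions1 expr0 scale1r.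
have -> : \prod_i u i ((1%g : 'S_N) i) = \prod_i u i i.
  by apply: eq_bigr => k _; rewrite perm1.
(* A permutation other than the identity moves some index, so its monomial has an off-diagonal
   factor, and K_2 is an ideal. *)
set X := \sum_(_ | _) _; have KX : K 2 X.
  apply: gK_sum => s s1; apply: gKZ.
  suff [i si] : exists i, s i != i.
    by apply: (K2_prod (i := i)); rewrite ?mem_index_enum //; apply: K2_u; rewrite eq_sym.
  apply/existsP; rewrite -negb_forall; apply: contra s1 => /forallP s1.
  by apply/eqP/permP => i; rewrite perm1; apply/eqP.
rewrite K2projD (K2proj_id KX) => h.
by rewrite -[X in K 2 X](addrK X); apply: gKB.
Qed.

Lemma K2_K2proj a : K 2 (K2proj a).
Proof.
apply: (qg_ind Q (P := fun a => K 2 (K2proj a))) a => [|c a b ha hb|a b ha hb|j k|].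
- by rewrite K2proj1; exact: gK0.
- by rewrite K2proj_lin; exact: gK_lin.
- rewrite K2projM; apply: gKD; last exact: gKZ.
  apply: gKD; last exact: gKZ.
  by apply: gK2M; exact: (eps_center Q).
- have [->|jk] := eqVneq j k; first exact: K2_K2proj_u.
  by rewrite K2proj_id; exact: K2_u.
- exact: K2_K2proj_Dinv.
Qed.

Lemma lspan_ker (V W : lmodType C) (S : set V) (f : V -> W) : linear f ->
  (forall x, S x -> f x = 0) -> forall x, lspan S x -> f x = 0.
Proof.
move=> fl h x [n [c [v [hv ->]]]].
rewrite (lin_sum fl) big1 // => i _.
by rewrite (linZ fl) h ?scaler0.
Qed.

Lemma lspan_rest a : lspan ([set 1] `|` range d) (a - K2proj a).
Proof.
rewrite {1}[a]K2projE addrK.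
exists N.+1, (fun i => if unlift ord0 i is Some j then e1 j a else eps a),
  (fun i => if unlift ord0 i is Some j then d j else 1); split.
  by move=> i; case: unlift => [j|]; [right; exists j|left].
by rewrite big_ord_recl unlift_none; congr (_ + _); apply: eq_bigr => i _; rewrite liftK.
Qed.

Lemma K2proj_gprojP : gprojP u Dinv star eps K2proj.
Proof.
split.
- exact: K2proj_lin.
- apply/seteqP; split=> [_ [a _ <-]|a Ka]; first exact: K2_K2proj.
  by exists a => //; exact: K2proj_id.
- exact: K2proj_id.
- apply/seteqP; split=> a /= h.
    by have := lspan_rest a; rewrite h subr0.
  apply: (lspan_ker K2proj_lin) h => x [->|[i _ <-]]; [exact: K2proj1|exact: K2proj_d].
Qed.

(** [P] kills a - [K2proj] a, which lies in the prescribed kernel, and fixes [K2proj] a. *)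
Lemma gprojP_uniq P : gprojP u Dinv star eps P -> P = K2proj.
Proof.
move=> [Pl Pr Pi Pk]; apply/funext => a; rewrite -(Pi _ (K2_K2proj a)).
apply/eqP; rewrite -subr_eq0 -(linB Pl); apply/eqP.
by have := lspan_rest a; rewrite -Pk.
Qed.

Section FunctionalLinearity.
Variable psi : A -> C.
Hypothesis psil : scalar psi.

Lemma sc_K2proj a : psi 1 = 0 -> (forall i, psi (d i) = 0) -> psi (K2proj a) = psi a.
Proof.
move=> p1 pd; rewrite [a in RHS]K2projE [RHS](scD psil) [X in _ = X + _](scD psil) (scZ psil) p1.
rewrite mulr0 add0r (sc_sum psil) big1 ?add0r // => i _.
by rewrite (scZ psil) pd mulr0.
Qed.
End FunctionalLinearity.

(* d_i is -i (g_i - 1) modulo K_2, and the commutators of the g_i lie in K_4. *)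
Lemma K3_g_comm l m : K 3 ((g l - 1) * (g m - 1) - (g m - 1) * (g l - 1)).
Proof.
have -> : (g l - 1) * (g m - 1) - (g m - 1) * (g l - 1) = g l * g m - g m * g l.
  rewrite !mulrBl !mulrBr !mul1r !mulr1 !opprB.
  by rewrite (AC ((2*2)*(2*2)) ((1*8)*((2*5)*((3*6)*(4*7)))))/= !addNr subrr !addr0.
have E (j k : 'I_N) : (j < k)%N -> K 3 (u j j * u k k - u k k * u j j).
  move=> jk; have [_ _ _ h4] := qg_qmat Q; rewrite h4 // addrAC subrr sub0r.
  apply/gKN/gKZ/(gK2r (a := u j k)); first by apply: K2_u; rewrite neq_ltn jk.
  by rewrite (qg_eps_u Q) eq_sym; case: eqP jk => // ->; rewrite ltnn.
rewrite /gdiag; case: unlift => [j|]; case: unlift => [k|];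
  rewrite ?(qg_central Q) ?subrr; try exact: gK0.
case: (ltngtP j k) => [|kj|/val_inj ->]; first exact: E.
  by rewrite -opprB; apply/gKN/E.
by rewrite subrr; exact: gK0.
Qed.

Lemma K2_d i : K 2 (d i + 'i *: (g (lift ord0 i) - 1)).
Proof.
have := K2_K2proj (g (lift ord0 i)); set x := g _ => h.
suff -> : d i + 'i *: (x - 1) = 'i *: K2proj x by exact: gKZ.
rewrite /K2proj eps_g scale1r (bigD1 i) //= big1 => [|j ji]; last first.
  by rewrite e1_g angle_row_lift mxE (negbTE ji) andbF mulr0 scale0r.
rewrite e1_g angle_row_lift mxE !eqxx mulr1 addr0 (scalerBr 'i (x - 1)).
rewrite (scalerA 'i 'i) -expr2 sqrCi scaleN1r opprK; exact: addrC.
Qed.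

Lemma K3_d_comm i j : K 3 (d i * d j - d j * d i).
Proof.
pose x k := 'i *: (g (lift ord0 k) - 1).
have ex k : eps (x k) = 0 by rewrite /x (epsZ Q) (epsB Q) eps_g (qg_eps1 Q) subrr mulr0.
have h k l : K 3 (d k * d l - x k * x l).
  have -> : d k * d l - x k * x l = (d k + x k) * d l - x k * (d l + x l).
    by rewrite mulrDl mulrDr opprD addrA addrK.
  apply: gKB; first by apply: (gK2r (K2_d k)); exact: eps_d.
  by apply: gK2l (ex k) (K2_d l).
have E : K 3 (x i * x j - x j * x i).
  rewrite /x -!scalerAl -!scalerAr -!scalerBr; apply/gKZ/gKZ; exact: K3_g_comm.
have Z (a b c e : A) : a - b = (a - c) - (b - e) + (c - e).
  by rewrite opprB (AC (2*2*2) ((1*4)*((3*6)*(2*5))))/= addrN addNr !addr0.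
by rewrite (Z _ _ (x i * x j) (x j * x i)); apply: gKD => //; apply: gKB; exact: h.
Qed.

Lemma gaussian_eq0 (phi : A -> C) : scalar phi -> (forall a, K 3 a -> phi a = 0) ->
  phi 1 = 0 -> (forall i, phi (d i) = 0) -> (forall i j, phi (d i * d j) = 0) ->
  forall a, phi a = 0.
Proof.
move=> pl p3 p1 pd pdd a; rewrite -(sc_K2proj pl a p1 pd).
have := K2_K2proj a; move: (K2proj a) => {a}; apply: gK2_ind.
- exact: sc0.
- by move=> c a b ha hb; rewrite pl ha hb mulr0 addr0.
move=> a b ea eb.
have E x : eps x = 0 -> x = \sum_i e1 i x *: d i + K2proj x.
  by move=> e; rewrite {1}[x]K2projE e scale0r add0r.
rewrite {1}(E _ ea) mulrDl (scD pl) [X in _ + X]p3; last exact: (gK2r (K2_K2proj a)).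
rewrite addr0 (E _ eb) mulrDr (scD pl) [X in _ + X]p3; last first.
  rewrite mulr_suml; apply: gK_sum => i _; rewrite -scalerAl; apply: gKZ.
  exact: gK2l (eps_d i) (K2_K2proj b).
rewrite addr0 mulr_suml (sc_sum pl) big1 // => i _.
rewrite -scalerAl (scZ pl) mulr_sumr (sc_sum pl) big1 ?mulr0 // => j _.
by rewrite -scalerAr (scZ pl) pdd mulr0.
Qed.

Local Notation drift_t := (gdrift_term et).
Local Notation quad := (gquad et).

Lemma drift_lin r : scalar (drift_t r).
Proof.
move=> c a b; rewrite /gdrift_term mulr_sumr -big_split; apply: eq_bigr => j _ /=.
by rewrite e1_lin; move: (e1 j a) (e1 j b) => y z; ring.
Qed.

Lemma quad_lin M : scalar (quad M).
Proof.
move=> c a b; rewrite /gquad mulrCA -mulrDr; congr (_ * _).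
rewrite mulr_sumr -big_split; apply: eq_bigr => j _ /=.
rewrite mulr_sumr -big_split; apply: eq_bigr => k _ /=.
by rewrite e2_lin; move: (e2 j k a) (e2 j k b) => y z; ring.
Qed.

Lemma drift_K2 r a : K 2 a -> drift_t r a = 0.
Proof. by move=> Ka; rewrite /gdrift_term big1 // => j _; rewrite e1_K2 // mulr0. Qed.

Lemma drift_1 r : drift_t r 1 = 0.
Proof. by rewrite /gdrift_term big1 // => j _; rewrite e1_1 mulr0. Qed.

Lemma drift_d r i : drift_t r (d i) = (r 0 i)%:C%C.
Proof.
rewrite /gdrift_term (bigD1 i) //= e1_d eqxx mulr1 big1 ?addr0 // => j ji.
by rewrite e1_d (negbTE ji) mulr0.
Qed.

Lemma drift_star r a : drift_t r (star a) = (drift_t r a)^*.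
Proof.
rewrite /gdrift_term rmorph_sum; apply: eq_bigr => j _.
by rewrite e1_star rmorphM /= conjC_real.
Qed.

Lemma drift_gdrift r : gdrift star eps (drift_t r).
Proof.
split; last exact: drift_K2.
split; [exact: drift_lin|exact: drift_star|exact: drift_1|].
move=> b /(gK1P Q) eb; rewrite drift_K2 //; apply: gK2M => //.
by rewrite (eps_star Q) eb rmorph0.
Qed.

Lemma quad_K3 M a : K 3 a -> quad M a = 0.
Proof.
move=> Ka; rewrite /gquad big1 ?mulr0 // => j _; rewrite big1 // => k _.
by rewrite e2_K3 // mulr0.
Qed.

Lemma quad_1 M : quad M 1 = 0.
Proof.
by rewrite /gquad big1 ?mulr0 // => j _; rewrite big1 // => k _; rewrite e2_1 mulr0.
Qed.

Lemma quad_d M i : quad M (d i) = 0.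
Proof.
by rewrite /gquad big1 ?mulr0 // => j _; rewrite big1 // => k _; rewrite e2_d mulr0.
Qed.

Lemma quad_star M a : quad M (star a) = (quad M a)^*.
Proof.
rewrite /gquad rmorphM fmorphV rmorph_nat; congr (_ * _).
rewrite rmorph_sum; apply: eq_bigr => j _; rewrite rmorph_sum; apply: eq_bigr => k _.
by rewrite e2_star rmorphM /= conjC_real.
Qed.

Lemma quadM M a b : M^T = M -> eps a = 0 -> eps b = 0 ->
  quad M (a * b) = \sum_j \sum_k (M j k)%:C%C * (e1 j a * e1 k b).
Proof.
move=> MT ea eb; rewrite /gquad.
have -> : \sum_j \sum_k (M j k)%:C%C * e2 j k (a * b) =
    \sum_j \sum_k (M j k)%:C%C * (e1 j a * e1 k b) +
    \sum_j \sum_k (M j k)%:C%C * (e1 k a * e1 j b).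
  rewrite -big_split; apply: eq_bigr => j _; rewrite -big_split; apply: eq_bigr => k _ /=.
  by rewrite e2M ea eb mulr0 mul0r addr0 add0r mulrDr.
rewrite [X in _ + X]exchange_big /=.
set S := (X in X + _); set T := (X in _ + X); have -> : T = S.
  by apply: eq_bigr => j _; apply: eq_bigr => k _; rewrite -[in LHS]MT mxE.
by rewrite -mulr2n -[X in _ * X]mulr_natl mulKf ?pnatr_eq0.
Qed.

Lemma quad_dd M i j : M^T = M -> quad M (d i * d j) = (M i j)%:C%C.
Proof.
move=> MT; rewrite quadM ?eps_d // (bigD1 i) //= [X in _ + X]big1 => [|k ki].
  rewrite addr0 (bigD1 j) //= [X in _ + X]big1 => [|k kj]; last first.
    by rewrite [e1 k _]e1_d (negbTE kj) !mulr0.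
  by rewrite !e1_d !eqxx !mulr1 addr0.
by rewrite big1 // => l _; rewrite e1_d (negbTE ki) mul0r mulr0.
Qed.

(** For z = x + i y the mixed terms in [x] and [y] cancel by the symmetry of [M], and the values of
    the real form at [x] and at [y] remain. *)
Lemma psd_complex (M : 'M[R]_N) (z : 'I_N -> C) : psd M ->
  0 <= \sum_j \sum_k (M j k)%:C%C * ((z j)^* * z k).
Proof.
move=> [MT Mp].
pose x : 'rV[R]_N := \row_j complex.Re (z j); pose y : 'rV[R]_N := \row_j complex.Im (z j).
have qE (w v : 'rV[R]_N) : (w *m M *m v^T) 0 0 = \sum_j \sum_k M j k * (w 0 j * v 0 k).
  rewrite mxE exchange_big /=; apply: eq_bigr => k _; rewrite mxE mulr_suml.
  by apply: eq_bigr => j _; rewrite !mxE; ring.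
suff -> : \sum_j \sum_k (M j k)%:C%C * ((z j)^* * z k) =
    (((x *m M *m x^T) 0 0) + ((y *m M *m y^T) 0 0))%:C%C.
  by rewrite lecR addr_ge0.
have sym : \sum_j \sum_k M j k * (x 0 j * y 0 k) = \sum_j \sum_k M j k * (y 0 j * x 0 k).
  rewrite exchange_big /=; apply: eq_bigr => j _; apply: eq_bigr => k _.
  by rewrite -[in LHS]MT mxE [x _ _ * _]mulrC.
rewrite !qE.
have -> : \sum_j \sum_k (M j k)%:C%C * ((z j)^* * z k) =
  (\sum_j \sum_k M j k * (x 0 j * x 0 k) + \sum_j \sum_k M j k * (y 0 j * y 0 k))%:C%C +
  'i * (\sum_j \sum_k M j k * (x 0 j * y 0 k) - \sum_j \sum_k M j k * (y 0 j * x 0 k))%:C%C.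
  rewrite rmorphB rmorphD !rmorph_sum -sumrB mulr_sumr -!big_split.
  apply: eq_bigr => j _ /=; rewrite !rmorph_sum -sumrB mulr_sumr -!big_split.
  apply: eq_bigr => k _ /=; rewrite !mxE -complexiE.
  case: (z j) (z k) => [a b] [c e] /=; apply/eqP; rewrite eq_complex /=.
  by apply/andP; split; apply/eqP; ring.
by rewrite sym subrr mulr0 addr0.
Qed.

Lemma quad_ggaussian M : psd M -> ggaussian star eps (quad M).
Proof.
move=> pM; have MT := pM.1.
split; last exact: quad_K3.
split; [exact: quad_lin|exact: quad_star|exact: quad_1|].
move=> b /(gK1P Q) eb; rewrite quadM //; last by rewrite (eps_star Q) eb rmorph0.
under eq_bigr do under eq_bigr do rewrite e1_star.
exact: psd_complex.
Qed.

Lemma gGF_add psi phi : gGF star eps psi -> gGF star eps phi ->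
  gGF star eps (fun a => psi a + phi a).
Proof.
move=> [l1 s1 o1 p1] [l2 s2 o2 p2]; split.
- by move=> c a b; rewrite l1 l2; ring.
- by move=> b; rewrite s1 s2 rmorphD.
- by rewrite o1 o2 addr0.
- by move=> b Kb; rewrite addr_ge0 ?p1 ?p2.
Qed.

Lemma ggaussian_sum r M psi : psd M -> (forall a, psi a = drift_t r a + quad M a) ->
  ggaussian star eps psi.
Proof.
move=> pM /funext ->; split.
  apply: gGF_add; first exact: (drift_gdrift r).1.
  exact: (quad_ggaussian pM).1.
by move=> a Ka; rewrite quad_K3 // drift_K2 ?addr0 //; exact: gK32 Q _ Ka.
Qed.

(** The matrix is M_ij = psi(d_i d_j): symmetric because the commutators of the [d i] lie in K_3,
    then real because the [d i] are selfadjoint, and positive by testing [psi] on real combinations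
    of the [d i]. *)
Lemma ggaussian_ex psi : ggaussian star eps psi -> exists r M,
  psd M /\ forall a, psi a = drift_t r a + quad M a.
Proof.
move=> [[pl ps p1 pp] p3].
pose r : 'rV[R]_N := \row_i complex.Re (psi (d i)).
pose M : 'M[R]_N := \matrix_(i, j) complex.Re (psi (d i * d j)).
have reC (z : C) : z = z^* -> z = (complex.Re z)%:C%C.
  case: z => a b /eqP; rewrite eq_complex /= eqxx /= -addr_eq0 -mulr2n mulrn_eq0 /=.
  by move=> /eqP ->.
have hr i : psi (d i) = (r 0 i)%:C%C by rewrite mxE; apply: reC; rewrite -ps d_star.
have sym i j : psi (d i * d j) = psi (d j * d i).
  by apply/eqP; rewrite -subr_eq0 -(scB pl) p3 //; exact: K3_d_comm.
have hM i j : psi (d i * d j) = (M i j)%:C%C.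
  by rewrite mxE; apply: reC; rewrite -ps (qg_starM Q) !d_star sym.
have MT : M^T = M by apply/matrixP => i j; rewrite !mxE sym.
exists r, M; split.
  split=> // x; rewrite -lecR; set b := \sum_i (x 0 i)%:C%C *: d i.
  have Kb : K 1 b by apply: gK_sum => i _; apply/gKZ/(gK1P Q); exact: eps_d.
  suff -> : ((x *m M *m x^T) 0 0)%:C%C = psi (star b * b) by exact: pp.
  rewrite (gstar_sum Q) mulr_suml (sc_sum pl) mxE rmorph_sum.
  have -> : \sum_i psi (star ((x 0 i)%:C%C *: d i) * b) =
      \sum_i \sum_j (x 0 i)%:C%C * (x 0 j)%:C%C * (M i j)%:C%C.
    apply: eq_bigr => i _; rewrite mulr_sumr (sc_sum pl); apply: eq_bigr => j _.
    rewrite (gstarZ Q) conjC_real d_star -scalerAl -scalerAr (scZ pl) (scZ pl) hM.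
    exact: mulrA.
  rewrite exchange_big; apply: eq_bigr => j _ /=.
  rewrite mxE rmorphM rmorph_sum mulr_suml; apply: eq_bigr => i _ /=.
  rewrite !mxE rmorphM /=; ring.
move=> a; apply/eqP; rewrite -subr_eq0; apply/eqP.
apply: (gaussian_eq0 (phi := fun a => psi a - (drift_t r a + quad M a))).
- move=> c x y; rewrite pl drift_lin quad_lin.
  by move: (psi x) (psi y) (drift_t r x) (drift_t r y) (quad M x) (quad M y) => *; ring.
- by move=> x Kx; rewrite p3 // quad_K3 // drift_K2 ?addr0 ?subrr //; exact: gK32 Q _ Kx.
- by rewrite p1 drift_1 quad_1 addr0 subrr.
- by move=> i; rewrite hr drift_d quad_d addr0 subrr.
- move=> i j; rewrite hM drift_K2 ?quad_dd ?add0r ?subrr //.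
  by apply: gK2M; exact: eps_d.
Qed.

Lemma ggaussian_uniq r r' M M' : psd M -> psd M' ->
  (forall a, drift_t r a + quad M a = drift_t r' a + quad M' a) -> r = r' /\ M = M'.
Proof.
move=> [MT _] [MT' _] h; split.
  apply/rowP => i; have := h (d i); rewrite !drift_d !quad_d !addr0.
  by move=> /(congr1 (@complex.Re R)).
apply/matrixP => i j; have := h (d i * d j).
have K2d : K 2 (d i * d j) by apply: gK2M; exact: eps_d.
by rewrite !drift_K2 // !quad_dd // !add0r => /(congr1 (@complex.Re R)).
Qed.

Lemma quad_K2proj M a : quad M (K2proj a) = quad M a.
Proof. by apply: sc_K2proj; [exact: quad_lin|exact: quad_1|exact: quad_d]. Qed.

Lemma drift_K2proj r a : drift_t r (K2proj a) = 0.
Proof. by rewrite drift_K2 //; exact: K2_K2proj. Qed.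

Lemma quad_inj M M' : psd M -> psd M' -> (forall a, quad M a = quad M' a) -> M = M'.
Proof.
move=> pM pM' h; suff [_ ->] : (0 : 'rV[R]_N) = 0 /\ M = M' by [].
by apply: ggaussian_uniq => // a; rewrite h.
Qed.

End Derivatives.

(** * Levy-Khintchine decompositions *)

Definition tends_cont (R : realType) (H H' : hilbertType R[i]) (T : H -> H') :=
  forall x l, tends x l -> tends (fun n => T (x n)) (T l).

Definition seqdense (R : realType) (V : Type) (H : hilbertType R[i]) (j : V -> H) :=
  forall h, exists x : nat -> V, tends (fun n => j (x n)) h.

Lemma seqdenseP (R : realType) (V : Type) (H : hilbertType R[i]) (j : V -> H) :
  dense (range j) <-> seqdense j.
Proof.
split=> [/denseP d h|d].
  have [s [sj sh]] := d h.
  have /choice[x hx] : forall n, exists v, j v = s n.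
    by move=> n; have [v _ e] := sj n; exists v.
  by exists x; apply: eq_tends sh => n; rewrite hx.
apply/denseP => h; have [x hx] := d h.
by exists (fun n => j (x n)); split=> // n; exists (x n).
Qed.

Lemma seqdense_eq (R : realType) (V : Type) (H H' : hilbertType R[i]) (j : V -> H)
    (f g : H -> H') : seqdense j -> tends_cont f -> tends_cont g ->
  (forall v, f (j v) = g (j v)) -> f =1 g.
Proof.
move=> d fc gc e h; have [x hx] := d h.
by apply: tends_unique (fc _ _ hx) _; apply: eq_tends (gc _ _ hx) => n; rewrite e.
Qed.

Lemma seqdense_inner_eq (R : realType) (V : Type) (H : hilbertType R[i]) (j : V -> H)
    (x y : H) : seqdense j -> (forall v, inner (j v) x = inner (j v) y) -> x = y.
Proof.
move=> d e; apply: inner_ext => h; have [s hs] := d h.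
apply: tends_unique (tends_inner hs (tends_cst x)) _.
by apply: eq_tends (tends_inner hs (tends_cst y)) => n; rewrite e.
Qed.

Section GenericDecomposition.
Variables (C : numClosedFieldType) (A : algType C) (star : A -> A) (eps : A -> C).

Definition gcng (H : hilbertType C) (pi : A -> H -> H) :=
  forall S : set H, subspace_set S -> closed S ->
    (forall a x, S x -> S (pi a x)) ->
    (forall a x, gK eps 1 a -> S x -> pi a x = 0) ->
    S = [set 0].

Definition gcngf (psi : A -> C) :=
  gGF star eps psi /\
  exists (H : hilbertType C) (pi : A -> H -> H) (eta : A -> H),
    [/\ gtriple star eps pi eta psi, dense (range eta) & gcng pi].

Definition grestricts (H H' : hilbertType C) (pi : A -> H -> H) (S : set H)
    (j : H' -> H) (pi' : A -> H' -> H') :=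
  [/\ isometry j, range j = S & forall a x, j (pi' a x) = pi a (j x)].

Definition gLK (psi psiG psiL : A -> C) :=
  [/\ gGF star eps psiG, gGF star eps psiL,
      forall a, psi a = psiG a + psiL a
    & exists (H : hilbertType C) (pi : A -> H -> H) (eta : A -> H),
      [/\ gtriple star eps pi eta psi, dense (range eta)
        & exists (HG HN : hilbertType C) (jG : HG -> H) (jN : HN -> H)
            (piG : A -> HG -> HG) (piN : A -> HN -> HN)
            (etaG : A -> HG) (etaN : A -> HN),
          [/\ grestricts pi (ggauss eps pi) jG piG,
              grestricts pi (ortho (ggauss eps pi)) jN piN,
              forall a, eta a = jG (etaG a) + jN (etaN a),
              gtriple star eps piG etaG psiG
            & gtriple star eps piN etaN psiL]]].
End GenericDecomposition.

Section Decomposition.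
Variables (R : realType) (q : R[i]) (N : nat) (A : algType R[i]).
Variables (u : 'M[A]_N) (Dinv : A) (star : A -> A) (eps : A -> R[i]).
Hypothesis q01 : 0 < q < 1.
Hypothesis Q : qgroup q u Dinv star eps.
Local Notation C := R[i].
Local Notation K := (gK eps).

Definition ctr a := a - eps a *: 1.

Lemma ctr_lin : linear ctr.
Proof.
move=> c a b; rewrite /ctr (qg_eps Q) scalerDl -scalerA scalerBr opprD.
exact: addrACA.
Qed.

Lemma eps_ctr a : eps (ctr a) = 0. Proof. exact: (eps_center Q). Qed.

Lemma ctr_id a : eps a = 0 -> ctr a = a.
Proof. by move=> e; rewrite /ctr e scale0r subr0. Qed.

Lemma ctr1 : ctr 1 = 0.
Proof. by rewrite /ctr (qg_eps1 Q) scale1r subrr. Qed.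

Lemma ctrM a b : ctr (a * b) = a * ctr b + eps b *: ctr a.
Proof.
rewrite /ctr mulrBr -scalerAr mulr1 scalerBr (qg_epsM Q) scalerA (mulrC (eps b)).
by rewrite addrA subrK.
Qed.

Lemma eps_mul0 a b : eps b = 0 -> eps (a * b) = 0.
Proof. by move=> e; rewrite (qg_epsM Q) e mulr0. Qed.

Lemma eps_star0 a : eps a = 0 -> eps (star a) = 0.
Proof. by move=> e; rewrite (eps_star Q) e rmorph0. Qed.

Section Functional.
Variable psi : A -> C.
Hypothesis psil : scalar psi.
(** The right side of the identity in a triple is [psi] on a product of centred elements, so the
    identity can be checked on the kernel of the counit alone. *)
Lemma fn_ctr a b : psi 1 = 0 -> psi (star (ctr a) * ctr b) =
  psi (star a * b) - psi (star a) * eps b - eps (star a) * psi b.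
Proof.
move=> p1; rewrite /ctr (gstarB Q) (gstarZ Q) (gstar1 Q) -(eps_star Q).
rewrite mulrBl !mulrBr -!scalerAl -!scalerAr mul1r !mulr1.
rewrite !(scB psil) !(scZ psil) p1 !mulr0 subr0; congr (_ - _ - _); exact: mulrC.
Qed.

End Functional.

Lemma K2_eq (psi phi : A -> C) : scalar psi -> scalar phi ->
  (forall a b, eps a = 0 -> eps b = 0 -> psi (star a * b) = phi (star a * b)) ->
  forall a, K 2 a -> psi a = phi a.
Proof.
move=> pl fl h; apply: gK2_ind => [|c a b ha hb|a b ea eb].
- by rewrite (sc0 pl) (sc0 fl).
- by rewrite pl fl ha hb.
- by rewrite -[a](qg_starK Q); apply: h => //; exact: eps_star0.
Qed.

Lemma gtripleP (H : hilbertType C) (pi : A -> H -> H) (eta : A -> H) psi :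
  gsrep star pi -> gcocycle eps pi eta -> scalar psi -> psi 1 = 0 ->
  (forall a b, eps a = 0 -> eps b = 0 -> inner (eta a) (eta b) = psi (star a * b)) ->
  gtriple star eps pi eta psi.
Proof.
move=> ps ec pl p1 h; split=> // a b.
rewrite -(eta_center Q ps ec a) -(eta_center Q ps ec b) -/(ctr a) -/(ctr b).
by rewrite h ?eps_ctr // fn_ctr.
Qed.

Lemma gtriple_K1 (H : hilbertType C) (pi : A -> H -> H) (eta : A -> H) psi a b :
  gtriple star eps pi eta psi -> eps a = 0 -> eps b = 0 ->
  inner (eta a) (eta b) = psi (star a * b).
Proof.
move=> [_ _ _ h] ea eb.
by rewrite h eb (eps_star0 ea) mulr0 mul0r !subr0.
Qed.

(** * The triple of a generating functional *)

Section GNS.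
Variable psi : A -> C.
Hypothesis psiG : gGF star eps psi.
Let pl : scalar psi. Proof. by case: psiG. Qed.
Let ph b : psi (star b) = (psi b)^*. Proof. by case: psiG. Qed.
Let p1 : psi 1 = 0. Proof. by case: psiG. Qed.
Let pp b : eps b = 0 -> 0 <= psi (star b * b).
Proof. by case: psiG => _ _ _ h e; apply: h; apply/(gK1P Q). Qed.

(** Centring extends the form from the kernel of the counit to the whole algebra, with 1 as a null
    vector; the map into the completion is then the cocycle itself. *)
Let form x y := psi (star (ctr x) * ctr y).

Let form_psd : psd_form form.
Proof.
split=> [x c y z|x y|x].
- by rewrite /form ctr_lin mulrDr -scalerAr pl.
- by rewrite /form -ph (qg_starM Q) (qg_starK Q).
- by apply: pp; exact: eps_ctr.
Qed.

Lemma gns : exists (H : hilbertType C) (pi : A -> H -> H) (eta : A -> H),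
  gtriple star eps pi eta psi /\ dense (range eta).
Proof.
have [H [j [jl jf jd]]] := prehilbert_completion form_psd.
have jK x y : eps x = 0 -> eps y = 0 -> inner (j x) (j y) = psi (star x * y).
  by move=> ex ey; rewrite jf /form !ctr_id.
have j1 : j 1 = 0.
  by apply: inner_eq0; rewrite jf /form ctr1 mulr0 (sc0 pl).
have jc x : j (ctr x) = j x by rewrite /ctr (linB jl) (linZ jl) j1 scaler0 subr0.
(* Boundedness of left multiplication passes to linear combinations and products; the generators are
   contractive. *)
pose bd a := exists2 M : C, 0 <= M & forall x, `|j (a * ctr x)| <= M * `|j x|.
have contr a : (forall y, eps y = 0 -> psi (star (a * y) * (a * y)) <= psi (star y * y)) -> bd a.
  move=> h; exists 1 => [|x]; first exact: ler01.
  rewrite mul1r -(@ler_pXn2r _ 2) ?nnegrE // -!inner_norm -(jc x).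
  by rewrite !jK ?eps_ctr ?eps_mul0 ?eps_ctr // h ?eps_ctr.
have bdA a : bd a.
  apply: (qg_ind Q (P := bd)) a => [|c a b [M M0 hM] [M' M0' hM']|a b [M M0 hM] [M' M0' hM']|i k|].
  - by apply: contr => y _; rewrite !mul1r.
  - exists (`|c| * M + M') => [|x]; first by rewrite addr_ge0 ?mulr_ge0.
    rewrite mulrDl -scalerAl jl (le_trans (ler_normD _ _)) // mulrDl lerD //.
    by rewrite normrZ -mulrA ler_wpM2l.
  - exists (M * M') => [|x]; first by rewrite mulr_ge0.
    have e : eps (b * ctr x) = 0 by rewrite eps_mul0 ?eps_ctr.
    by rewrite -(mulrA a) -(ctr_id e) (le_trans (hM _)) // -(mulrA M) ler_wpM2l.
  - apply: contr => y ey.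
    (* The column relation writes psi(star y y) as a sum of nonnegative terms, one of which belongs
       to u_ik. *)
    have E : psi (star y * y) = \sum_m psi (star (u m k * y) * (u m k * y)).
      rewrite -(sc_sum pl); congr psi.
      transitivity (star y * (\sum_m star (u m k) * u m k) * y).
        by rewrite (qg_col Q) eqxx mulr1.
      rewrite mulr_sumr mulr_suml; apply: eq_bigr => m _.
      by rewrite (qg_starM Q) !mulrA.
    rewrite E (bigD1 i) //= lerDl; apply: sumr_ge0 => m _.
    by apply: pp; exact: eps_mul0.
  - apply: contr => y ey.
    by rewrite (qg_starM Q) mulrA -(mulrA _ (star Dinv)) (qg_Dr Q) mulr1.
have /choice[pi hpi] : forall a, exists T : H -> H, [/\ linear T,
    exists M, forall h, `|T h| <= M * `|h| & forall x, T (j x) = j (a * ctr x)].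
  move=> a; have [M _ hM] := bdA a.
  have l0 : linear (fun x => j (a * ctr x)).
    by move=> c x y; rewrite ctr_lin mulrDr -scalerAr jl.
  have [T [Tl Tb Te]] := dense_extension jl l0 hM jd.
  by exists T; split=> //; exists M.
have pil a : linear (pi a) by case: (hpi a).
have pit a : tends_cont (pi a).
  by case: (hpi a) => l [M b] _; exact: linear_bounded_tends b.
have pie a x : pi a (j x) = j (a * ctr x) by case: (hpi a).
have pisr : gsrep star pi.
  split.
  - split=> [a|a]; first exact: pil.
    by case: (hpi a) => l [M b] _; exact: linear_bounded_cont b.
  - move=> c a b; apply: (seqdense_eq jd (pit _)) => [x l xl|v].
      by apply: tendsD; [apply: tendsZ|]; exact: pit.
    by rewrite !pie mulrDl -scalerAl jl.
  - apply: (seqdense_eq jd (pit _)) => [x l //|v].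
    by rewrite pie mul1r jc.
  - move=> a b; apply: (seqdense_eq jd (pit _)) => [x l xl|v].
      by apply: (pit); exact: pit.
    by rewrite !pie (ctr_id (eps_mul0 b (eps_ctr v))) mulrA.
  - move=> a x y; have [s hs] := jd x; have [t ht] := jd y.
    apply: tends_unique (tends_inner (pit (star a) _ _ hs) ht) _.
    apply: eq_tends (tends_inner hs (pit a _ _ ht)) => n.
    rewrite !pie -(jc (s n)) -(jc (t n)) !jK ?eps_mul0 ?eps_ctr //.
    by rewrite (qg_starM Q) (qg_starK Q) mulrA.
have ec : gcocycle eps pi j.
  split=> // a b; rewrite pie -[LHS]jc ctrM (linD jl) (linZ jl).
  by rewrite jc.
exists H, pi, j; split; last exact/seqdenseP.
apply: gtripleP => //; exact: jK.
Qed.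
End GNS.

Lemma pi_bounded (H : hilbertType C) (pi : A -> H -> H) : gsrep star pi ->
  forall a, exists2 M : C, 0 <= M & forall x, `|pi a x| <= M * `|x|.
Proof.
move=> pis a; pose bd a := exists2 M : C, 0 <= M & forall x, `|pi a x| <= M * `|x|.
apply: (qg_ind Q (P := bd)) a => [|c a b [M M0 hM] [M' M0' hM']|a b [M M0 hM] [M' M0' hM']|i k|].
- by exists 1 => [|x]; rewrite ?ler01 // (pi1 pis) mul1r.
- exists (`|c| * M + M') => [|x]; first by rewrite addr_ge0 ?mulr_ge0.
  rewrite (piA pis) (le_trans (ler_normD _ _)) // mulrDl lerD //.
  by rewrite normrZ -mulrA ler_wpM2l.
- exists (M * M') => [|x]; first by rewrite mulr_ge0.
  by rewrite (piM pis) (le_trans (hM _)) // -mulrA ler_wpM2l.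
- by exists 1 => [|x]; rewrite ?ler01 // mul1r; exact: (pi_u_le Q pis).
- exists 1 => [|x]; rewrite ?ler01 // mul1r -(@ler_pXn2r _ 2) ?nnegrE //.
  by rewrite -!inner_norm -(pi_adj pis) -(piM pis) (qg_Dr Q) (pi1 pis).
Qed.

Section Restriction.
Variables (H : hilbertType C) (pi : A -> H -> H) (S : set H).
Hypotheses (pis : gsrep star pi) (Ssub : subspace_set S) (Scl : seq_closed S).
Hypothesis Sinv : forall a x, S x -> S (pi a x).

Lemma restriction : exists (H' : hilbertType C) (j : H' -> H) (pi' : A -> H' -> H'),
  grestricts pi S j pi' /\ gsrep star pi'.
Proof.
have [H' [j [ji jr]]] := subspace_hilbert Ssub Scl.
have jS x : S (j x) by rewrite -jr; exists x.
have ex a x : exists y, j y = pi a (j x).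
  by have := Sinv a (jS x); rewrite -jr => -[y _ <-]; exists y.
pose pi' a x := xget 0 [set y | j y = pi a (j x)].
have pe a x : j (pi' a x) = pi a (j x).
  by have [y hy] := ex a x; exact: (xgetI _ (hy : [set y | j y = pi a (j x)] y)).
have jinj := isometry_inj ji; have [jl jin] := ji.
have pl a : linear (pi' a).
  by move=> c x y; apply: jinj; rewrite pe !jl !pe (piL pis).
exists H', j, pi'; split; first by split.
split.
- split=> // a; have [M _ hM] := pi_bounded pis a.
  apply: (linear_bounded_cont (M := M) (pl a)) => x.
  by rewrite -!(isometry_norm ji) pe.
- by move=> c a b x; apply: jinj; rewrite jl !pe (piA pis).
- by move=> x; apply: jinj; rewrite pe (pi1 pis).
- by move=> a b x; apply: jinj; rewrite !pe (piM pis).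
- by move=> a x y; rewrite -!jin !pe (pi_adj pis).
Qed.

Lemma cocycle_restrict (H' : hilbertType C) (j : H' -> H) (pi' : A -> H' -> H')
    (eta : A -> H) : grestricts pi S j pi' -> gcocycle eps pi eta ->
  (forall a, S (eta a)) -> exists eta', (forall a, j (eta' a) = eta a) /\ gcocycle eps pi' eta'.
Proof.
move=> [ji jr pe] [el em] eS; have jinj := isometry_inj ji; have [jl jin] := ji.
have /choice[eta' he] : forall a, exists y, j y = eta a.
  by move=> a; have := eS a; rewrite -jr => -[y _ <-]; exists y.
exists eta'; split=> //; split=> [c a b|a b]; apply: jinj.
  by rewrite jl !he el.
by rewrite addrC jl !he pe he em addrC.
Qed.
End Restriction.

(** * Splitting off the gaussian part of a triple *)

Section Splitting.
Variables (H : hilbertType C) (pi : A -> H -> H) (eta : A -> H) (psi : A -> C).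
Hypothesis pis : gsrep star pi.
Hypothesis etac : gcocycle eps pi eta.
Local Notation G := (ggauss eps pi).
Local Notation PG := (proj_on G).
Let Gsub := ggauss_subspace eps pis.
Let Gcl := ggauss_closed (eps := eps) pis.

Lemma ggauss_inv a x : G x -> G (pi a x).
Proof.
move=> Gx; rewrite (pi_ggauss Q pis) //.
by rewrite -[_ *: _]addr0; apply: Gsub.2 => //; exact: Gsub.1.
Qed.

Lemma ortho_inv a x : ortho G x -> ortho G (pi a x).
Proof. by move=> ox y Gy; rewrite -(pi_adj pis); apply: ox; exact: ggauss_inv. Qed.

Lemma proj_pi a x : PG (pi a x) = pi a (PG x).
Proof.
apply: (proj_on_uniq Gsub Gcl).
  by apply: ggauss_inv; exact: proj_on_in.
move=> y Gy; rewrite -(pivB pis) -(pi_adj pis); apply: (proj_on_ortho Gsub Gcl).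
exact: ggauss_inv.
Qed.

Let PL := proj_on_linear Gsub Gcl.

Lemma etaG_cocycle : gcocycle eps pi (fun a => PG (eta a)).
Proof.
split=> [c a b|a b]; first by rewrite (etaL etac) PL.
by rewrite (etaM etac) (linD PL) (linZ PL) proj_pi.
Qed.

Definition etaNG a := eta a - PG (eta a).

Lemma etaNG_cocycle : gcocycle eps pi etaNG.
Proof.
have [l m] := etaG_cocycle; split=> [c a b|a b]; rewrite /etaNG.
  by rewrite l (etaL etac) scalerBr opprD addrACA.
by rewrite m (etaM etac) (pivB pis) scalerBr opprD addrACA.
Qed.

Lemma etaNG_ortho a : ortho G (etaNG a).
Proof. exact: proj_on_compl. Qed.

Lemma inner_split a b : inner (eta a) (eta b) =
  inner (PG (eta a)) (PG (eta b)) + inner (etaNG a) (etaNG b).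
Proof.
have o : inner (PG (eta a)) (etaNG b) = 0.
  by apply: (proj_on_ortho Gsub Gcl); exact: proj_on_in.
have o' : inner (etaNG a) (PG (eta b)) = 0.
  by rewrite innerC (proj_on_ortho Gsub Gcl) ?rmorph0 //; exact: proj_on_in.
have E c : eta c = PG (eta c) + etaNG c by rewrite /etaNG addrC subrK.
rewrite {1}(E a) {1}(E b).
move: (PG (eta a)) (PG (eta b)) (etaNG a) (etaNG b) o o' => x y z w o o'.
by rewrite innerDl !innerDr o o' addr0 add0r.
Qed.

End Splitting.

Variable P : A -> A.
Hypothesis Pl : linear P.
Hypothesis PK : forall a, K 2 (P a).
Hypothesis Pid : forall a, K 2 a -> P a = a.
Hypothesis Pstar : forall a, P (star a) = star (P a).
Hypothesis P1 : P 1 = 0.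

Section Existence.
Variables (H : hilbertType C) (pi : A -> H -> H) (eta : A -> H) (psi : A -> C).
Hypothesis psiG : gGF star eps psi.
Hypothesis T : gtriple star eps pi eta psi.
Local Notation G := (ggauss eps pi).
Local Notation PG := (proj_on G).
Let pis : gsrep star pi. Proof. by case: T. Qed.
Let etac : gcocycle eps pi eta. Proof. by case: T. Qed.

(** Only inner products of the convergent sequences pi(a) f_n enter, with a in the kernel of the
    counit, so the limits exist on K_2 whatever f_n itself does. [P] supplies the hermitian
    extension to the whole algebra. *)
Lemma levy_part : exists psiL : A -> C, [/\ gGF star eps psiL,
  (forall a, psiL (P a) = psiL a)
  & forall a b, eps a = 0 -> eps b = 0 ->
      psiL (star a * b) = inner (etaNG pi eta a) (etaNG pi eta b)].
Proof.
have [f hf] := cocycle_approx q01 Q pis etac.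
have hf0 a : eps a = 0 -> tends (fun n => pi a (f n)) (etaNG pi eta a).
  by move=> ea; apply: eq_tends (hf a) => n; rewrite ea scale0r subr0.
have lim2 a b : eps a = 0 -> eps b = 0 ->
    tends (fun n => inner (f n) (pi (star a * b) (f n)))
      (inner (etaNG pi eta a) (etaNG pi eta b)).
  move=> ea eb; apply: eq_tends (tends_inner (hf0 a ea) (hf0 b eb)) => n.
  by rewrite (piM pis) (pi_adj' Q pis).
have limK a : K 2 a -> exists l, tends (fun n => inner (f n) (pi a (f n))) l.
  move: a; apply: gK2_ind => [|c a b [l hl] [m hm]|a b ea eb].
  - by exists 0; apply: eq_tends (tends_cst 0) => n; rewrite (pi0 pis) inner0r.
  - exists (c * l + m); apply: eq_tends (tendsD (tendsM (tends_cst c) hl) hm) => n.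
    by rewrite (piA pis) innerDr innerZr.
  - have := lim2 (star a) b (eps_star0 ea) eb; rewrite (qg_starK Q) => h.
    by eexists; exact: h.
have /choice[psiL hL] : forall a, exists l, tends (fun n => inner (f n) (pi (P a) (f n))) l.
  by move=> a; exact: limK.
have LK a b : eps a = 0 -> eps b = 0 ->
    psiL (star a * b) = inner (etaNG pi eta a) (etaNG pi eta b).
  move=> ea eb; apply: tends_unique (hL _) _.
  by rewrite Pid; [exact: lim2|apply: gK2M => //; exact: eps_star0].
exists psiL; split=> //; last first.
  by move=> a; apply: tends_unique (hL _) _; rewrite Pid.
split.
- move=> c a b; apply: tends_unique (hL _) _.
  apply: eq_tends (tendsD (tendsM (tends_cst c) (hL a)) (hL b)) => n.
  by rewrite Pl (piA pis) innerDr innerZr.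
- move=> b; apply: tends_unique (hL _) _.
  apply: eq_tends (tends_conj (hL b)) => n.
  by rewrite Pstar (pi_adj' Q pis) [RHS]innerC.
- apply: tends_unique (hL _) _.
  by apply: eq_tends (tends_cst 0) => n; rewrite P1 (pi0 pis) inner0r.
- move=> b /(gK1P Q) eb; rewrite LK // inner_norm.
  exact: exprn_ge0.
Qed.

Hypothesis cyc : dense (range eta).

(** The difference of [psi] and [psiL] is a generating functional, because on star b b it is the
    squared norm of the gaussian part of eta(b), by orthogonality of the two parts. *)
Lemma gLK_exists : exists psiG psiL : A -> C, [/\ gLK star eps psi psiG psiL,
  (forall a, psiL (P a) = psiL a)
  & forall a b, eps a = 0 -> eps b = 0 ->
      psiL (star a * b) = inner (etaNG pi eta a) (etaNG pi eta b)].
Proof.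
have [psiL [LG LP LK]] := levy_part.
have [pl ph p1 pp] := psiG; have [Ll Lh L1 Lp] := LG.
pose psi' a := psi a - psiL a.
have l' : scalar psi'.
  move=> c a b; rewrite /psi' pl Ll; move: (psi a) (psi b) (psiL a) (psiL b) => *; ring.
have K' a b : eps a = 0 -> eps b = 0 ->
    inner (PG (eta a)) (PG (eta b)) = psi' (star a * b).
  move=> ea eb; rewrite /psi' LK // -(gtriple_K1 T ea eb) (inner_split eta pis).
  by rewrite addrK.
have G' : gGF star eps psi'.
  split=> //; first by move=> b; rewrite /psi' ph Lh rmorphB.
    by rewrite /psi' p1 L1 subrr.
  move=> b /(gK1P Q) eb; rewrite -K' // inner_norm; exact: exprn_ge0.
exists psi', psiL; split=> //; split=> //; first by move=> a; rewrite /psi' subrK.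
exists H, pi, eta; split=> //.
have [HG [jG [piG [rG pGs]]]] := restriction pis (ggauss_subspace eps pis)
  (ggauss_closed (eps := eps) pis) (ggauss_inv pis).
have [HN [jN [piN [rN pNs]]]] := restriction pis (ortho_subspace G)
  (@ortho_seq_closed _ _ G) (ortho_inv pis).
have [etaG [eG cG]] := cocycle_restrict rG (etaG_cocycle pis etac)
  (fun a => proj_on_in (ggauss_subspace eps pis) (ggauss_closed (eps := eps) pis) (eta a)).
have [etaN [eN cN]] := cocycle_restrict rN (etaNG_cocycle pis etac)
  (etaNG_ortho eta pis).
have [[_ iG] _ _] := rG; have [[_ iN] _ _] := rN.
exists HG, HN, jG, jN, piG, piN, etaG, etaN; split=> //.
- by move=> a; rewrite eG eN /etaNG addrC subrK.
- apply: gtripleP => //; first by have [] := G'.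
  by move=> a b ea eb; rewrite -iG !eG K'.
- by apply: gtripleP => // a b ea eb; rewrite -iN !eN LK.
Qed.
End Existence.

(** The gaussian vectors form the largest subspace on which [pi] is gaussian, so only this subspace
    has to be tested. *)
Lemma gcngP (H : hilbertType C) (pi : A -> H -> H) : gsrep star pi ->
  gcng eps pi <-> forall x, ggauss eps pi x -> x = 0.
Proof.
move=> pis; split=> [h x Gx|h S [S0 _] _ _ hS].
  have e := h _ (ggauss_subspace eps pis) (seq_closed_closed (ggauss_closed (eps := eps) pis))
    (ggauss_inv pis) (fun a x Ka Gx => Gx a Ka).
  by move: Gx; rewrite e.
apply/seteqP; split=> x /=; last by move=> ->.
by move=> Sx; apply: h => a Ka; exact: hS.
Qed.

Lemma etaNG_cng (H : hilbertType C) (pi : A -> H -> H) (eta : A -> H) a :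
  gsrep star pi -> gcng eps pi -> etaNG pi eta a = eta a.
Proof.
move=> pis /(gcngP pis) h; rewrite /etaNG (h (proj_on _ _)) ?subr0 //.
exact: (proj_on_in (ggauss_subspace eps pis) (ggauss_closed (eps := eps) pis)).
Qed.

Section Consequences.
Variables psi psiG psiL : A -> C.
Hypothesis D : gLK star eps psi psiG psiL.

(** For a, b, c in the kernel of the counit, psi_G(a b c) = <eta_G(star a), pi_G(b) eta_G(c)>, and
    pi_G(b) = 0. *)
Lemma gLK_gaussian : ggaussian star eps psiG.
Proof.
have [G _ _ [H [pi [eta [[pis _ _ _] _ [HG [HN [jG [jN [piG [piN [etaG [etaN
  [rG rN e TG TN]]]]]]]]]]]]]] := D.
split=> //; have [ji jr pe] := rG; have [pGs [_ em] pl _] := TG.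
have z a x : eps a = 0 -> piG a x = 0.
  move=> ea; apply: (isometry_inj ji); rewrite pe (lin0 ji.1).
  have Gj : ggauss eps pi (jG x) by rewrite -jr; exists x.
  by apply: Gj; apply/(gK1P Q).
apply: gK3_ind => [|c a b ha hb|a b c ea eb ec].
- exact: (sc0 pl).
- by rewrite pl ha hb mulr0 addr0.
- rewrite -mulrA -[a](qg_starK Q) -(gtriple_K1 TG) ?eps_star0 ?eps_mul0 //.
  by rewrite em ec scale0r addr0 z // inner0r.
Qed.

(** The range of [etaN] is dense as the orthogonal projection of the dense range of [eta]. A
    gaussian vector of [piN] is gaussian for [pi] and orthogonal to all such vectors, hence 0. *)
Lemma gLK_cng : gcngf star eps psiL.
Proof.
have [_ L _ [H [pi [eta [[pis _ _ _] cyc [HG [HN [jG [jN [piG [piN [etaG [etaN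
  [rG rN e TG TN]]]]]]]]]]]]]] := D.
split=> //; exists HN, piN, etaN; have [pNs _ _ _] := TN.
have [ji jr pe] := rN; have [_ jGr _] := rG.
have Gsub := ggauss_subspace eps pis; have Gcl := ggauss_closed (eps := eps) pis.
split=> //.
  apply/seqdenseP => x; have /seqdenseP/(_ (jN x))[s hs] := cyc.
  exists s; apply: tends_dom hs (_ : forall n, _ <= 1 * _) => n.
  rewrite mul1r -(isometry_norm ji) (linB ji.1).
  have o : ortho (ggauss eps pi) (jN (etaN (s n)) - jN x).
    by rewrite -(linB ji.1) -jr; eexists.
  have g : ggauss eps pi (jG (etaG (s n))) by rewrite -jGr; eexists.
  rewrite e -addrA.
  move: (jG (etaG (s n))) (jN (etaN (s n)) - jN x) g o => y z Gy o.
  have o' : inner z y = 0 by rewrite innerC (o _ Gy) rmorph0.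
  rewrite -(@ler_pXn2r _ 2) ?nnegrE // -!inner_norm innerDl !innerDr (o _ Gy) o'.
  by rewrite addr0 add0r lerDr inner_norm exprn_ge0.
apply/(gcngP pNs) => x Gx; apply: (isometry_inj ji); rewrite (lin0 ji.1).
have o : ortho (ggauss eps pi) (jN x) by rewrite -jr; eexists.
apply: inner_eq0; apply: o => a Ka.
by rewrite -pe Gx // (lin0 ji.1).
Qed.

(** The triple inside the decomposition and the given one are both cyclic for [psi], so a unitary
    relates them. It intertwines the representations, respects the gaussian subspaces and therefore
    matches the non-gaussian parts of the cocycles. Thus [psi] determines [psiL] on K_2. *)
Lemma gLK_K1 (H : hilbertType C) (pi : A -> H -> H) (eta : A -> H) a b :
  gtriple star eps pi eta psi -> dense (range eta) -> eps a = 0 -> eps b = 0 ->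
  psiL (star a * b) = inner (etaNG pi eta a) (etaNG pi eta b).
Proof.
move=> T cyc ea eb.
have [_ _ _ [H1 [pi1 [eta1 [T1 cyc1 [HG [HN [jG [jN [piG [piN [etaG [etaN
  [rG rN e TG TN]]]]]]]]]]]]]] := D.
have [pis ec _ hin] := T; have [pis1 ec1 _ hin1] := T1.
have [V [[[Vl Vi] Vr] Ve]] := gram_unitary (etaL ec1) (etaL ec)
  (fun x y => etrans (hin1 x y) (esym (hin x y))) cyc1 cyc.
have Vpi c x : V (pi1 c x) = pi c (V x).
  have Vt : tends_cont V by apply: isometry_tends.
  have /seqdenseP sd := cyc1.
  move: x; apply: (seqdense_eq sd) => [x l xl|x l xl|y].
  - by apply: Vt; exact: (pi_tends pis1).
  - by apply: (pi_tends pis); exact: Vt.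
  - have -> : pi1 c (eta1 y) = eta1 (c * y) - eps y *: eta1 c by rewrite (etaM ec1) addrK.
    by rewrite (linB Vl) (linZ Vl) !Ve (etaM ec) addrK.
have VG x : ggauss eps pi1 x <-> ggauss eps pi (V x).
  split=> h c Kc; first by rewrite -Vpi h // (lin0 Vl).
  by apply: (isometry_inj (conj Vl Vi)); rewrite Vpi h // (lin0 Vl).
have VP x : V (proj_on (ggauss eps pi1) x) = proj_on (ggauss eps pi) (V x).
  apply/esym/(proj_on_uniq (ggauss_subspace eps pis) (ggauss_closed (eps := eps) pis)).
    by apply/VG; exact: (proj_on_in (ggauss_subspace eps pis1) (ggauss_closed (eps := eps) pis1)).
  move=> y; have [z _ <-] : range V y by rewrite Vr.
  move=> /VG Gz; rewrite -(linB Vl) Vi.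
  exact: (proj_on_ortho (ggauss_subspace eps pis1) (ggauss_closed (eps := eps) pis1)).
have eN c : jN (etaN c) = etaNG pi1 eta1 c.
  rewrite /etaNG; have -> : proj_on (ggauss eps pi1) (eta1 c) = jG (etaG c).
    apply: (proj_on_uniq (ggauss_subspace eps pis1) (ggauss_closed (eps := eps) pis1)).
      by have [_ <- _] := rG; eexists.
    move=> y Gy; rewrite e (addrC (jG _)) addrK.
    have o : ortho (ggauss eps pi1) (jN (etaN c)) by have [_ <- _] := rN; eexists.
    exact: o.
  by rewrite e addrC addKr.
have VN c : V (etaNG pi1 eta1 c) = etaNG pi eta c.
  by rewrite /etaNG (linB Vl) VP Ve.
have [[_ iN] _ _] := rN.
by rewrite -!VN Vi -!eN iN (gtriple_K1 TN).
Qed.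
End Consequences.

Lemma gLK_uniq psi psiG psiL psiG' psiL' : gLK star eps psi psiG psiL ->
  gLK star eps psi psiG' psiL' -> (forall a, psiL (P a) = psiL a) ->
  (forall a, psiL' (P a) = psiL' a) -> psiG' = psiG /\ psiL' = psiL.
Proof.
move=> D D' LP LP'.
have [_ _ e [H [pi [eta [T cyc _]]]]] := D; have [_ _ e' _] := D'.
have [_ [l _ _ _] _ _] := D; have [_ [l' _ _ _] _ _] := D'.
have eL : psiL' = psiL.
  apply/funext => a; rewrite -LP -LP'; apply: (K2_eq l' l) (PK a) => x y ex ey.
  by rewrite (gLK_K1 D T cyc ex ey) (gLK_K1 D' T cyc ex ey).
split=> //; apply/funext => a; apply: (addIr (psiL a)).
by rewrite -e -eL -e'.
Qed.

Lemma gLK_ex psi : gGF star eps psi ->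
  exists psiG psiL, gLK star eps psi psiG psiL /\ forall a, psiL (P a) = psiL a.
Proof.
move=> G; have [H [pi [eta [T cyc]]]] := gns G.
by have [pG [pL [D LP _]]] := gLK_exists G T cyc; exists pG, pL.
Qed.

(** For [psi] vanishing on K_3 the cocycle has gaussian values, so [psiL] vanishes on K_2 and, being
    invariant under [P], everywhere. *)
Lemma gaussian_gLK psi : ggaussian star eps psi ->
  exists psiL, gLK star eps psi psi psiL /\ forall a, psiL (P a) = psiL a.
Proof.
move=> [G p3]; have [H [pi [eta [T cyc]]]] := gns G.
have [pG [pL [D LP LK]]] := gLK_exists G T cyc; exists pL; split=> //.
suff e : pG = psi by rewrite -{2}e.
have [_ [Ll _ _ _] e _] := D.
suff z a : pL a = 0 by apply/funext => a; rewrite e z addr0.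
have [pis ec _ _] := T.
(* Tested against eta(v), the vector pi(c) eta(b) gives [psi] on an element of K_3. *)
have pz c b : eps c = 0 -> pi c (eta b) = 0.
  move=> ea; rewrite -(eta_center Q pis ec b) -/(ctr b) -(etaK ec) ?eps_ctr //.
  have /seqdenseP sd := cyc; apply: (seqdense_inner_eq sd) => v.
  rewrite inner0r -(eta_center Q pis ec v) -/(ctr v).
  rewrite (gtriple_K1 T) ?eps_ctr ?eps_mul0 ?eps_ctr // mulrA p3 //.
  by apply: gK3M; rewrite // ?eps_star0 ?eps_ctr.
have Ga b : ggauss eps pi (eta b) by move=> c /(gK1P Q); exact: pz.
rewrite -LP; apply: (K2_eq Ll (phi := fun=> 0)) (PK a) => [c x y|x y ex ey].
  by rewrite mulr0 addr0.
rewrite LK // /etaNG.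
by rewrite (proj_on_id (ggauss_subspace eps pis) (ggauss_closed (eps := eps) pis)) // subrr inner0l.
Qed.

Lemma cng_gLK psi : gcngf star eps psi -> (forall a, psi (P a) = psi a) ->
  exists psiG, gLK star eps psi psiG psi.
Proof.
move=> [G [H [pi [eta [T cyc cn]]]]] pP.
have [pG [pL [D LP LK]]] := gLK_exists G T cyc; exists pG.
suff e : pL = psi by rewrite -{2}e.
have [_ [Ll _ _ _] _ _] := D; have [pl _ _ _] := G; have [pis _ _ _] := T.
apply/funext => a; rewrite -LP -pP; apply: (K2_eq Ll pl) (PK a) => x y ex ey.
by rewrite LK // !(etaNG_cng _ _ pis cn) (gtriple_K1 T).
Qed.

End Decomposition.

(** * The space H^pi *)

Section GenericCompletionPi.
Variables (C : numClosedFieldType) (N : nat) (A : algType C).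
Variables (u : 'M[A]_N) (Dinv : A) (star : A -> A) (eps : A -> C) (P : A -> A).
Variables (H : hilbertType C) (pi : A -> H -> H).

Definition ginner_pi (f g : H) : C :=
  \sum_(j < N) inner (pi (1 - u j j) f) (pi (1 - u j j) g)
  + inner (pi (1 - Dinv) f) (pi (1 - Dinv) g).

Definition gcompletion_pi (Hpi : hilbertType C) (iota : H -> Hpi) :=
  [/\ linear iota, forall f g, inner (iota f) (iota g) = ginner_pi f g
    & dense (range iota)].

Variables (Hpi : hilbertType C) (iota : H -> Hpi).

Definition gpi_ext (a : A) : Hpi -> H :=
  xget (fun=> 0)
    [set T | [/\ linear T, continuous T & forall f, T (iota f) = pi a f]].

Definition gpi_ext_adj (a : A) (f : Hpi) : Hpi :=
  xget 0 [set h | forall g : H, inner h (iota g) = inner (gpi_ext a f) g].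

Definition gpi_cocycle (f : Hpi) (a : A) : H := gpi_ext (a - eps a *: 1) f.

Definition gpi_functional (f : Hpi) (a : A) : C := inner f (gpi_ext_adj (P a) f).

Definition gng_pair (f : Hpi) :=
  [/\ gsrep star pi, gcng eps pi, gcompletion_pi iota
    & dense (range (gpi_cocycle f))].
End GenericCompletionPi.

Section HilbertPi.
Variables (R : realType) (q : R[i]) (N : nat) (A : algType R[i]).
Variables (u : 'M[A]_N) (Dinv : A) (star : A -> A) (eps : A -> R[i]).
Hypothesis q01 : 0 < q < 1.
Hypothesis Q : qgroup q u Dinv star eps.
Local Notation C := R[i].
Local Notation K := (gK eps).
Variable P : A -> A.
Hypothesis Pl : linear P.
Hypothesis PK : forall a, K 2 (P a).
Hypothesis Pid : forall a, K 2 a -> P a = a.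
Hypothesis Pstar : forall a, P (star a) = star (P a).
Hypothesis P1 : P 1 = 0.

Let q_gt0 : 0 < q. Proof. by case/andP: q01. Qed.
Let q_lt1 : q < 1. Proof. by case/andP: q01. Qed.

Section Bounds.
Variables (H : hilbertType C) (pi : A -> H -> H).
Hypothesis pis : gsrep star pi.
Local Notation ipi := (ginner_pi u Dinv pi).

Lemma ginner_pi_psd : psd_form ipi.
Proof.
split=> [x c y z|x y|x].
- rewrite /ginner_pi !(piL pis) innerDr innerZr mulrDr mulr_sumr addrACA; congr (_ + _).
  rewrite -big_split; apply: eq_bigr => j _ /=.
  by rewrite (piL pis) innerDr innerZr.
- rewrite /ginner_pi rmorphD rmorph_sum; congr (_ + _); last exact: innerC.
  by apply: eq_bigr => j _; exact: innerC.
- by rewrite addr_ge0 ?sumr_ge0 ?inner_norm ?exprn_ge0 // => j _; rewrite inner_norm exprn_ge0.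
Qed.

Variables (Hpi : hilbertType C) (iota : H -> Hpi).
Hypothesis iotal : linear iota.
Hypothesis iotaP : forall f g, inner (iota f) (iota g) = ipi f g.
Hypothesis iotad : seqdense iota.

Lemma iota_norm f : `|iota f| ^+ 2 =
  \sum_j `|pi (1 - u j j) f| ^+ 2 + `|pi (1 - Dinv) f| ^+ 2.
Proof.
rewrite -inner_norm iotaP /ginner_pi inner_norm; congr (_ + _).
by apply: eq_bigr => j _; rewrite inner_norm.
Qed.

(** The sum of norms dominates the Euclidean norm, and Cauchy estimates for it add up term by
    term. *)
Lemma iota_le_sum f :
  `|iota f| <= \sum_j `|pi (1 - u j j) f| + `|pi (1 - Dinv) f|.
Proof.
have sq (r : seq 'I_N) (F : 'I_N -> C) : (forall j, 0 <= F j) ->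
    \sum_(j <- r) F j ^+ 2 <= (\sum_(j <- r) F j) ^+ 2.
  move=> F0; elim: r => [|j r IH]; first by rewrite !big_nil expr0n.
  rewrite !big_cons sqrrD -addrA lerD2l (le_trans IH) // lerDr.
  by rewrite mulrn_wge0 // mulr_ge0 // sumr_ge0.
have S0 : 0 <= \sum_j `|pi (1 - u j j) f| by rewrite sumr_ge0.
rewrite -(@ler_pXn2r _ 2) ?nnegrE ?addr_ge0 // iota_norm sqrrD.
rewrite -addrA [X in _ <= _ + X]addrC addrA.
apply: le_trans (_ : _ <= (\sum_j `|pi (1 - u j j) f|) ^+ 2 + `|pi (1 - Dinv) f| ^+ 2) _.
  by rewrite lerD2r sq.
by rewrite lerDl mulrn_wge0 // mulr_ge0.
Qed.

Lemma iota_u j f : `|pi (1 - u j j) f| <= `|iota f|.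
Proof.
rewrite -(@ler_pXn2r _ 2) ?nnegrE // iota_norm (bigD1 j) //= -addrA lerDl.
by rewrite addr_ge0 ?exprn_ge0 // sumr_ge0 // => i _; rewrite exprn_ge0.
Qed.

Lemma iota_Dinv f : `|pi (1 - Dinv) f| <= `|iota f|.
Proof.
rewrite -(@ler_pXn2r _ 2) ?nnegrE // iota_norm lerDr.
by rewrite sumr_ge0 // => i _; rewrite exprn_ge0.
Qed.

(* For m = max (i, l) one has u_il (1 - u_mm) = (1 - q u_mm) u_il, and
   1 - q u_mm is bounded below by 1 - q. *)
Lemma iota_offdiag (i l : 'I_N) f : i != l ->
  (1 - q) * `|pi (u i l) f| <= `|iota f|.
Proof.
move=> il; have [h1 h2 _ _] := qg_qmat Q.
have [m hm] : exists m : 'I_N, u i l * u m m = q *: (u m m * u i l).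
  move: il; rewrite neq_ltn => /orP[il|li]; [exists l; exact: h1|exists i; exact: h2].
set y := pi (u i l) f.
have e : pi (u i l) (pi (1 - u m m) f) = y - q *: pi (u m m) y.
  rewrite (piB pis) (pi1 pis) (pivB pis) -/y; congr (_ - _).
  by rewrite -(piM pis) hm (piZ pis) (piM pis).
apply: le_trans (iota_u m f); apply: le_trans (pi_u_le Q pis i l _); rewrite e.
rewrite mulrBl mul1r (le_trans _ (lerB_dist _ _)) // lerB //.
rewrite normrZ (ger0_norm (ltW q_gt0)) ler_wpM2l ?(ltW q_gt0) //.
exact: (pi_u_le Q pis).
Qed.

(** The norm of H^pi involves only the u_jj and [Dinv]. The rule [ctrM] for centred products
    propagates the bound from the generators, with [iota_offdiag] for the off-diagonal ones. *)
Lemma iota_bounded a : eps a = 0 ->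
  exists2 M : C, 0 <= M & forall f, `|pi a f| <= M * `|iota f|.
Proof.
pose bd a := exists2 M : C, 0 <= M & forall f, `|pi a f| <= M * `|iota f|.
have bdD c x y : bd x -> bd y -> bd (c *: x + y).
  move=> [M M0 hM] [M' M0' hM']; exists (`|c| * M + M') => [|f].
    by rewrite addr_ge0 ?mulr_ge0.
  rewrite (piA pis) (le_trans (ler_normD _ _)) // mulrDl lerD //.
  by rewrite normrZ -mulrA ler_wpM2l.
have bd0 : bd 0.
  by exists 0 => // f; rewrite (pi0 pis) normr0 mul0r.
have bdZ c x : bd x -> bd (c *: x).
  by move=> bx; rewrite -[_ *: _]addr0; exact: bdD.
have bdN x : bd (- x) -> bd x by rewrite -{2}[x]opprK -(scaleN1r (- x)); exact: bdZ.
have bdM x y : bd y -> bd (x * y).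
  move=> [M M0 hM]; have [M' M0' hM'] := pi_bounded Q pis x.
  exists (M' * M) => [|f]; first by rewrite mulr_ge0.
  by rewrite (piM pis) (le_trans (hM' _)) // -mulrA ler_wpM2l.
suff h b : bd (ctr eps b) by move=> ea; rewrite -(ctr_id ea); exact: h.
apply: (qg_ind Q (P := fun b => bd (ctr eps b))) b => [|c x y hx hy|x y hx hy|j k|].
- by rewrite (ctr1 Q).
- by rewrite (ctr_lin Q); exact: bdD.
- by rewrite (ctrM Q) addrC; apply: bdD => //; exact: bdM.
- rewrite /ctr (qg_eps_u Q); have [->|jk] := eqVneq j k.
    apply: bdN; rewrite scale1r opprB; exists 1 => [|f]; first exact: ler01.
    by rewrite mul1r; exact: iota_u.
  rewrite scale0r subr0; exists (1 - q)^-1 => [|f].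
    by rewrite invr_ge0 subr_ge0 ltW.
  by rewrite ler_pdivlMl ?subr_gt0 //; exact: iota_offdiag.
- rewrite /ctr (qg_eps_Dinv Q); apply: bdN; rewrite scale1r opprB.
  by exists 1 => [|f]; [exact: ler01|rewrite mul1r; exact: iota_Dinv].
Qed.

Local Notation ext := (gpi_ext pi iota).

Lemma extP a : eps a = 0 ->
  [/\ linear (ext a), continuous (ext a) & forall f, ext a (iota f) = pi a f].
Proof.
move=> ea; have [M _ hM] := iota_bounded ea.
have [T [Tl Tb Te]] := dense_extension iotal (piL pis a) hM iotad.
have hT : [set T | [/\ linear T, continuous T & forall f, T (iota f) = pi a f]] T.
  by split=> //; exact: linear_bounded_cont Tb.
exact: (xgetI _ hT).
Qed.

Lemma ext_lin a : eps a = 0 -> linear (ext a). Proof. by case/extP. Qed.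
Lemma ext_tends a : eps a = 0 -> tends_cont (ext a).
Proof. by case/extP=> _ c _; exact: continuous_tends. Qed.
Lemma extE a f : eps a = 0 -> ext a (iota f) = pi a f.
Proof. by case/extP=> _ _. Qed.

Lemma ext_linear c a b F : eps a = 0 -> eps b = 0 ->
  ext (c *: a + b) F = c *: ext a F + ext b F.
Proof.
move=> ea eb; have eab : eps (c *: a + b) = 0 by rewrite (qg_eps Q) ea eb mulr0 addr0.
move: F; apply: (seqdense_eq iotad (ext_tends eab)) => [x l xl|f].
  by apply: tendsD; [apply: tendsZ|]; exact: ext_tends.
by rewrite !extE // (piA pis).
Qed.

Lemma extM a b F : eps b = 0 -> ext (a * b) F = pi a (ext b F).
Proof.
move=> eb; have eab : eps (a * b) = 0 by rewrite (eps_mul0 Q).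
move: F; apply: (seqdense_eq iotad (ext_tends eab)) => [x l xl|f].
  by apply: (pi_tends pis); exact: ext_tends.
by rewrite !extE // (piM pis).
Qed.

Lemma ext_bounded a : eps a = 0 -> exists M : C, forall F, `|ext a F| <= M * `|F|.
Proof.
move=> ea; have [M M0 hM] := iota_bounded ea; exists M => F.
have [s hs] := iotad F.
rewrite -(@ler_pXn2r _ 2) ?nnegrE ?mulr_ge0 // exprMn -!inner_norm -subr_ge0.
have t := tendsB (tendsM (tends_cst (M ^+ 2)) (tends_inner hs hs))
  (tends_inner (ext_tends ea hs) (ext_tends ea hs)).
apply: (tends_ge0 t) => n.
by rewrite subr_ge0 extE // !inner_norm -exprMn ler_pXn2r ?nnegrE ?mulr_ge0.
Qed.

Local Notation coc := (gpi_cocycle eps pi iota).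

Lemma coc_cocycle F : gcocycle eps pi (coc F).
Proof.
split=> [c a b|a b]; rewrite /gpi_cocycle -!/(ctr eps _).
  by rewrite (ctr_lin Q) ext_linear // (eps_ctr Q).
rewrite (ctrM Q) addrC ext_linear ?(eps_mul0 Q) ?(eps_ctr Q) //.
by rewrite extM ?(eps_ctr Q) // addrC.
Qed.

Lemma coc_K1 F a : eps a = 0 -> coc F a = ext a F.
Proof. by move=> ea; rewrite /gpi_cocycle ea scale0r subr0. Qed.

Local Notation adj := (gpi_ext_adj pi iota).

(** For a product a b the functional is <ext b F, pi(star a) g>. It is bounded in the norm of H^pi
    because star a lies in the kernel of the counit, and the Riesz representation applies in
    H^pi. *)
Lemma adj_ex a F : K 2 a -> exists h, forall g : H, inner h (iota g) = inner (ext a F) g.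
Proof.
suff X : K 2 a -> eps a = 0 /\ exists h, forall g : H, inner h (iota g) = inner (ext a F) g.
  by move=> /X[].
move: a; apply: gK2_ind => [|c a b [ea [h hh]] [eb [k hk]]|a b ea eb].
- split; first exact: (eps0 Q); exists 0 => g.
  have -> : ext 0 F = 0.
    by have := extM 0 F (eps0 Q); rewrite mul0r (pi0 pis).
  by rewrite !inner0l.
- split; first by rewrite (qg_eps Q) ea eb mulr0 addr0.
  exists (c *: h + k) => g.
  by rewrite ext_linear // !innerDl !innerZl hh hk.
- split; first exact: (eps_mul0 Q).
  have es := eps_star0 Q ea; have [M hM] := ext_bounded es.
  have [||h hh] := @riesz _ Hpi (fun G => inner (ext b F) (ext (star a) G)) (`|ext b F| * M).
  + by move=> c x y; rewrite (ext_lin es) innerDr innerZr.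
  + by move=> x; rewrite (le_trans (inner_CS _ _)) // -mulrA ler_wpM2l.
  by exists h => g; rewrite hh extE // extM // (pi_adj' Q pis).
Qed.

Lemma adjP a F g : K 2 a -> inner (adj a F) (iota g) = inner (ext a F) g.
Proof.
move=> Ka; have [h hh] := adj_ex F Ka.
exact: (xgetI _ (hh : [set h | forall g : H, inner h (iota g) = inner (ext a F) g] h)).
Qed.

Lemma adj_uniq a F h : K 2 a -> (forall g, inner h (iota g) = inner (ext a F) g) ->
  h = adj a F.
Proof.
move=> Ka hh; apply: (seqdense_inner_eq iotad) => g.
by rewrite innerC hh -(adjP _ _ Ka) -innerC.
Qed.

Lemma adj_linear c a b F : K 2 a -> K 2 b -> adj (c *: a + b) F = c *: adj a F + adj b F.
Proof.
move=> Ka Kb; apply/esym/adj_uniq => [|g]; first exact: gK_lin.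
by rewrite ext_linear ?(gK21 Q) // !innerDl !innerZl !adjP.
Qed.

Local Notation fnl := (gpi_functional P pi iota).

Lemma fnl_lin F : scalar (fnl F).
Proof. by move=> c a b; rewrite /gpi_functional Pl adj_linear // innerDr innerZr. Qed.

(** [F] is approximated by vectors [iota (s n)], for which both sides reduce to <pi(a) s_n, ext b
    F>. *)
Lemma fnl_K1 F a b : eps a = 0 -> eps b = 0 ->
  fnl F (star a * b) = inner (coc F a) (coc F b).
Proof.
move=> ea eb; have Ks : K 2 (star a * b) by apply: gK2M => //; exact: (eps_star0 Q).
rewrite /gpi_functional Pid // !coc_K1 //.
have [s hs] := iotad F.
apply: tends_unique (tends_inner hs (tends_cst _)) _.
apply: eq_tends (tends_inner (ext_tends ea hs) (tends_cst (ext b F))) => n.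
by rewrite extE // innerC [RHS]innerC adjP // extM // (pi_adj pis).
Qed.

(** On K_2 hermiticity is the symmetry of [fnl_K1] in its two arguments; [P], which commutes with
    the star, carries it to the whole algebra. *)
Lemma fnl_gGF F : gGF star eps (fnl F).
Proof.
have l := fnl_lin F.
have h1 : fnl F 1 = 0.
  rewrite /gpi_functional P1; have -> : adj 0 F = 0; last exact: inner0r.
  by have := adj_linear (-1) F (gK0 eps 2) (gK0 eps 2); rewrite !scaleN1r !addNr.
have hP a : fnl F (P a) = fnl F a by rewrite /gpi_functional Pid.
have hK a : K 2 a -> fnl F (star a) = (fnl F a)^*.
  move: a; apply: gK2_ind => [|c a b ha hb|a b ea eb].
  - by rewrite (gstar0 Q) (sc0 l) rmorph0.
  - by rewrite (qg_starP Q) !l ha hb rmorphD rmorphM.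
  - rewrite (qg_starM Q) fnl_K1 ?(eps_star0 Q) // -{2}[a](qg_starK Q).
    by rewrite fnl_K1 ?(eps_star0 Q) // -innerC.
split=> //.
- by move=> b; rewrite -hP Pstar hK // hP.
- by move=> b /(gK1P Q) eb; rewrite fnl_K1 // inner_norm exprn_ge0.
Qed.

Lemma fnl_P F a : fnl F (P a) = fnl F a.
Proof. by rewrite /gpi_functional Pid. Qed.

Lemma fnl_triple F : gtriple star eps pi (coc F) (fnl F).
Proof.
have [l _ h1 _] := fnl_gGF F.
apply: (gtripleP Q) => //; first exact: coc_cocycle.
by move=> a b ea eb; rewrite fnl_K1.
Qed.

Lemma vector_of_cocycle eta : gcocycle eps pi eta -> gcng eps pi ->
  exists F, forall a, coc F a = eta a.
Proof.
move=> ec cn; have [f hf] := cocycle_approx q01 Q pis ec.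
have hf0 a : eps a = 0 -> tends (fun n => pi a (f n)) (eta a).
  move=> ea; have := hf a; rewrite ea scale0r subr0.
  by have -> : eta a - proj_on (ggauss eps pi) (eta a) = eta a := etaNG_cng Q eta a pis cn.
have e1u j : eps (1 - u j j) = 0.
  by rewrite (epsB Q) (qg_eps1 Q) (qg_eps_u Q) eqxx subrr.
have e1D : eps (1 - Dinv) = 0 by rewrite (epsB Q) (qg_eps1 Q) (qg_eps_Dinv Q) subrr.
have cau : cauchyseq (fun n => iota (f n)).
  (* The distances of finitely many coboundaries from their limits dominate the distance of
     [iota (f m)] and [iota (f n)]. *)
  pose g n := \sum_j `|pi (1 - u j j) (f n) - eta (1 - u j j)|
    + `|pi (1 - Dinv) (f n) - eta (1 - Dinv)|.
  have gt : tends g 0.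
    have -> : (0 : C) = \sum_(j < N) 0 + 0 by rewrite big1 // addr0.
    apply: tendsD; first apply: tends_sum => j _; apply/tends_norm0/tends0P; exact: hf0.
  have le m n : `|iota (f m) - iota (f n)| <= g m + g n.
    rewrite -(linB iotal) (le_trans (iota_le_sum _)) // /g addrACA.
    have tri b : `|pi b (f m - f n)| <= `|pi b (f m) - eta b| + `|pi b (f n) - eta b|.
      by rewrite (pivB pis) [X in _ <= _ + X]distrC ler_distD.
    apply: lerD; last exact: tri.
    by rewrite -big_split; apply: ler_sum => j _; exact: tri.
  move=> e e0; have [n0 h] := gt _ (divr_gt0 e0 (ltr0n _ 2)); exists n0 => m n hm hn.
  apply: le_lt_trans (le m n) _.
  have g0 k : 0 <= g k by rewrite addr_ge0 ?sumr_ge0.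
  have := h m hm; have := h n hn; rewrite !subr0 !ger0_norm // => h1 h2.
  by rewrite [e]splitr ltrD.
have [F hF] := hilbert_complete cau; exists F => a.
rewrite /gpi_cocycle -/(ctr eps a) -[RHS](eta_center Q pis ec) -/(ctr eps a).
apply: tends_unique (ext_tends (eps_ctr Q a) hF) _.
apply: eq_tends (hf0 _ (eps_ctr Q a)) => n.
by rewrite extE ?(eps_ctr Q).
Qed.
End Bounds.

Lemma pair_cng (H Hpi : hilbertType C) (pi : A -> H -> H) (iota : H -> Hpi) F :
  gng_pair u Dinv star eps pi iota F ->
  gcngf star eps (gpi_functional P pi iota F) /\
  forall a, gpi_functional P pi iota F (P a) = gpi_functional P pi iota F a.
Proof.
move=> [pis cn [il iP /seqdenseP id] cyc]; split; last by move=> a; exact: fnl_P.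
split; first exact: (fnl_gGF pis il iP id F).
exists H, pi, (gpi_cocycle eps pi iota F); split=> //.
exact: (fnl_triple pis il iP id F).
Qed.

Lemma cng_pair psi : gcngf star eps psi -> (forall a, psi (P a) = psi a) ->
  exists (H : hilbertType C) (pi : A -> H -> H) (Hpi : hilbertType C) (iota : H -> Hpi)
    (F : Hpi), gng_pair u Dinv star eps pi iota F /\
    forall a, psi a = gpi_functional P pi iota F a.
Proof.
move=> [G [H [pi [eta [T cyc cn]]]]] pP; have [pis ec pl _] := T.
have [Hpi [iota [il iP id]]] := prehilbert_completion (ginner_pi_psd pis).
have [F hF] := vector_of_cocycle pis il iP id ec cn.
exists H, pi, Hpi, iota, F; split.
  split=> //; first by split=> //; exact/seqdenseP.
  by have -> : gpi_cocycle eps pi iota F = eta by apply/funext.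
move=> a; rewrite -pP -(fnl_P pi iota F).
apply: (K2_eq Q pl (fnl_lin pis il iP id F)) (PK a) => x y ex ey.
by rewrite (fnl_K1 pis il iP id) // !hF (gtriple_K1 Q T).
Qed.

(** Equal functionals give cocycles with equal inner products, hence a unitary matching them. It
    intertwines on the dense range because pi(a) eta(y) = eta(a y) - eps(y) eta(a). Conversely, the
    inner products determine both functionals on K_2, and [P] does the rest. *)
Lemma pair_uniq (H H' : hilbertType C) (pi : A -> H -> H) (pi' : A -> H' -> H')
    (Hpi Hpi' : hilbertType C) (iota : H -> Hpi) (iota' : H' -> Hpi') F F' :
  gng_pair u Dinv star eps pi iota F -> gng_pair u Dinv star eps pi' iota' F' ->
  ((forall a, gpi_functional P pi iota F a = gpi_functional P pi' iota' F' a) <->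
   exists V : H -> H',
     [/\ unitary V, forall a x, V (pi a x) = pi' a (V x)
       & forall a, V (gpi_cocycle eps pi iota F a) = gpi_cocycle eps pi' iota' F' a]).
Proof.
move=> [pis cn [il iP /seqdenseP id] cyc] [pis' cn' [il' iP' /seqdenseP id'] cyc'].
have T := fnl_triple pis il iP id F; have T' := fnl_triple pis' il' iP' id' F'.
have [_ ec l hin] := T; have [_ ec' l' hin'] := T'.
split=> [e|[V [[[Vl Vi] _] _ Ve]] a]; last first.
  rewrite -(fnl_P pi iota F) -(fnl_P pi' iota' F').
  apply: (K2_eq Q l l') (PK a) => x y ex ey.
  by rewrite -(gtriple_K1 Q T) // -(gtriple_K1 Q T') // -!Ve Vi.
have {}e := funext e; have hin2 x y : inner (gpi_cocycle eps pi iota F x)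
    (gpi_cocycle eps pi iota F y) =
  inner (gpi_cocycle eps pi' iota' F' x) (gpi_cocycle eps pi' iota' F' y).
  by rewrite hin hin' e.
have [V [[Vis Vr] Ve]] := gram_unitary (etaL ec) (etaL ec') hin2 cyc cyc'.
exists V; split=> // a; have [Vl Vi] := Vis.
have Vt : tends_cont V by apply: isometry_tends.
have /seqdenseP sd := cyc.
apply: (seqdense_eq sd) => [x l0 xl|x l0 xl|y].
- by apply: Vt; exact: (pi_tends pis).
- by apply: (pi_tends pis'); exact: Vt.
- have -> : pi a (gpi_cocycle eps pi iota F y) =
    gpi_cocycle eps pi iota F (a * y) - eps y *: gpi_cocycle eps pi iota F a.
    by rewrite (etaM ec) addrK.
  by rewrite (linB Vl) (linZ Vl) !Ve (etaM ec') addrK.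
Qed.
End HilbertPi.

(** * The classification *)

Section GenericTheorem.
Variables (R : realType) (q : R[i]) (N : nat) (A : algType R[i]).
Variables (u : 'M[A]_N) (Dinv : A) (star : A -> A) (eps : A -> R[i]).
Variable et : 'rV[R]_N -> A -> R[i].
Hypothesis N_gt0 : (0 < N)%N.
Hypothesis q01 : 0 < q < 1.
Hypothesis Q : qgroup q u Dinv star eps.
Hypothesis et_lin : forall x, scalar (et x).
Hypothesis etM : forall x, {morph et x : a b / a * b}.
Hypothesis et1 : forall x, et x 1 = 1.
Hypothesis et_u : forall x j k,
  et x (u j k) = expi (angle x (lift ord_max j)) *+ (j == k).
Hypothesis et_Dinv : forall x, et x Dinv = expi (angle x ord_max).
Variable P : A -> A.
Hypothesis PP : gprojP u Dinv star eps P.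
Local Notation C := R[i].
Local Notation K := (gK eps).

Local Notation quad := (gquad et).
Local Notation drift_t := (gdrift_term et).
Local Notation Kp := (K2proj u Dinv star eps et).

Let PE : P = Kp. Proof. exact: gprojP_uniq N_gt0 q01 Q et_lin etM et1 et_u et_Dinv _ PP. Qed.
Let Pl : linear P. Proof. by case: PP. Qed.
Let PK a : K 2 (P a). Proof. by case: PP => _ <- _ _; exists a. Qed.
Let Pid a : K 2 a -> P a = a. Proof. by case: PP => _ _ h _; exact: h. Qed.
Let Pstar a : P (star a) = star (P a).
Proof. rewrite PE; exact: (K2proj_star Q et_lin etM et1 et_u et_Dinv). Qed.
Let P1 : P 1 = 0.
Proof. rewrite PE; exact: (K2proj1 Q et1). Qed.
Let driftP r a : drift_t r (P a) = 0.
Proof. rewrite PE; eapply drift_K2proj; eassumption. Qed.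
Let quadP M a : quad M (P a) = quad M a.
Proof. rewrite PE; eapply quad_K2proj; eassumption. Qed.

Lemma gGF_decomposition psi : gGF star eps psi <->
  exists psiG psiL : A -> C, [/\ ggaussian star eps psiG, gcngf star eps psiL
    & forall a, psi a = psiG a + psiL a].
Proof.
split=> [G|[psiG [psiL [[G _] [L _] /funext ->]]]]; last exact: gGF_add.
have [psiG [psiL [D _]]] := gLK_ex q01 Q Pl PK Pid Pstar P1 G.
exists psiG, psiL; split.
- exact (gLK_gaussian Q D).
- exact (gLK_cng Q D).
- by case: D.
Qed.

Lemma gLK_existence_uniqueness psi : gGF star eps psi ->
  exists psiG psiL : A -> C,
    [/\ ggaussian star eps psiG, gcngf star eps psiL, gLK star eps psi psiG psiL,
        forall a, psiL (P a) = psiL a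
      & forall psiG' psiL' : A -> C, gLK star eps psi psiG' psiL' ->
          (forall a, psiL' (P a) = psiL' a) -> psiG' = psiG /\ psiL' = psiL].
Proof.
move=> G; have [psiG [psiL [D LP]]] := gLK_ex q01 Q Pl PK Pid Pstar P1 G.
exists psiG, psiL; split=> //; [exact (gLK_gaussian Q D)|exact (gLK_cng Q D)|].
by move=> psiG' psiL' D' LP'; exact: (gLK_uniq Q PK D D').
Qed.

(** The first equivalence states that every gaussian functional does occur as a gaussian part; it is
    the gaussian part of itself. *)
Lemma gaussian_classification psiG :
  [/\ ggaussian star eps psiG <->
        exists psi psiL : A -> C,
          [/\ gGF star eps psi, gLK star eps psi psiG psiL
            & forall a, psiL (P a) = psiL a],
      ggaussian star eps psiG <->
        exists (r : 'rV[R]_N) (M : 'M[R]_N),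
          psd M /\ forall a, psiG a = drift_t r a + quad M a
    & ggaussian star eps psiG ->
        exists! p : 'rV[R]_N * 'M[R]_N,
          psd p.2 /\ forall a, psiG a = drift_t p.1 a + quad p.2 a].
Proof.
have ex : ggaussian star eps psiG -> exists (r : 'rV[R]_N) (M : 'M[R]_N),
    psd M /\ forall a, psiG a = drift_t r a + quad M a.
  exact: (ggaussian_ex N_gt0 q01 Q et_lin etM et1 et_u et_Dinv).
split.
- split=> [G|[psi [psiL [_ D _]]]]; last exact (gLK_gaussian Q D).
  have [psiL [D LP]] := gaussian_gLK q01 Q Pl PK Pid Pstar P1 G.
  by exists psiG, psiL; split=> //; case: G.
- split=> // -[r [M [pM e]]].
  by eapply ggaussian_sum; eassumption.
- move=> /ex[r [M [pM e]]]; exists (r, M); split=> // -[r' M'] [/= pM' e'].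
  have [-> ->] : r = r' /\ M = M'; last by [].
  have e2 a : drift_t r a + quad M a = drift_t r' a + quad M' a by rewrite -e -e'.
  by eapply ggaussian_uniq; eassumption.
Qed.

Lemma gaussian_parameters (r r' : 'rV[R]_N) (M M' : 'M[R]_N) (psiG psiG' : A -> C) :
  psd M -> psd M' ->
  (forall a, psiG a = drift_t r a + quad M a) ->
  (forall a, psiG' a = drift_t r' a + quad M' a) ->
  [/\ forall a, psiG (P a) = quad M a,
      (forall a, psiG (P a) = psiG' (P a)) <-> M = M',
      forall a, psiG a - psiG (P a) = drift_t r a
    & gdrift star eps (drift_t r)].
Proof.
move=> pM pM' e e'.
have h a : psiG (P a) = quad M a by rewrite e driftP quadP add0r.
have h' a : psiG' (P a) = quad M' a by rewrite e' driftP quadP add0r.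
split=> //.
- split=> [hh|MM a]; last by rewrite h h' MM.
  have hq a : quad M a = quad M' a by rewrite -h -h'.
  by eapply quad_inj; eassumption.
- by move=> a; rewrite h e addrK.
- by eapply drift_gdrift; eassumption.
Qed.

Lemma cng_classification psiL :
  [/\ gcngf star eps psiL /\ (forall a, psiL (P a) = psiL a) <->
        exists psi psiG : A -> C,
          [/\ gGF star eps psi, gLK star eps psi psiG psiL
            & forall a, psiL (P a) = psiL a]
    & gcngf star eps psiL /\ (forall a, psiL (P a) = psiL a) <->
        exists (H : hilbertType C) (pi : A -> H -> H)
               (Hpi : hilbertType C) (iota : H -> Hpi) (f : Hpi),
          gng_pair u Dinv star eps pi iota f /\
          forall a, psiL a = gpi_functional P pi iota f a].
Proof.
split; split.
- move=> [L LP]; have [psiG D] := cng_gLK q01 Q Pl PK Pid Pstar P1 L LP.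
  by exists psiL, psiG; split=> //; case: L.
- by move=> [psi [psiG [_ D LP]]]; split=> //; exact (gLK_cng Q D).
- by move=> [L LP]; exact: (cng_pair q01 Q Pl PK Pid).
- move=> [H [pi [Hpi [iota [f [p /funext ->]]]]]].
  exact: (pair_cng q01 Q Pl PK Pid Pstar P1 p).
Qed.
Lemma pair_equivalence (H H' : hilbertType C) (pi : A -> H -> H) (pi' : A -> H' -> H')
    (Hpi Hpi' : hilbertType C) (iota : H -> Hpi) (iota' : H' -> Hpi') f f' :
  gng_pair u Dinv star eps pi iota f -> gng_pair u Dinv star eps pi' iota' f' ->
  ((forall a, gpi_functional P pi iota f a = gpi_functional P pi' iota' f' a) <->
   exists V : H -> H',
     [/\ unitary V, forall a x, V (pi a x) = pi' a (V x)
       & forall a, V (gpi_cocycle eps pi iota f a) = gpi_cocycle eps pi' iota' f' a]).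
Proof. by move=> h h'; exact: (pair_uniq q01 Q Pl PK Pid Pstar P1 h h'). Qed.
End GenericTheorem.

(** * Transfer to the algebra [Uq] *)

Section Instance.
Variables (R : realType) (q : R) (N : nat).
Hypotheses (hq : 0 < q < 1) (hN : (0 < N)%N).
Local Notation C := R[i].
Local Notation p := (q%:C%C : C).
Local Notation A := (Uq p N).

Lemma qC_itv : 0 < p < 1.
Proof. by case/andP: hq => h1 h2; rewrite !ltcR h1 h2. Qed.

Let p_gt0 : 0 < p. Proof. by case/andP: qC_itv. Qed.

Let one_rel : (\prod_(i < N) (1 : C)) * 1 = 1.
Proof. by rewrite big1 // mulr1. Qed.

Lemma Uq_qgroup : @qgroup C p N A (Uq_u p N) (Uq_Dinv p N) (Uq_star p N) (@counit C p N).
Proof.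
have [sl sM sK su sD] := Uq_starP p_gt0 hN.
split.
- exact: Uq_ind.
- exact: Uq_qmat.
- exact: (u_unitary_row p_gt0 hN).
- exact: (u_unitary_col p_gt0 hN).
- rewrite sD; exact: Uq_DinvD.
- rewrite sD; exact: Uq_DDinv.
- exact: sD.
- exact: (Dinv_central_u p_gt0 hN).
- exact: sl.
- exact: sM.
- exact: sK.
- exact: Uq_char_scalar one_rel.
- exact: Uq_charM one_rel.
- exact: Uq_char1 one_rel.
- move=> j k; exact: Uq_char_u one_rel j k.
- exact: Uq_char_Dinv one_rel.
Qed.

Local Notation et := (@eps_theta R q N).

Lemma eps_theta_scalar x : scalar (et x).
Proof. exact: Uq_char_scalar (eps_theta_rel x). Qed.
Lemma eps_thetaM x : {morph et x : a b / a * b}.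
Proof. exact: Uq_charM (eps_theta_rel x). Qed.
Lemma eps_theta1 x : et x 1 = 1.
Proof. exact: Uq_char1 (eps_theta_rel x). Qed.
Lemma eps_theta_u x j k : et x (Uq_u p N j k) = expi (angle x (lift ord_max j)) *+ (j == k).
Proof. exact: Uq_char_u (eps_theta_rel x) j k. Qed.
Lemma eps_theta_Dinv x : et x (Uq_Dinv p N) = expi (angle x ord_max).
Proof. exact: Uq_char_Dinv (eps_theta_rel x). Qed.

Lemma is_projPE (P : A -> A) : @is_projP C p N P =
  gprojP (Uq_u p N) (Uq_Dinv p N) (Uq_star p N) (@counit C p N) P.
Proof. by []. Qed.

(** [projP] is defined by choice; [K2proj] is the witness that makes the choice meaningful. *)
Lemma projP_gprojP : gprojP (Uq_u p N) (Uq_Dinv p N) (Uq_star p N) (@counit C p N) (projP p N).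
Proof.
rewrite -is_projPE; apply: (@xgetPex _ (fun a : A => a) (fun P => is_projP P)).
eexists; rewrite is_projPE.
exact: K2proj_gprojP hN qC_itv Uq_qgroup eps_theta_scalar eps_thetaM eps_theta1
  eps_theta_u eps_theta_Dinv.
Qed.
Local Notation st := (Uq_star p N).
Local Notation ep := (@counit C p N).
Local Notation uu := (Uq_u p N).
Local Notation Di := (Uq_Dinv p N).

(* The two sides are convertible; the kernel sees this at once, whereas the
   unifier gets lost in the construction of Uq. *)
Lemma generating_functionalE : @generating_functional C p N = gGF st ep.
Proof. exact_no_check (erefl (@generating_functional C p N)). Qed.
Lemma driftE : @drift C p N = gdrift st ep.
Proof. exact_no_check (erefl (@drift C p N)). Qed.
Lemma gaussianE : @gaussian C p N = ggaussian st ep.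
Proof. exact_no_check (erefl (@gaussian C p N)). Qed.
Lemma completely_nongaussianE : @completely_nongaussian C p N = gcngf st ep.
Proof. exact_no_check (erefl (@completely_nongaussian C p N)). Qed.
Lemma levy_khintchineE : @levy_khintchine C p N = gLK st ep.
Proof. exact_no_check (erefl (@levy_khintchine C p N)). Qed.
Lemma nongaussian_pairE : @nongaussian_pair C p N = @gng_pair C N A uu Di st ep.
Proof. exact_no_check (erefl (@nongaussian_pair C p N)). Qed.
Lemma pi_cocycleE : @pi_cocycle C p N = @gpi_cocycle C A ep.
Proof. exact_no_check (erefl (@pi_cocycle C p N)). Qed.
Lemma pi_functionalE : @pi_functional C p N = @gpi_functional C A (projP p N).
Proof. exact_no_check (erefl (@pi_functional C p N)). Qed.
Lemma drift_termE : @drift_term R q N = @gdrift_term R N A et.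
Proof. exact_no_check (erefl (@drift_term R q N)). Qed.
Lemma quadratic_termE : @quadratic_term R q N = @gquad R N A et.
Proof. exact_no_check (erefl (@quadratic_term R q N)). Qed.
End Instance.

Theorem theorem6p2 (R : realType) (q : R) (N : nat) (hq : 0 < q < 1)
    (hN : (0 < N)%N) :
  let A := Uq q%:C%C N in
  let P := projP q%:C%C N in
  (* generating functionals are the sums of gaussian and completely
     non-gaussian ones *)
  (forall psi : A -> R[i],
     generating_functional psi <->
     exists psiG psiL : A -> R[i],
       [/\ gaussian psiG, completely_nongaussian psiL
         & forall a, psi a = psiG a + psiL a])
  /\
  (* existence and uniqueness of the normalized Levy-Khintchine decomposition *)
  (forall psi : A -> R[i], generating_functional psi ->
     exists psiG psiL : A -> R[i],
       [/\ gaussian psiG, completely_nongaussian psiL,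
           levy_khintchine psi psiG psiL,
           forall a, psiL (P a) = psiL a
         & forall psiG' psiL' : A -> R[i],
             levy_khintchine psi psiG' psiL' ->
             (forall a, psiL' (P a) = psiL' a) ->
             psiG' = psiG /\ psiL' = psiL])
  /\
  (* the gaussian parts *)
  (forall psiG : A -> R[i],
     [/\ gaussian psiG <->
           exists psi psiL : A -> R[i],
             [/\ generating_functional psi, levy_khintchine psi psiG psiL
               & forall a, psiL (P a) = psiL a],
         gaussian psiG <->
           exists (r : 'rV[R]_N) (M : 'M[R]_N),
             psd M /\ forall a, psiG a = drift_term r a + quadratic_term M a
       & gaussian psiG ->
           exists! p : 'rV[R]_N * 'M[R]_N,
             psd p.2 /\
             forall a, psiG a = drift_term p.1 a + quadratic_term p.2 a])
  /\
  (forall (r r' : 'rV[R]_N) (M M' : 'M[R]_N) (psiG psiG' : A -> R[i]),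
     psd M -> psd M' ->
     (forall a, psiG a = drift_term r a + quadratic_term M a) ->
     (forall a, psiG' a = drift_term r' a + quadratic_term M' a) ->
     [/\ forall a, psiG (P a) = quadratic_term M a,
         (forall a, psiG (P a) = psiG' (P a)) <-> M = M',
         forall a, psiG a - psiG (P a) = drift_term r a
       & drift (drift_term r : A -> R[i])])
  /\
  (* the completely non-gaussian parts *)
  (forall psiL : A -> R[i],
     [/\ completely_nongaussian psiL /\ (forall a, psiL (P a) = psiL a) <->
           exists psi psiG : A -> R[i],
             [/\ generating_functional psi, levy_khintchine psi psiG psiL
               & forall a, psiL (P a) = psiL a]
       & completely_nongaussian psiL /\ (forall a, psiL (P a) = psiL a) <->
           exists (H : hilbertType R[i]) (pi : A -> H -> H)
                  (Hpi : hilbertType R[i]) (iota : H -> Hpi) (f : Hpi),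
             nongaussian_pair pi iota f /\
             forall a, psiL a = pi_functional pi iota f a])
  /\
  (forall (H H' : hilbertType R[i]) (pi : A -> H -> H) (pi' : A -> H' -> H')
          (Hpi Hpi' : hilbertType R[i]) (iota : H -> Hpi) (iota' : H' -> Hpi')
          (f : Hpi) (f' : Hpi'),
     nongaussian_pair pi iota f -> nongaussian_pair pi' iota' f' ->
     ((forall a, pi_functional pi iota f a = pi_functional pi' iota' f' a) <->
      exists V : H -> H',
        [/\ unitary V, forall a x, V (pi a x) = pi' a (V x)
          & forall a, V (pi_cocycle pi iota f a) = pi_cocycle pi' iota' f' a])).
Proof.
have q01 := qC_itv hq; have Q := Uq_qgroup hq hN; have PP := projP_gprojP hq hN.
have l := @eps_theta_scalar R q N; have m := @eps_thetaM R q N.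
have o := @eps_theta1 R q N; have hu := @eps_theta_u R q N; have hD := @eps_theta_Dinv R q N.
have h1 := gGF_decomposition hN q01 Q l m o hu hD PP.
have h2 := gLK_existence_uniqueness hN q01 Q l m o hu hD PP.
have h3 := gaussian_classification hN q01 Q l m o hu hD PP.
have h4 := gaussian_parameters hN q01 Q l m o hu hD PP.
have h5 := cng_classification hN q01 Q l m o hu hD PP.
have h6 := pair_equivalence hN q01 Q l m o hu hD PP.
move=> A P; subst A P.
rewrite (generating_functionalE q N) (driftE q N) (gaussianE q N).
rewrite (completely_nongaussianE q N) (levy_khintchineE q N).
rewrite (nongaussian_pairE q N) (pi_cocycleE q N) (pi_functionalE q N).
rewrite (drift_termE q N) (quadratic_termE q N).
exact (conj h1 (conj h2 (conj h3 (conj h4 (conj h5 h6))))).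
Qed.
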